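(* Let $\mu\in\mathbb{C}$ and let $B,C\in\mathcal{L}(\mathcal{K},\mathcal{H})$ be such that $\rho(A_B)\neq\emptyset$ and such that $\mu\in\rho(A_C)\cap\rho(A_{B+C})$ or $\mu\in\rho(A_C)\cap\rho(A_{B-C})$. Then $\mu$ is an isolated eigenvalue of finite algebraic multiplicity of the operator $A_B$ if and only if $\mu$ is a pole of finite multiplicity of $M_B(\cdot)$. In this case, the order of the pole of the resolvent $R(\cdot,A_B)$ at $\mu$ is the same as the order of the pole of $M_B(\cdot)$ at $\mu$.
   Context: Setting: $H$ is a complex Hilbert space; $A$ and $\widetilde{A}$ are closed densely defined operators on $H$ forming an adjoint pair, i.e. $A^*\supseteq\widetilde{A}$ and $\widetilde{A}^*\supseteq A$. $D(\widetilde{A}^* )$ and $D(A^* )$ carry their graph norms. A boundary triplet for the pair is fixed: Hilbert spaces $\mathcal{H},\mathcal{K}$ and linear operators $\Gamma_1:D(\widetilde{A}^* )\to\mathcal{H}$, $\Gamma_2:D(\widetilde{A}^* )\to\mathcal{K}$, $\widetilde{\Gamma}_1:D(A^* )\to\mathcal{K}$, $\widetilde{\Gamma}_2:D(A^* )\to\mathcal{H}$, bounded with respect to the graph norms and surjective, such that for $u\in D(\widetilde{A}^* )$, $v\in D(A^* )$ $$(\widetilde{A}^*u,v)_H-(u,A^*v)_H=(\Gamma_1u,\widetilde{\Gamma}_2v)_{\mathcal{H}}-(\Gamma_2u,\widetilde{\Gamma}_1v)_{\mathcal{K}},$$ and $D(A)=D(\widetilde{A}^* )\cap\ker\Gamma_1\cap\ker\Gamma_2$,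 $D(\widetilde{A})=D(A^* )\cap\ker\widetilde{\Gamma}_1\cap\ker\widetilde{\Gamma}_2$. For $B\in\mathcal{L}(\mathcal{K},\mathcal{H})$ (bounded operators), $A_B:=\widetilde{A}^*|_{\ker(\Gamma_1-B\Gamma_2)}$. For $\lambda\in\rho(A_B)$ the $M$-function $M_B(\lambda):\mathrm{Ran}(\Gamma_1-B\Gamma_2)\to\mathcal{K}$ is the (well-defined) linear operator with $M_B(\lambda)(\Gamma_1-B\Gamma_2)u=\Gamma_2u$ for all $u\in\ker(\widetilde{A}^*-\lambda)$. $R(\lambda,A_B)$ denotes the resolvent of $A_B$. Poles: $M_B(\cdot)$ has a pole of order $p\ge1$ at $\mu$ if a punctured neighbourhood of $\mu$ lies in $\rho(A_B)$ and on it $M_B(\lambda)f=\sum_{n\ge-p}(\lambda-\mu)^nM_nf$ for all $f\in\mathrm{Ran}(\Gamma_1-B\Gamma_2)$, with linear operators $M_n:\mathrm{Ran}(\Gamma_1-B\Gamma_2)\to\mathcal{K}$ and $M_{-p}\neq0$; the pole has finite multiplicity if $M_n$ has finite rank for all $n<0$. An isolated point of the spectrum has finite algebraic multiplicity if the associated Riesz spectral projection has finite rank. *)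

(* Defs.v *)
From HB Require Import structures.
From mathcomp Require Export all_boot all_order all_algebra.
From mathcomp Require Export sesquilinear complex.
From mathcomp Require Export all_classical all_reals all_analysis.
Set Implicit Arguments.
Unset Strict Implicit.
Unset Printing Implicit Defensive.
Export Order.TTheory GRing.Theory Num.Theory.
Export numFieldNormedType.Exports.

#[global] Open Scope classical_set_scope.
#[global] Open Scope ring_scope.

(* The inner product is linear in its first argument. *)
Record hilbert (R : realType) := Hilbert {
  hilbert_sort :> completeNormedModType R[i];
  inner : {dot hilbert_sort for Num.conj};
  inner_normE : forall x : hilbert_sort, inner x x = `|x| ^+ 2 }.
Arguments inner {R h}.

Section Operators.
Variable R : realType.
Local Notation C := R[i].

Definition is_subspace (V : lmodType C) (D : set V) :=
  D 0 /\ forall (a : C) (u v : V), D u -> D v -> D (a *: u + v).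

Definition linear_on (V W : lmodType C) (D : set V) (f : V -> W) :=
  forall (a : C) (u v : V), D u -> D v -> f (a *: u + v) = a *: f u + f v.

Definition finite_rank_on (V W : lmodType C) (D : set V) (f : V -> W) :=
  exists (d : nat) (e : 'I_d -> W), forall u, D u ->
    exists c : 'I_d -> C, f u = \sum_(i < d) c i *: e i.

(* A possibly unbounded operator in V: only the values of the underlying
   function on the domain are meaningful. *)
Record operator (V : Type) := Operator { dom : set V; op_fun :> V -> V }.

Definition is_linear (V : lmodType C) (T : operator V) :=
  is_subspace (dom T) /\ linear_on (dom T) T.

Definition extends (V : Type) (S T : operator V) :=
  dom T `<=` dom S /\ forall u, dom T u -> S u = T u.

Definition closed_operator (V : normedModType C) (T : operator V) :=
  closed [set p : V * V | dom T p.1 /\ p.2 = T p.1].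

(* When T is densely defined the vector chosen below is unique. *)
Definition adjoint (H : hilbert R) (T : operator H) : operator H :=
  let spec v w := forall u, dom T u -> inner (T u) v = inner u w in
  Operator [set v | exists w, spec v w] (fun v => xget 0 [set w | spec v w]).
Arguments adjoint : simpl never.

Definition graph_norm (V : normedModType C) (T : operator V) (u : V) : C :=
  sqrtC (`|u| ^+ 2 + `|T u| ^+ 2).

Definition graph_bounded (V W : normedModType C) (T : operator V)
    (f : V -> W) :=
  exists c : C, forall u, dom T u -> `|f u| <= c * graph_norm T u.

(* R(lambda, T) = (T - lambda)^-1 *)
Definition resolvent (V : normedModType C) (T : operator V) (lambda : C)
    (x : V) : V :=
  xget 0 [set u | dom T u /\ T u - lambda *: u = x].

Definition resolvent_set (V : normedModType C) (T : operator V) : set C :=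
  [set lambda | set_bij (dom T) setT (fun u => T u - lambda *: u)
                /\ continuous (resolvent T lambda)].

Definition spectrum (V : normedModType C) (T : operator V) : set C :=
  ~` resolvent_set T.

Definition is_eigenvalue (V : normedModType C) (T : operator V) (mu : C) :=
  exists u, [/\ dom T u, u != 0 & T u = mu *: u].

Definition punctured_disc (mu : C) (r : R) : set C :=
  [set lambda | 0 < `|lambda - mu| < r%:C%C].

Definition isolated_in_spectrum (V : normedModType C) (T : operator V)
    (mu : C) :=
  spectrum T mu /\
  exists2 r : R, 0 < r & punctured_disc mu r `<=` resolvent_set T.

(* The Riemann integral over [a, b], as the norm limit of the Riemann sums
   over tagged partitions t 0 <= ... <= t n with tags xi. *)
Definition is_Riemann_int (V : normedModType C) (f : R -> V) (a b : R)
    (I : V) :=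
  forall e : R, 0 < e -> exists2 d : R, 0 < d &
    forall (n : nat) (t xi : nat -> R),
      t 0%N = a -> t n = b ->
      (forall k, (k < n)%N ->
         t k <= xi k <= t k.+1 /\ t k.+1 - t k < d) ->
      `|\sum_(k < n) (t k.+1 - t k)%:C%C *: f (xi k) - I| < e%:C%C.

Definition cis (t : R) : C := (cos t +i* sin t)%C.

(* I is the contour integral of f over the positively oriented circle
   lambda = mu + r e^(it), so d lambda = i r e^(it) dt. *)
Definition is_circle_int (V : normedModType C) (mu : C) (r : R) (f : C -> V)
    (I : V) :=
  is_Riemann_int (fun t => ('i%C * r%:C%C * cis t) *: f (mu + r%:C%C * cis t))
    0 (2 * pi) I.

(* P = - (2 pi i)^-1 \oint (T - lambda)^-1 d lambda (strongly), over a circle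
   enclosing no point of the spectrum of T other than mu. *)
Definition is_Riesz_projection (V : normedModType C) (T : operator V)
    (mu : C) (P : V -> V) :=
  exists r : R, [/\ 0 < r,
    [set lambda | 0 < `|lambda - mu| <= r%:C%C] `<=` resolvent_set T &
    forall x, exists2 I : V,
      is_circle_int mu r (fun lambda => resolvent T lambda x) I &
      P x = - (2 * (pi : R)%:C%C * 'i%C)^-1 *: I].

Definition finite_algebraic_multiplicity (V : normedModType C)
    (T : operator V) (mu : C) :=
  exists2 P : V -> V, is_Riesz_projection T mu P & finite_rank_on setT P.

Definition isolated_eigenvalue_of_finite_multiplicity (V : normedModType C)
    (T : operator V) (mu : C) :=
  [/\ is_eigenvalue T mu, isolated_in_spectrum T mu &
      finite_algebraic_multiplicity T mu].

(* The partial sum of \sum_(n >= -p) (lambda - mu)^n M_n f over the indices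
   -p <= n < N - p. *)
Definition Laurent_sum (V : Type) (W : lmodType C) (mu : C) (p : nat)
    (M : int -> V -> W) (lambda : C) (f : V) (N : nat) : W :=
  \sum_(k < N) (lambda - mu) ^ (k%:Z - p%:Z) *: M (k%:Z - p%:Z) f.

(* The Laurent expansion of the resolvent, in operator norm, with bounded
   coefficients. *)
Definition resolvent_pole (V : normedModType C) (T : operator V)
    (mu : C) (p : nat) :=
  (0 < p)%N /\
  exists2 r : R, 0 < r & punctured_disc mu r `<=` resolvent_set T /\
  exists M : int -> {linear V -> V},
    [/\ forall n, - p%:Z <= n -> continuous (M n),
        exists x, M (- p%:Z) x != 0 &
        forall lambda, punctured_disc mu r lambda ->
        forall e : R, 0 < e -> \forall N \near \oo, forall x,
          `|Laurent_sum mu p (fun n => M n) lambda x N - resolvent T lambda x|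
          <= e%:C%C * `|x|].

End Operators.

Section BoundaryTriplets.
Variables (R : realType) (H G K : hilbert R).
Local Notation C := R[i].

Definition adjoint_pair (A At : operator H) :=
  extends (adjoint A) At /\ extends (adjoint At) A.

(* G1, G2 and Gt1, Gt2 are only considered on the domains of the adjoints of
   At and of A respectively. *)
Record boundary_triplet (A At : operator H)
    (G1 : H -> G) (G2 : H -> K) (Gt1 : H -> K) (Gt2 : H -> G) : Prop := {
  bt_linear :
    [/\ linear_on (dom (adjoint At)) G1, linear_on (dom (adjoint At)) G2,
        linear_on (dom (adjoint A)) Gt1 & linear_on (dom (adjoint A)) Gt2];
  bt_bounded :
    [/\ graph_bounded (adjoint At) G1, graph_bounded (adjoint At) G2,
        graph_bounded (adjoint A) Gt1 & graph_bounded (adjoint A) Gt2];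
  bt_surjective :
    [/\ G1 @` dom (adjoint At) = setT, G2 @` dom (adjoint At) = setT,
        Gt1 @` dom (adjoint A) = setT & Gt2 @` dom (adjoint A) = setT];
  bt_Green : forall u v, dom (adjoint At) u -> dom (adjoint A) v ->
    inner (adjoint At u) v - inner u (adjoint A v) =
    inner (G1 u) (Gt2 v) - inner (G2 u) (Gt1 v);
  bt_dom : dom A = [set u | [/\ dom (adjoint At) u, G1 u = 0 & G2 u = 0]];
  bt_domt : dom At = [set v | [/\ dom (adjoint A) v, Gt1 v = 0 & Gt2 v = 0]]
}.

(* A_B, the restriction of the adjoint of At to ker (G1 - B G2) *)
Definition restr (At : operator H) (G1 : H -> G) (G2 : H -> K) (B : K -> G) :
    operator H :=
  Operator [set u | dom (adjoint At) u /\ G1 u - B (G2 u) = 0] (adjoint At).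

Definition bran (At : operator H) (G1 : H -> G) (G2 : H -> K) (B : K -> G) :
    set G :=
  (fun u => G1 u - B (G2 u)) @` dom (adjoint At).

(* For lambda in the resolvent set of A_B and f in bran At G1 G2 B there is
   exactly one u as below; see MfunE for uniqueness. *)
Definition Mfun (At : operator H) (G1 : H -> G) (G2 : H -> K) (B : K -> G)
    (lambda : C) (f : G) : K :=
  G2 (xget 0 [set u | [/\ dom (adjoint At) u, adjoint At u = lambda *: u
                        & G1 u - B (G2 u) = f]]).

Lemma MfunE (At : operator H) (G1 : H -> G) (G2 : H -> K)
    (B : {linear K -> G}) (lambda : C) (u : H) :
  is_linear (adjoint At) ->
  linear_on (dom (adjoint At)) G1 -> linear_on (dom (adjoint At)) G2 ->
  resolvent_set (restr At G1 G2 B) lambda ->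
  dom (adjoint At) u -> adjoint At u = lambda *: u ->
  Mfun At G1 G2 B lambda (G1 u - B (G2 u)) = G2 u.
Proof.
move=> [[D0 Dlin] Alin] G1lin G2lin [[_ inj _] _] Du Au.
rewrite /Mfun; case: xgetP => [v _ [Dv Av Gv]|/(_ u)]; last by case.
suff -> : v = u by [].
have Dw : dom (adjoint At) ((-1) *: u + v) by exact: Dlin.
have Tw : dom (restr At G1 G2 B) ((-1) *: u + v).
  split=> //; rewrite G1lin // G2lin // linearP !scaleN1r opprD opprK.
  rewrite addrACA Gv [- G1 u + _]addrC -opprB.
  by rewrite addNr.
have T0 : dom (restr At G1 G2 B) 0.
  have E0 : 0 = (-1) *: u + u by rewrite scaleN1r addNr.
  split=> //; rewrite E0 G1lin // G2lin // linearP !scaleN1r !addNr.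
  by rewrite subrr.
have A0 : adjoint At 0 = 0.
  by have := Alin (-1) _ _ D0 D0; rewrite scaler0 addr0 scaleN1r addNr.
suff /eqP : (-1) *: u + v = 0 by rewrite scaleN1r addrC subr_eq0 => /eqP.
apply: inj; rewrite ?inE //.
change (adjoint At ((-1) *: u + v) - lambda *: ((-1) *: u + v) =
        adjoint At 0 - lambda *: 0).
rewrite A0 scaler0 subrr Alin // Au Av.
by rewrite scalerDr !scalerA mulrC subrr.
Qed.

Definition M_Laurent (At : operator H) (G1 : H -> G) (G2 : H -> K)
    (B : K -> G) (mu : C) (p : nat) (M : int -> G -> K) :=
  [/\ (0 < p)%N,
      forall n, - p%:Z <= n -> linear_on (bran At G1 G2 B) (M n),
      exists2 f, bran At G1 G2 B f & M (- p%:Z) f != 0 &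
      exists2 r : R, 0 < r &
        punctured_disc mu r `<=` resolvent_set (restr At G1 G2 B) /\
        forall lambda f, punctured_disc mu r lambda -> bran At G1 G2 B f ->
          Laurent_sum mu p M lambda f @ \oo --> Mfun At G1 G2 B lambda f].

Definition M_pole (At : operator H) (G1 : H -> G) (G2 : H -> K)
    (B : K -> G) (mu : C) (p : nat) :=
  exists M, M_Laurent At G1 G2 B mu p M.

Definition M_pole_of_finite_multiplicity (At : operator H) (G1 : H -> G)
    (G2 : H -> K) (B : K -> G) (mu : C) :=
  exists p M, M_Laurent At G1 G2 B mu p M /\
    forall n, - p%:Z <= n < 0 -> finite_rank_on (bran At G1 G2 B) (M n).

End BoundaryTriplets.

(* Main.v *)
Require Import Defs.
From HB Require Import structures.
From mathcomp Require Import ring lra zify.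
Set Implicit Arguments.
Unset Strict Implicit.
Unset Printing Implicit Defensive.

(** Write [T] for the adjoint of [At], [A_B] for the restriction of [T] to the kernel
of [G1 - B G2], [R(z)] for the resolvent of [A_B] at [mu + z], and [S] for the
resolvent of [A_C] at [mu]. Two formulas relate the resolvent of [A_B] and the
M-function near [mu], both with outer factors that do not depend on [z].

In the first one ([M_resolvent]) the M-function is, up to terms that are
polynomial in [z], the map [(mu + z - l0)^2 J R(z)] applied to the solution of the
boundary problem at a fixed point [l0], where [J] is [G2] after the resolvent of
[A_B] at [l0], a bounded operator. So a Laurent expansion of [R] gives one of the
M-function, with a pole of at most the same order and coefficients of finite
rank whenever those of [R] have finite rank.

The second one ([resolvent_sandwich]) expresses [(1 - z S) R(z) (1 - z S) x] by the
M-function applied to the fixed boundary data of [S x]. It rests on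
[boundary_values]: by Green's identity, tested on the range of the adjoint of [S],
the part [u - S (T u - mu u)] of [u] is a bounded function of the two boundary
values of [u]. Since the range of [G1 - B G2] need not be closed and the
coefficients of the M-function need not be bounded, the expansion is at first
only known vector by vector. Cauchy's estimate on a circle ([cauchy_bound]) turns
it into an expansion with bounded coefficients, and dividing by [1 - z S] on both
sides ([div_left], [div_right]) yields the Laurent expansion of [R]
([laurent_from_M]).

It remains to identify isolated eigenvalues of finite algebraic multiplicity
with poles of the resolvent whose principal part has finite rank. If the Riesz
projection [P] has finite rank, averaging the resolvent over a circle gives a
bounded [Q] with [(T - mu) Q = 1 - P] ([riesz_parametrix]); linear algebra on the
range of [P] then produces the Laurent expansion ([riesz_laurent]). Conversely the
leading coefficient of a pole consists of eigenvectors and the residue is minus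
the Riesz projection ([laurent_isolated]).

The orders agree because each formula passes to the limit after multiplication
by a power of [z]: the leading coefficient on one side vanishes if the one on the
other side does ([M_limit], [resolvent_limit]), and the order of a pole is
determined by such limits ([order_uniq]). *)

(** * Real-valued norms, bounded operators and limits *)

Section RealNorm.
Variable R : realType.
Local Notation C := R[i].

Lemma rcD (x y : R) : ((x + y)%:C = x%:C + y%:C :> C)%C.
Proof. exact: rmorphD. Qed.

Lemma rcM (x y : R) : ((x * y)%:C = x%:C * y%:C :> C)%C.
Proof. exact: rmorphM. Qed.

Lemma rcN (x : R) : ((- x)%:C = - x%:C :> C)%C.
Proof. exact: rmorphN. Qed.

Lemma rcV (x : R) : ((x^-1)%:C = (x%:C)^-1 :> C)%C.
Proof. exact: fmorphV. Qed.

Lemma rcX (x : R) n : ((x ^+ n)%:C = x%:C ^+ n :> C)%C.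
Proof. exact: rmorphXn. Qed.

(** Norms over the complex scalars take values in the complex numbers, where the
order is partial; estimates are made with this real-valued copy. *)
Definition nrm (V : normedZmodType C) (x : V) : R := complex.Re `|x|.

Lemma nrmE (V : normedZmodType C) (x : V) : `|x| = (nrm x)%:C%C.
Proof. by rewrite /nrm RRe_real // normr_real. Qed.

Lemma nrm_ge0 (V : normedZmodType C) (x : V) : 0 <= nrm x.
Proof. by rewrite -lecR -nrmE normr_ge0. Qed.

Lemma nrm_eq0 (V : normedZmodType C) (x : V) : (nrm x == 0) = (x == 0).
Proof. by rewrite -[RHS]normr_eq0 nrmE -(inj_eq (@complexI R)). Qed.

Lemma nrm0 (V : normedZmodType C) : nrm (0 : V) = 0.
Proof. by apply/eqP; rewrite nrm_eq0. Qed.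

Lemma nrm_gt0 (V : normedZmodType C) (x : V) : (0 < nrm x) = (x != 0).
Proof. by rewrite lt_def nrm_ge0 andbT nrm_eq0. Qed.

Lemma nrmD (V : normedZmodType C) (x y : V) : nrm (x + y) <= nrm x + nrm y.
Proof. by rewrite -lecR rcD -!nrmE ler_normD. Qed.

Lemma nrmN (V : normedZmodType C) (x : V) : nrm (- x) = nrm x.
Proof. by rewrite /nrm normrN. Qed.

Lemma nrmB (V : normedZmodType C) (x y : V) : nrm (x - y) <= nrm x + nrm y.
Proof. by rewrite -(nrmN y) nrmD. Qed.

Lemma nrmBC (V : normedZmodType C) (x y : V) : nrm (x - y) = nrm (y - x).
Proof. by rewrite -nrmN opprB. Qed.

Lemma nrm_triB (V : normedZmodType C) (y x z : V) :
  nrm (x - z) <= nrm (x - y) + nrm (y - z).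
Proof. by rewrite -[x - z](subrKA y) nrmD. Qed.

Lemma nrm_sum (V : normedZmodType C) (I : Type) (s : seq I) (P : pred I)
    (F : I -> V) :
  nrm (\sum_(i <- s | P i) F i) <= \sum_(i <- s | P i) nrm (F i).
Proof.
elim/big_rec2: _ => [|i a b _ H]; first by rewrite nrm0.
by rewrite (le_trans (nrmD _ _)) // lerD2l.
Qed.

Lemma nrmZ (V : normedModType C) (a : C) (x : V) :
  nrm (a *: x) = nrm a * nrm x.
Proof. by apply: (@complexI R); rewrite rcM -!nrmE normrZ. Qed.

Lemma nrmM (a b : C) : nrm (a * b) = nrm a * nrm b.
Proof. by apply: (@complexI R); rewrite rcM -!nrmE normrM. Qed.

Lemma nrm1 : nrm (1 : C) = 1.
Proof. by apply: (@complexI R); rewrite -nrmE normr1. Qed.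

Lemma nrmX (a : C) n : nrm (a ^+ n) = nrm a ^+ n.
Proof. by elim: n => [|n IH]; rewrite ?expr0 ?nrm1 // !exprS nrmM IH. Qed.

Lemma nrmV (a : C) : nrm a^-1 = (nrm a)^-1.
Proof. by apply: (@complexI R); rewrite rcV -!nrmE normfV. Qed.

Lemma nrm_real (r : R) : nrm (r%:C%C : C) = `|r|.
Proof. by rewrite /nrm normc_def /= expr0n addr0 sqrtr_sqr. Qed.

Lemma nrm_ReIm (z : C) : nrm z <= `|complex.Re z| + `|complex.Im z|.
Proof.
rewrite /nrm normc_def /= -[leRHS]ger0_norm ?addr_ge0 // -sqrtr_sqr.
rewrite ler_wsqrtr // sqrrD !real_normK ?num_real // lerD2r lerDl.
by rewrite mulrn_wge0 // mulr_ge0.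
Qed.

Lemma nrm_conj (z : C) : nrm (Num.conj z) = nrm z.
Proof. by rewrite /nrm norm_conjC. Qed.

Lemma nrm_real_gt0 (r : R) : 0 < r -> nrm (r%:C%C : C) = r.
Proof. by move=> r0; rewrite nrm_real gtr0_norm. Qed.

Lemma gt0_realC (e : C) : 0 < e -> exists2 r : R, 0 < r & e = r%:C%C.
Proof.
move=> e0; exists (complex.Re e); last by rewrite RRe_real // gtr0_real.
by rewrite -ltcR RRe_real // gtr0_real.
Qed.

Lemma cvg_nrmP (V : normedModType C) (u : nat -> V) (l : V) :
  u @ \oo --> l <->
  forall e : R, 0 < e -> exists N, forall n, (N <= n)%N -> nrm (u n - l) < e.
Proof.
split => [/cvgrPdist_lt H e e0|H].
  have [|N _ HN] := H e%:C%C; first by rewrite ltcR.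
  by exists N => n Nn; have := HN n Nn; rewrite nrmE ltcR nrmBC.
apply/cvgrPdist_lt => e /gt0_realC [r r0 ->]; have [N HN] := H r r0.
by exists N => // n /= Nn; rewrite nrmE ltcR nrmBC HN.
Qed.

Lemma cvg_nrm_uniq (V : normedModType C) (u : nat -> V) (l m : V) :
  u @ \oo --> l -> u @ \oo --> m -> l = m.
Proof. by move=> ul um; apply: (cvg_unique _ ul um); apply: norm_hausdorff. Qed.

Lemma cauchy_cvg_nrm (V : completeNormedModType C) (u : nat -> V) :
  (forall e : R, 0 < e -> exists N, forall m n,
     (N <= m)%N -> (N <= n)%N -> nrm (u m - u n) < e) ->
  exists l : V, u @ \oo --> l.
Proof.
move=> H; suff /cauchy_cvgP ul : cauchy (u @ \oo) by exists (lim (u @ \oo)).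
apply: cauchy_exP => e /gt0_realC [r r0 ->]; have [N HN] := H r r0.
exists (u N); exists N => // n /= Nn.
by rewrite -ball_normE /= nrmE ltcR HN.
Qed.

(** Bounded operators are kept as bare functions: resolvents, adjoints and Laurent
coefficients arise from choice or recursion, and their linearity is only known
afterwards. *)
Definition blin (V W : normedModType C) (f : V -> W) :=
  linear f /\ exists c : R, forall x, nrm (f x) <= c * nrm x.

Section Blin.
Variables (V W : normedModType C) (f : V -> W).
Hypothesis lf : linear f.

Lemma lin0 : f 0 = 0.
Proof. by have := lf (-1) 0 0; rewrite scaler0 addr0 scaleN1r addNr. Qed.

Lemma linDf x y : f (x + y) = f x + f y.
Proof. by have := lf 1 x y; rewrite !scale1r. Qed.

Lemma linZf a x : f (a *: x) = a *: f x.
Proof. by have := lf a x 0; rewrite !addr0 lin0 addr0. Qed.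

Lemma linNf x : f (- x) = - f x.
Proof. by rewrite -scaleN1r linZf scaleN1r. Qed.

Lemma linBf x y : f (x - y) = f x - f y.
Proof. by rewrite linDf linNf. Qed.

Lemma lin_sum (I : Type) (s : seq I) (P : pred I) (F : I -> V) :
  f (\sum_(i <- s | P i) F i) = \sum_(i <- s | P i) f (F i).
Proof. by apply: (big_morph f linDf lin0). Qed.
End Blin.

Lemma linear_bundle (V W : lmodType C) (f : V -> W) : linear f ->
  exists F : {linear V -> W}, F =1 f.
Proof.
move=> lf; pose m := GRing.isLinear.Build C V W *:%R f lf.
by pose F : {linear V -> W} := HB.pack f m; exists F.
Qed.

Lemma blin_gt0 (V W : normedModType C) (f : V -> W) : blin f ->
  exists2 c : R, 0 < c & forall x, nrm (f x) <= c * nrm x.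
Proof.
move=> [_ [c fc]]; exists (`|c| + 1); first by rewrite ltr_wpDl.
move=> x; apply: (le_trans (fc x)); rewrite ler_wpM2r ?nrm_ge0 //.
by rewrite (le_trans (ler_norm c)) // lerDl.
Qed.

Lemma blin_id (V : normedModType C) : blin (@id V).
Proof. by split=> //; exists 1 => x; rewrite mul1r. Qed.

Lemma blin_comp (U V W : normedModType C) (f : V -> W) (g : U -> V) :
  blin f -> blin g -> blin (f \o g).
Proof.
move=> hf [lg [d gd]]; have [c c0 fc] := blin_gt0 hf; split.
  by move=> a x y /=; rewrite lg hf.1.
exists (c * d) => x /=; rewrite (le_trans (fc _)) // -mulrA.
by rewrite ler_wpM2l ?gd // ltW.
Qed.

Lemma blinD (V W : normedModType C) (f g : V -> W) :
  blin f -> blin g -> blin (fun x => f x + g x).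
Proof.
move=> [lf [c fc]] [lg [d gd]]; split.
  by move=> a x y; rewrite lf lg scalerDr addrACA.
exists (c + d) => x; rewrite (le_trans (nrmD _ _)) // mulrDl.
by rewrite lerD.
Qed.

Lemma blinZ (V W : normedModType C) (a : C) (f : V -> W) :
  blin f -> blin (fun x => a *: f x).
Proof.
move=> [lf [c fc]]; split.
  by move=> b x y; rewrite lf scalerDr !scalerA mulrC.
exists (nrm a * c) => x; rewrite nrmZ -mulrA.
by rewrite ler_wpM2l ?nrm_ge0.
Qed.

Lemma eq_blin (V W : normedModType C) (f g : V -> W) :
  f =1 g -> blin f -> blin g.
Proof. by move=> /funext ->. Qed.

Lemma blinN (V W : normedModType C) (f : V -> W) :
  blin f -> blin (fun x => - f x).
Proof.
by move=> hf; apply: eq_blin (blinZ (-1) hf) => x; rewrite scaleN1r.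
Qed.

Lemma blinB (V W : normedModType C) (f g : V -> W) :
  blin f -> blin g -> blin (fun x => f x - g x).
Proof. by move=> hf hg; apply: blinD => //; apply: blinN. Qed.

Lemma blin0 (V W : normedModType C) : blin (fun _ : V => 0 : W).
Proof.
split; first by move=> a x y; rewrite scaler0 addr0.
by exists 0 => x; rewrite nrm0 mul0r.
Qed.

Lemma blin_sum (V W : normedModType C) (F : nat -> V -> W) n :
  (forall k, (k < n)%N -> blin (F k)) -> blin (fun x => \sum_(k < n) F k x).
Proof.
elim: n => [|n IH] H.
  by apply: eq_blin (blin0 V W) => x; rewrite big_ord0.
apply: (@eq_blin _ _ (fun x => \sum_(k < n) F k x + F n x)).
  by move=> x; rewrite big_ord_recr.
by apply: blinD; [apply: IH => k kn; apply: H; apply: ltnW|apply: H].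
Qed.

Lemma blin_iter (V : normedModType C) (f : V -> V) n :
  blin f -> blin (fun x => iter n f x).
Proof.
move=> hf; elim: n => [|n IH]; first exact: blin_id.
exact: (blin_comp hf IH).
Qed.

Lemma blin_cvg (V W : normedModType C) (f : V -> W) (u : nat -> V) l :
  blin f -> u @ \oo --> l -> (fun n => f (u n)) @ \oo --> f l.
Proof.
move=> hf /cvg_nrmP ul; have [c c0 fc] := blin_gt0 hf.
apply/cvg_nrmP => e e0; have [N HN] := ul (e / c) (divr_gt0 e0 c0).
exists N => n Nn; rewrite -(linBf hf.1) (le_lt_trans (fc _)) //.
by rewrite mulrC -ltr_pdivlMr // HN.
Qed.

Lemma blin_continuous (V W : normedModType C) (f : {linear V -> W}) :
  continuous f <-> blin f.
Proof.
split=> [/linear_bounded_continuous/linear_boundedP H|[_ [c fc]]].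
  split; first by move=> a x y; rewrite linearP.
  have [M [Mr HM]] := H.
  have M1 : M < M + 1 by rewrite ltrDl.
  have E : M + 1 = (complex.Re (M + 1 : C))%:C%C by rewrite RRe_real ?realD ?real1.
  exists (complex.Re (M + 1 : C)) => x; have := HM _ M1 x.
  by rewrite {1}E !nrmE -rcM lecR.
apply/linear_bounded_continuous/linear_boundedP.
exists c%:C%C; split.
  by rewrite realE (lecR 0 c) (lecR c 0) -realE num_real.
move=> M cM x; rewrite (@le_trans _ _ (c%:C%C * `|x|)) //.
  by rewrite !nrmE -rcM lecR.
by rewrite ler_wpM2r // ltW.
Qed.

(** The punctured limit at 0. The functions concerned are of the form
[z ^+ p *: R (mu + z)] and carry no information at [z = 0]. *)
Definition lim0 (V : normedModType C) (g : C -> V) (l : V) :=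
  forall e : R, 0 < e -> exists2 d : R, 0 < d &
    forall z, 0 < nrm z < d -> nrm (g z - l) < e.

Lemma lim0_uniq (V : normedModType C) (g : C -> V) l m :
  lim0 g l -> lim0 g m -> l = m.
Proof.
move=> gl gm; apply/eqP; rewrite -subr_eq0 -nrm_eq0; apply/eqP.
apply/le_anti; rewrite nrm_ge0 andbT leNgt; apply/negP => e0.
have e20 := divr_gt0 e0 (ltr0n R 2).
have [d d0 Hd] := gl _ e20; have [d' d'0 Hd'] := gm _ e20.
pose z : C := ((Num.min d d') / 2)%:C%C.
have m0 : 0 < Num.min d d' by rewrite lt_min d0.
have zE : nrm z = Num.min d d' / 2 by rewrite nrm_real_gt0 // divr_gt0.
have z0 : 0 < nrm z < Num.min d d' by rewrite zE; apply/andP; split; lra.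
have [z1 z2] := andP z0.
move: z2; rewrite lt_min => /andP[z2 z3].
have H1 := Hd z; rewrite z1 z2 in H1; have {}H1 := H1 isT.
have H2 := Hd' z; rewrite z1 z3 in H2; have {}H2 := H2 isT.
have := nrm_triB (g z) l m; rewrite (nrmBC l (g z)); lra.
Qed.

Lemma lim0_ext (V : normedModType C) (g h : C -> V) l (r : R) : 0 < r ->
  (forall z, 0 < nrm z < r -> g z = h z) -> lim0 g l -> lim0 h l.
Proof.
move=> r0 gh gl e e0; have [d d0 Hd] := gl e e0.
exists (Num.min d r); first by rewrite lt_min d0.
move=> z; rewrite lt_min => /and3P[z0 zd zr].
by rewrite -gh ?z0 // Hd // z0.
Qed.

Lemma lim0_blin (V W : normedModType C) (f : V -> W) (g : C -> V) l :
  blin f -> lim0 g l -> lim0 (fun z => f (g z)) (f l).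
Proof.
move=> hf gl e e0; have [c c0 fc] := blin_gt0 hf.
have [d d0 Hd] := gl (e / c) (divr_gt0 e0 c0).
exists d => // z zd; rewrite -(linBf hf.1) (le_lt_trans (fc _)) //.
by rewrite mulrC -ltr_pdivlMr // Hd.
Qed.

Lemma lim0D (V : normedModType C) (g h : C -> V) l m :
  lim0 g l -> lim0 h m -> lim0 (fun z => g z + h z) (l + m).
Proof.
move=> gl hm e e0; have e20 := divr_gt0 e0 (ltr0n R 2).
have [d d0 Hd] := gl _ e20; have [d' d'0 Hd'] := hm _ e20.
exists (Num.min d d'); first by rewrite lt_min d0.
move=> z; rewrite lt_min => /and3P[z0 zd zd'].
have H1 := Hd z; rewrite z0 zd in H1; have {}H1 := H1 isT.
have H2 := Hd' z; rewrite z0 zd' in H2; have {}H2 := H2 isT.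
have -> : g z + h z - (l + m) = (g z - l) + (h z - m).
  by rewrite opprD addrACA.
by have := nrmD (g z - l) (h z - m); lra.
Qed.

Lemma lim0_cst (V : normedModType C) (l : V) : lim0 (fun=> l) l.
Proof. by move=> e e0; exists 1 => // z _; rewrite subrr nrm0. Qed.

Lemma lim0_small (V : normedModType C) (g : C -> V) l :
  lim0 g l -> lim0 (fun z => z *: g z) 0.
Proof.
move=> gl e e0; have [d d0 Hd] := gl 1 ltr01.
have c0 : 0 < nrm l + 1 by rewrite ltr_wpDl // nrm_ge0.
exists (Num.min d (e / (nrm l + 1))); first by rewrite lt_min d0 divr_gt0.
move=> z; rewrite lt_min => /and3P[z0 zd ze].
have H1 := Hd z; rewrite z0 zd in H1; have {}H1 := H1 isT.
rewrite subr0 nrmZ -(divfK (lt0r_neq0 c0) e) ltr_pM ?nrm_ge0 //.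
by have := nrmD (g z - l) l; rewrite subrK; lra.
Qed.

Lemma lim0_pow (V : normedModType C) (g : C -> V) l n : (0 < n)%N ->
  lim0 g l -> lim0 (fun z => z ^+ n *: g z) 0.
Proof.
case: n => // n _; elim: n => [|n IH] gl; first exact: lim0_small gl.
apply: (@lim0_ext _ (fun z => z *: (z ^+ n.+1 *: g z)) _ _ 1) => //.
  by move=> z _; rewrite scalerA -exprS.
exact: lim0_small (IH gl).
Qed.

End RealNorm.

(** * Power series on a punctured disc *)

Section PowerSeries.
Variable R : realType.
Local Notation C := R[i].

Lemma pow_small (c e q : R) : 0 < e -> 0 <= c -> 0 <= q <= 1 / 2 ->
  exists N, forall n, (N <= n)%N -> c * q ^+ n < e.
Proof.
move=> e0 c0 /andP[q0 q1]; exists (Num.bound (c / e)) => n Nn.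
have H : c / e < n%:R.
  apply: lt_le_trans (archi_boundP (divr_ge0 c0 (ltW e0))) _.
  by rewrite ler_nat.
have H2 : n%:R < 2 ^+ n :> R by rewrite -natrX ltr_nat ltn_expl.
have H3 : c * q ^+ n <= c * (1 / 2) ^+ n.
  by rewrite ler_wpM2l // lerXn2r ?nnegrE //; lra.
apply: (le_lt_trans H3); rewrite expr_div_n expr1n mulrA mulr1.
rewrite ltr_pdivrMr ?exprn_gt0 // mulrC -ltr_pdivrMr //.
exact: lt_trans H H2.
Qed.

Section Geometric.
Variables (V : normedModType C) (b : nat -> V) (c q : R).
Hypotheses (c0 : 0 <= c) (q0 : 0 <= q) (q1 : q <= 1 / 2).
Hypothesis bq : forall k, nrm (b k) <= c * q ^+ k.

Lemma geom_tail N j :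
  nrm (\sum_(k < N + j) b k - \sum_(k < N) b k) <= 2 * c * q ^+ N.
Proof.
(* Keeping the remainder [2 c q^(N + j)] makes the induction go through, because
   [q <= 1 / 2]. *)
suff : nrm (\sum_(k < N + j) b k - \sum_(k < N) b k)
       <= 2 * c * q ^+ N - 2 * c * q ^+ (N + j).
  have : 0 <= c * q ^+ (N + j) by rewrite mulr_ge0 ?exprn_ge0.
  by lra.
elim: j => [|j IH]; first by rewrite addn0 !subrr nrm0.
rewrite addnS big_ord_recr /= addrAC (le_trans (nrmD _ _)) //.
have := bq (N + j); rewrite exprSr; set w := q ^+ (N + j) => H.
have w0 : 0 <= c * w by rewrite mulr_ge0 // exprn_ge0.
have : c * w * q <= c * w * (1 / 2) by rewrite ler_wpM2l.
by rewrite -/w in IH; lra.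
Qed.

Lemma geom_lim l N : (fun n => \sum_(k < n) b k) @ \oo --> l ->
  nrm (\sum_(k < N) b k - l) <= 2 * c * q ^+ N.
Proof.
move=> /cvg_nrmP H; apply/ler_addgt0Pr => e e0.
have [M HM] := H e e0; have := HM (N + M)%N (leq_addl _ _).
have := geom_tail N M.
have := nrm_triB (\sum_(k < N + M) b k) (\sum_(k < N) b k) l.
rewrite (nrmBC (\sum_(k < N) b k) (\sum_(k < N + M) b k)); lra.
Qed.
End Geometric.

Lemma geom_cvg (V : completeNormedModType C) (b : nat -> V) (c q : R) :
  0 <= c -> 0 <= q -> q <= 1 / 2 -> (forall k, nrm (b k) <= c * q ^+ k) ->
  exists l : V, (fun n => \sum_(k < n) b k) @ \oo --> l.
Proof.
move=> c0 q0 q1 bq; apply: cauchy_cvg_nrm => e e0.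
have [||N HN] := @pow_small (2 * c) e q e0; rewrite ?mulr_ge0 ?q0 //.
have H m n : (N <= n)%N -> (n <= m)%N ->
    nrm (\sum_(k < m) b k - \sum_(k < n) b k) < e.
  move=> Nn nm; rewrite -(subnKC nm).
  by apply: le_lt_trans (geom_tail c0 q0 q1 bq n (m - n)) _; apply: HN.
exists N => m n Nm Nn; case: (leqP n m) => nm; first exact: H.
by rewrite nrmBC; apply: H => //; apply: ltnW.
Qed.

(** The Neumann series, with the ratio fixed to one half. *)
Lemma neumann (V : completeNormedModType C) (K : V -> V) : linear K ->
  (forall x, nrm (K x) <= nrm x / 2) ->
  forall x, exists2 y, y - K y = x & nrm y <= 2 * nrm x.
Proof.
move=> lK Kh x.
have bq k : nrm (iter k K x) <= nrm x * (1 / 2) ^+ k.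
  elim: k => [|k IH]; first by rewrite expr0 mulr1.
  by rewrite iterS (le_trans (Kh _)) // exprSr; lra.
have h0 : 0 <= 1 / 2 :> R by lra.
have h1 : 1 / 2 <= 1 / 2 :> R by lra.
have [y Hy] := geom_cvg (nrm_ge0 x) h0 h1 bq.
have bK : blin K by split=> //; exists (1 / 2) => z; have := Kh z; lra.
have HK := blin_cvg bK Hy.
have E n : \sum_(k < n) iter k K x - K (\sum_(k < n) iter k K x)
           = x - iter n K x.
  elim: n => [|n IH]; first by rewrite big_ord0 (lin0 lK) !subrr.
  by rewrite big_ord_recr /= (linDf lK) opprD addrACA IH addrA subrK.
exists y; last first.
  have := geom_lim (nrm_ge0 x) h0 h1 bq 0%N Hy.
  by rewrite big_ord0 sub0r nrmN expr0 mulr1.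
have H0 : (fun n => x - iter n K x) @ \oo --> x.
  apply/cvg_nrmP => e e0.
  have [||N HN] := @pow_small (nrm x) e (1 / 2) e0; rewrite ?nrm_ge0 ?h0 //.
  exists N => n Nn; rewrite addrC addKr nrmN.
  exact: le_lt_trans (bq n) (HN _ Nn).
apply: cvg_nrm_uniq H0; under eq_fun do rewrite -E.
exact: cvgB.
Qed.

Definition psum (V : lmodType C) (a : nat -> V) (z : C) (N : nat) : V :=
  \sum_(k < N) z ^+ k *: a k.

Lemma psumS (V : lmodType C) (a : nat -> V) z N :
  psum a z N.+1 = psum a z N + z ^+ N *: a N.
Proof. by rewrite /psum big_ord_recr. Qed.

(** Convergence is asked on the punctured disc only, and pointwise: this is all
that the definition of a pole of the M-function provides. The Laurent series
with a pole of order [p] is handled as the power series of [z ^+ p *: g z]. *)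
Definition pser (V : normedModType C) (a : nat -> V) (g : C -> V) (r : R) :=
  forall z, 0 < nrm z < r -> psum a z @ \oo --> g z.

Section Pser.
Variable V : normedModType C.
Implicit Types (a b : nat -> V) (g h : C -> V) (r s : R).

(** The terms of a convergent series are bounded. *)
Lemma pser_coef_bound a g r s : pser a g r -> 0 < s < r ->
  exists2 c : R, 0 <= c & forall k, nrm (a k) <= c * s^-1 ^+ k.
Proof.
move=> ag /andP[s0 sr]; pose z : C := s%:C%C.
have zs : nrm z = s by rewrite nrm_real_gt0.
have [|N HN] := (cvg_nrmP _ _).1 (ag z _) 1 ltr01; first by rewrite zs s0.
have tb k : nrm (z ^+ k *: a k) <= 2 + \sum_(j < N) nrm (z ^+ j *: a j).
  have [kN|Nk] := ltnP k N.
    rewrite (bigD1 (Ordinal kN)) //= addrCA lerDl addr_ge0 //.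
    by rewrite sumr_ge0 // => *; apply: nrm_ge0.
  rewrite -[leLHS]addr0 lerD //; last first.
    by rewrite sumr_ge0 // => *; apply: nrm_ge0.
  have -> : z ^+ k *: a k = psum a z k.+1 - psum a z k.
    by rewrite /psum big_ord_recr /= [X in X - _]addrC addrK.
  have H1 := HN _ (leqW Nk); have H2 := HN _ Nk.
  have := nrm_triB (g z) (psum a z k.+1) (psum a z k).
  rewrite (nrmBC (g z)); lra.
exists (2 + \sum_(j < N) nrm (z ^+ j *: a j)).
  by rewrite addr_ge0 // sumr_ge0 // => *; apply: nrm_ge0.
move=> k; rewrite exprVn ler_pdivlMr ?exprn_gt0 // mulrC.
by have := tb k; rewrite nrmZ nrmX zs.
Qed.

Lemma pser_tail a g r c s : pser a g r -> 0 <= c -> 0 <= s ->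
  (forall k, nrm (a k) <= c * s ^+ k) ->
  forall z, 0 < nrm z < r -> nrm z * s <= 1 / 2 ->
  forall N, nrm (psum a z N - g z) <= 2 * c * (nrm z * s) ^+ N.
Proof.
move=> ag c0 s0 ac z zr zs N.
apply: (@geom_lim _ (fun k => z ^+ k *: a k)) => //.
- by rewrite mulr_ge0 ?nrm_ge0.
- move=> k; rewrite nrmZ nrmX exprMn mulrCA ler_wpM2l ?ac //.
  by rewrite exprn_ge0 ?nrm_ge0.
- exact: ag.
Qed.

Lemma pser_lim0 a g r : 0 < r -> pser a g r -> lim0 g (a 0%N).
Proof.
move=> r0 ag e e0; have r2 : 0 < r / 2 < r by apply/andP; split; lra.
have [c c0 Hc] := pser_coef_bound ag r2.
have s0 : 0 < r / 2 by lra.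
have p0 : 0 < e / (2 * c + 1) * (r / 2).
  by rewrite mulr_gt0 // divr_gt0 //; lra.
exists (Num.min (r / 4) (e / (2 * c + 1) * (r / 2))).
  by rewrite lt_min p0 andbT; lra.
move=> z; rewrite lt_min => /and3P[z0 z4 ze].
have := pser_tail ag c0 _ Hc _ _ 1%N (z := z).
rewrite /psum big_ord_recr /= big_ord0 add0r expr0 scale1r expr1 nrmBC => H.
apply: le_lt_trans (H _ _ _) _.
- by rewrite invr_ge0 ltW.
- by rewrite z0 /=; lra.
- by rewrite ler_pdivrMr //; lra.
rewrite mulrA ltr_pdivrMr //.
have c1 : 0 < 2 * c + 1 by lra.
move: ze; rewrite mulrAC (ltr_pdivlMr _ _ c1) => ze.
have := nrm_ge0 z; lra.
Qed.

Lemma pser_ext a b g h r : (forall k, a k = b k) ->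
  (forall z, 0 < nrm z < r -> g z = h z) -> pser a g r -> pser b h r.
Proof. by move=> /funext <- gh ag z zr; rewrite -gh //; apply: ag. Qed.

Lemma pserD a b g h r : pser a g r -> pser b h r ->
  pser (fun k => a k + b k) (fun z => g z + h z) r.
Proof.
move=> ag bh z zr.
have -> : psum (fun k => a k + b k) z = (fun N => psum a z N + psum b z N).
  apply/funext => N; rewrite /psum -big_split /=.
  by apply: eq_bigr => k _; rewrite scalerDr.
by apply: cvgD; [apply: ag|apply: bh].
Qed.

Lemma pser_blin (W : normedModType C) (f : V -> W) a g r : blin f ->
  pser a g r -> pser (fun k => f (a k)) (fun z => f (g z)) r.
Proof.
move=> hf ag z zr.
have -> : psum (fun k => f (a k)) z = (fun N => f (psum a z N)).
  apply/funext => N; rewrite /psum (lin_sum hf.1).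
  by apply: eq_bigr => k _; rewrite (linZf hf.1).
exact: blin_cvg hf (ag z zr).
Qed.

Definition shift a k : V := if k is k'.+1 then a k' else 0.

Lemma psum_shift a z N : psum (shift a) z N.+1 = z *: psum a z N.
Proof.
rewrite /psum big_ord_recl /= scaler0 add0r scaler_sumr.
by apply: eq_bigr => k _; rewrite scalerA -exprS.
Qed.

Lemma pser_shift a g r : pser a g r -> pser (shift a) (fun z => z *: g z) r.
Proof.
move=> ag z zr; rewrite -(cvg_shiftS (psum (shift a) z)) /=.
have -> : (fun n => psum (shift a) z n.+1) = (fun n => z *: psum a z n).
  by apply/funext => n; rewrite psum_shift.
exact: (blin_cvg (blinZ z (blin_id V)) (ag z zr)).
Qed.

Lemma pser_poly (a : nat -> V) n r :
  pser (fun k => if (k < n)%N then a k else 0) (fun z => psum a z n) r.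
Proof.
move=> z zr; apply/cvg_nrmP => e e0; exists n => N nN.
suff -> : psum (fun k => if (k < n)%N then a k else 0) z N = psum a z n.
  by rewrite subrr nrm0.
rewrite -(subnKC nN) /psum big_split_ord /= [X in _ + X]big1 ?addr0.
  by apply: eq_bigr => k _; rewrite ltn_ord.
by move=> k _; rewrite ltnNge leq_addr /= scaler0.
Qed.

Lemma pser_mono (v : V) (n : nat) r :
  pser (fun k => if k == n then v else 0) (fun z => z ^+ n *: v) r.
Proof.
have := @pser_poly (fun k => if k == n then v else 0) n.+1 r.
apply: pser_ext.
  by move=> k; case: eqP => [->|_]; rewrite ?ltnSn ?if_same.
move=> z _; rewrite /psum big_ord_recr /= eqxx big1 ?add0r //.
by move=> k _; rewrite ltn_eqF ?scaler0 // ltn_ord.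
Qed.

Lemma pser_drop a g r n : (forall k, (k < n)%N -> a k = 0) -> pser a g r ->
  pser (fun k => a (n + k)%N) (fun z => z ^- n *: g z) r.
Proof.
move=> a0 ag z zr; have z0 : z != 0 by rewrite -nrm_gt0; case/andP: zr.
have -> : psum (fun k => a (n + k)%N) z = (fun N => z ^- n *: psum a z (n + N)%N).
  apply/funext => N; rewrite /psum big_split_ord /= [X in _ *: (X + _)]big1 ?add0r.
    rewrite scaler_sumr; apply: eq_bigr => k _.
    by rewrite scalerA exprD mulKf // expf_neq0.
  by move=> k _; rewrite a0 ?scaler0 // ltn_ord.
apply: (blin_cvg (blinZ (z ^- n) (blin_id V))); apply/cvg_nrmP => e e0.
have [N HN] := (cvg_nrmP _ _).1 (ag z zr) e e0.
by exists N => m Nm; apply: HN; rewrite (leq_trans Nm) // leq_addl.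
Qed.

End Pser.
End PowerSeries.

(** * Riemann integrals of vector-valued functions *)

Section Riemann.
Variable R : realType.
Local Notation C := R[i].
Local Notation pi := (pi : R).

Section General.
Variable V : normedModType C.
Implicit Types (f g : R -> V) (a b : R).

Lemma sum_steps (t : nat -> R) n :
  \sum_(k < n) (t k.+1 - t k) = t n - t 0%N.
Proof.
elim: n => [|n IH]; first by rewrite big_ord0 subrr.
by rewrite big_ord_recr /= IH addrC addrA subrK.
Qed.

Lemma sum_stepsV (F : R -> V) (t : nat -> R) n :
  \sum_(k < n) (F (t k.+1) - F (t k)) = F (t n) - F (t 0%N).
Proof.
elim: n => [|n IH]; first by rewrite big_ord0 subrr.
by rewrite big_ord_recr /= IH addrC addrA subrK.
Qed.

(** The fundamental theorem of calculus in the form that needs no derivative: a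
quadratic Taylor estimate for [F] makes the Riemann sums of [f] telescope up to
an error proportional to the mesh. *)
Lemma riemann_deriv f (F : R -> V) a b (L : R) : 0 <= L ->
  (forall s x t, s <= x <= t ->
     nrm (F t - F s - (t - s)%:C%C *: f x) <= L * (t - s) ^+ 2) ->
  is_Riemann_int f a b (F b - F a).
Proof.
move=> L0 HF e e0; pose c := L * `|b - a| + 1.
have c0 : 0 < c by rewrite ltr_wpDl // mulr_ge0.
exists (e / c); first by rewrite divr_gt0.
move=> n t x ta tb H; rewrite nrmE ltcR nrmBC -ta -tb -(sum_stepsV F) -sumrB.
have st k : (k < n)%N -> 0 <= t k.+1 - t k.
  by move=> kn; have [/andP[h1 h2] _] := H k kn; rewrite subr_ge0 (le_trans h1).
apply: le_lt_trans (nrm_sum _ _ _) _.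
have H1 : \sum_(k < n) nrm (F (t k.+1) - F (t k) - (t k.+1 - t k)%:C%C *: f (x k))
   <= \sum_(k < n) L * (e / c) * (t k.+1 - t k).
  apply: ler_sum => k _; have [h1 h2] := H k (ltn_ord k).
  apply: le_trans (HF _ _ _ h1) _; rewrite -mulrA ler_wpM2l // expr2.
  by rewrite ler_wpM2r ?st // ltW.
apply: (le_lt_trans H1); rewrite -mulr_sumr sum_steps ta tb.
have h : b - a <= `|b - a| := ler_norm _.
apply: (@le_lt_trans _ _ (L * (e / c) * `|b - a|)).
  by rewrite ler_wpM2l // mulr_ge0 // divr_ge0 // ltW.
by rewrite mulrAC mulrA ltr_pdivrMr // mulrC ltr_pM2l // /c ltrDl ltr01.
Qed.

Lemma riemannD f g a b I J : is_Riemann_int f a b I ->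
  is_Riemann_int g a b J ->
  is_Riemann_int (fun t => f t + g t) a b (I + J).
Proof.
move=> hf hg e e0; have e2 := divr_gt0 e0 (ltr0n R 2).
have [d d0 Hd] := hf _ e2; have [d' d'0 Hd'] := hg _ e2.
exists (Num.min d d'); first by rewrite lt_min d0.
move=> n t x ta tb H; rewrite nrmE ltcR.
have := Hd n t x ta tb _; have := Hd' n t x ta tb _; rewrite !nrmE !ltcR => h1 h2.
have {}h1 : nrm (\sum_(k < n) (t k.+1 - t k)%:C%C *: g (x k) - J) < e / 2.
  by apply: h1 => k /H [? ]; rewrite lt_min => /andP[].
have {}h2 : nrm (\sum_(k < n) (t k.+1 - t k)%:C%C *: f (x k) - I) < e / 2.
  by apply: h2 => k /H [? ]; rewrite lt_min => /andP[].
under eq_bigr do rewrite scalerDr.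
rewrite big_split /= opprD addrACA.
by apply: le_lt_trans (nrmD _ _) _; lra.
Qed.

Lemma riemann_blin (W : normedModType C) (h : V -> W) f a b I : blin h ->
  is_Riemann_int f a b I ->
  is_Riemann_int (fun t => h (f t)) a b (h I).
Proof.
move=> hh hf e e0; have [c c0 hc] := blin_gt0 hh.
have [d d0 Hd] := hf _ (divr_gt0 e0 c0); exists d => // n t x ta tb H.
have := Hd n t x ta tb H; rewrite !nrmE !ltcR => h1.
have -> : \sum_(k < n) (t k.+1 - t k)%:C%C *: h (f (x k))
    = h (\sum_(k < n) (t k.+1 - t k)%:C%C *: f (x k)).
  by rewrite (lin_sum hh.1); apply: eq_bigr => k _; rewrite (linZf hh.1).
by rewrite -(linBf hh.1) (le_lt_trans (hc _)) // mulrC -ltr_pdivlMr //.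
Qed.

Lemma riemann_sum (f : nat -> R -> V) (I : nat -> V) a b n :
  (forall k, (k < n)%N -> is_Riemann_int (f k) a b (I k)) ->
  is_Riemann_int (fun t => \sum_(k < n) f k t) a b (\sum_(k < n) I k).
Proof.
elim: n => [|n IH] H.
  move=> e e0; exists 1 => // n t x _ _ _; rewrite big_ord0 subr0 big1.
    by rewrite normr0 ltcR.
  by move=> k _; rewrite big_ord0 scaler0.
have -> : (fun t => \sum_(k < n.+1) f k t) = (fun t => \sum_(k < n) f k t + f n t).
  by apply/funext => t; rewrite big_ord_recr.
rewrite big_ord_recr; apply: riemannD; last exact: H.
by apply: IH => k kn; apply: H; apply: ltnW.
Qed.

Lemma riemann_unif f a b I : a <= b ->
  (forall e : R, 0 < e -> exists g J, [/\ is_Riemann_int g a b J,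
     forall t, nrm (f t - g t) <= e & nrm (J - I) <= e]) ->
  is_Riemann_int f a b I.
Proof.
move=> ab H e e0; pose c := b - a + 3; have c0 : 0 < c by rewrite /c; lra.
have ec0 := divr_gt0 e0 c0; have [g [J [hg fg JI]]] := H _ ec0.
have [d d0 Hd] := hg _ ec0; exists d => // n t x ta tb Ht.
have := Hd n t x ta tb Ht; rewrite !nrmE !ltcR => h1.
have st k : (k < n)%N -> 0 <= t k.+1 - t k.
  by move=> kn; have [/andP[h1' h2] _] := Ht k kn; rewrite subr_ge0 (le_trans h1').
have h2 : nrm (\sum_(k < n) (t k.+1 - t k)%:C%C *: f (x k)
    - \sum_(k < n) (t k.+1 - t k)%:C%C *: g (x k)) <= (b - a) * (e / c).
  rewrite -sumrB (le_trans (nrm_sum _ _ _)) // -ta -tb -sum_steps mulr_suml.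
  apply: ler_sum => k _; rewrite -scalerBr nrmZ nrm_real ger0_norm ?st //.
  by rewrite ler_wpM2l ?st.
set S := \sum_(k < n) _ *: f _ in h2 *; set S' := \sum_(k < n) _ *: g _ in h1 h2.
apply: le_lt_trans (nrm_triB S' _ _) _.
apply: le_lt_trans (lerD h2 (nrm_triB J _ _)) _.
have eE : e = (b - a) * (e / c) + 3 * (e / c).
  by rewrite -mulrDl mulrCA divff ?mulr1 // gt_eqF.
by rewrite [ltRHS]eE; lra.
Qed.

(** Uniform partitions with left tags turn the integral into a limit of averages,
which is how an integral is bounded and how the Riesz projection is computed
below. *)
Lemma riemann_equi f a b I : a < b -> is_Riemann_int f a b I ->
  (fun n => ((b - a) / n.+1%:R)%:C%C *:
     \sum_(k < n.+1) f (a + (b - a) / n.+1%:R * k%:R)) @ \oo --> I.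
Proof.
move=> ab hf; apply/cvg_nrmP => e e0; have [d d0 Hd] := hf e e0.
have ba0 : 0 < b - a by lra.
exists (Num.bound ((b - a) / d)) => n Nn.
have Hn : (b - a) / d < n.+1%:R.
  apply: lt_le_trans (archi_boundP _) _; first by rewrite divr_ge0 // ltW.
  by rewrite ler_nat (leq_trans Nn).
have n0 : 0 < n.+1%:R :> R by rewrite ltr0n.
pose h := (b - a) / n.+1%:R; pose t k := a + h * k%:R.
have h0 : 0 < h by rewrite divr_gt0.
have hE k : t k.+1 - t k = h by rewrite /t -natr1; ring.
have := Hd n.+1 t t _ _ _; rewrite nrmE ltcR => H.
rewrite scaler_sumr; move: H.
under eq_bigr do rewrite hE.
apply.
- by rewrite /t mulr0 addr0.
- by rewrite /t /h divfK ?gt_eqF // addrC subrK.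
- move=> k _; rewrite hE lexx /= -subr_ge0 hE ltW //; split => //.
  by rewrite /h ltr_pdivrMr // mulrC -ltr_pdivrMr.
Qed.

Lemma riemann_bound f a b I M : a < b -> is_Riemann_int f a b I ->
  (forall t, a <= t <= b -> nrm (f t) <= M) -> nrm I <= (b - a) * M.
Proof.
move=> ab /(riemann_equi ab)/cvg_nrmP hI fM; apply/ler_addgt0Pr => e e0.
have [N HN] := hI e e0; have := HN N (leqnn _).
have n0 : 0 < N.+1%:R :> R by rewrite ltr0n.
set S := _ *: _.
have SM : nrm S <= (b - a) * M.
  have ba0 : 0 <= b - a by lra.
  rewrite /S nrmZ nrm_real ger0_norm ?divr_ge0 //.
  rewrite mulrAC ler_pdivrMr // -mulrA ler_wpM2l //.
  rewrite (le_trans (nrm_sum _ _ _)) //.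
  rewrite (@le_trans _ _ (\sum_(k < N.+1) M)) ?ler_sum //.
    move=> k _; apply: fM; rewrite lerDl mulr_ge0 ?divr_ge0 //= -lerBrDl.
    by rewrite mulrAC ler_pdivrMr // ler_wpM2l // ler_nat ltnW.
  by rewrite sumr_const card_ord mulr_natr.
have := nrm_triB S I 0; rewrite !subr0 (nrmBC I); lra.
Qed.
End General.

Lemma cisD (s t : R) : cis (s + t) = cis s * cis t.
Proof. by rewrite /cis sinD cosD; simpc; congr (_ +i* _)%C; ring. Qed.

Lemma nrm_cis (t : R) : nrm (cis t : C) = 1.
Proof. by rewrite /nrm normc_def /= cos2Dsin2 sqrtr1. Qed.

Lemma cisX (t : R) n : cis t ^+ n = cis (n%:R * t).
Proof.
elim: n => [|n IH]; first by rewrite mul0r /cis cos0 sin0.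
by rewrite exprSr IH -cisD -natr1 mulrDl mul1r.
Qed.

(** The mean value theorem without an order on the two points. *)
Lemma MVT_any (f df : R -> R) : (forall x : R, is_derive x (1 : R) f (df x)) ->
  forall x y, exists2 c, `|c| <= Num.max `|x| `|y| &
    f x - f y = df c * (x - y).
Proof.
move=> hf x y; wlog xy : x y / y <= x.
  move=> H; case: (leP y x) => [/H//|/ltW/H [c hc E]].
  by exists c; rewrite 1?maxC // -opprB E -mulrN opprB.
have cf : {within `[y, x], continuous f}.
  apply: continuous_subspaceT => z; apply: differentiable_continuous.
  by apply/derivable1_diffP; apply: ex_derive.
have [c] := MVT_segment xy (fun z _ => hf z) cf.
rewrite in_itv /= => /andP[yc cx] E; exists c => //.
rewrite le_max; case: (leP 0 c) => h; apply/orP; [left|right].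
  by rewrite ger0_norm // (le_trans cx) // ler_norm.
by rewrite ltr0_norm // (@le_trans _ _ (- y)) ?lerN2 // -normrN ler_norm.
Qed.

Lemma sin_le (x : R) : `|sin x| <= `|x|.
Proof.
have [c _] := MVT_any (@is_derive_sin R) x 0.
rewrite sin0 !subr0 => ->; rewrite normrM ler_piMl //.
by rewrite ler_norml cos_geN1 cos_le1.
Qed.

Lemma cosB_le (x y : R) : `|cos x - cos y| <= `|x - y|.
Proof.
have [c _ ->] := MVT_any (@is_derive_cos R) x y.
by rewrite normrM normrN ler_piMl // ler_norml sin_geN1 sin_le1.
Qed.

Lemma sinB_le (x y : R) : `|sin x - sin y| <= `|x - y|.
Proof.
have [c _ ->] := MVT_any (@is_derive_sin R) x y.
by rewrite normrM ler_piMl // ler_norml cos_geN1 cos_le1.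
Qed.

Lemma cisB_le (x y : R) : nrm (cis x - cis y : C) <= 2 * `|x - y|.
Proof.
apply: le_trans (nrm_ReIm _) _ => /=.
by have := cosB_le x y; have := sinB_le x y; lra.
Qed.

Lemma cis_taylor (u : R) : nrm (cis u - 1 - 'i%C * u%:C%C : C) <= 2 * u ^+ 2.
Proof.
apply: le_trans (nrm_ReIm _) _; rewrite /cis; simpc => /=.
have h1 : `|cos u - 1| <= u ^+ 2.
  have [c cu] := MVT_any (@is_derive_cos R) u 0.
  rewrite cos0 !subr0 => ->; rewrite normrM normrN -real_normK ?num_real //.
  rewrite expr2 ler_wpM2r // (le_trans (sin_le c)) // (le_trans cu) //.
  by rewrite normr0 ge_max lexx normr_ge0.
have h2 : `|sin u - u| <= u ^+ 2.
  have hd (x : R) : is_derive x (1 : R) (fun x => sin x - x) (cos x - 1).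
    by apply: is_deriveB.
  have [c cu] := MVT_any hd u 0.
  rewrite sin0 !subr0 => ->; rewrite normrM -real_normK ?num_real //.
  rewrite expr2 ler_wpM2r // -cos0 (le_trans (cosB_le c 0)) // subr0.
  by rewrite (le_trans cu) // normr0 ge_max lexx normr_ge0.
by rewrite ?addr0 ?subr0 ?oppr0; lra.
Qed.

End Riemann.

(** * Cauchy's coefficient formula on a circle *)

Section CauchyFormula.
Variable R : realType.
Local Notation C := R[i].

Lemma cis_period n : cis (n%:R * (2 * pi)) = 1 :> C.
Proof.
rewrite -cisX; suff -> : cis (2 * pi) = 1 :> C by rewrite expr1n.
by rewrite /cis mulrC mulr_natr cos2pi sin2pi.
Qed.

(** The integral over a period of a nontrivial character vanishes, with the
explicit primitive [cis (a * t) / (i a)]. *)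
Lemma riemann_cis (V : normedModType C) (a : R) (v : V) : a != 0 ->
  cis (a * (2 * pi)) = 1 :> C ->
  is_Riemann_int (fun t => cis (a * t) *: v) 0 (2 * pi) 0.
Proof.
move=> a0 per; pose F t := ('i%C * a%:C%C)^-1 *: (cis (a * t) *: v).
have aC : a%:C%C != 0 :> C by rewrite -nrm_eq0 nrm_real normr_eq0.
have i0 : 'i%C != 0 :> C by rewrite -nrm_eq0 /nrm normc_def /= expr0n expr1n add0r sqrtr1 oner_eq0.
have ni : nrm ('i%C : C) = 1 by rewrite /nrm normc_def /= expr0n expr1n add0r sqrtr1.
have -> : 0 = F (2 * pi) - F 0.
  by rewrite /F per mulr0 /cis cos0 sin0 subrr.
apply: (@riemann_deriv _ _ _ _ _ _ (4 * `|a| * nrm v)).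
  by rewrite !mulr_ge0 ?nrm_ge0.
move=> s x t /andP[sx xt].
pose T u : C := cis u - 1 - 'i%C * u%:C%C.
have -> : F t - F s - (t - s)%:C%C *: (cis (a * x) *: v) =
  (('i%C * a%:C%C)^-1 * cis (a * x) * (T (a * (t - x)) - T (a * (s - x)))) *: v.
  rewrite /F !scalerA -!scalerBl; congr (_ *: _).
  have -> : cis (a * t) = cis (a * x) * cis (a * (t - x)) :> C.
    by rewrite -cisD -mulrDr addrC subrK.
  have -> : cis (a * s) = cis (a * x) * cis (a * (s - x)) :> C.
    by rewrite -cisD -mulrDr addrC subrK.
  have -> : (t - s)%:C%C = (t - x)%:C%C - (s - x)%:C%C :> C.
    by rewrite -rcN -rcD; congr (_%:C%C); ring.
  rewrite /T !rcM; field.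
  by rewrite aC i0.
rewrite nrmZ !nrmM nrmV nrmM ni mul1r nrm_real nrm_cis mulr1.
have h : nrm (T (a * (t - x)) - T (a * (s - x))) <= 4 * a ^+ 2 * (t - s) ^+ 2.
  apply: le_trans (nrmB _ _) _.
  apply: le_trans (lerD (cis_taylor _) (cis_taylor _)) _.
  rewrite !exprMn.
  have h1 : (t - x) ^+ 2 <= (t - s) ^+ 2 by rewrite lerXn2r ?nnegrE //; lra.
  have h2 : (s - x) ^+ 2 <= (t - s) ^+ 2.
    by rewrite -sqrrN lerXn2r ?nnegrE //; lra.
  have := sqr_ge0 a; move: h1 h2.
  set A := a ^+ 2; set p := (t - x) ^+ 2; set q := (s - x) ^+ 2.
  set w := (t - s) ^+ 2 => h1 h2 A0.
  have := ler_wpM2l A0 h1; have := ler_wpM2l A0 h2; lra.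
have v0 := nrm_ge0 v.
rewrite [leRHS]mulrAC ler_wpM2r // mulrC ler_pdivrMr ?normr_gt0 //.
apply: le_trans h _; rewrite -(real_normK (num_real a)).
by rewrite le_eqVlt; apply/orP; left; apply/eqP; ring.
Qed.

Lemma riemann_cst (V : normedModType C) (a b : R) (v : V) :
  is_Riemann_int (fun=> v) a b ((b - a)%:C%C *: v).
Proof.
have -> : (b - a)%:C%C *: v = b%:C%C *: v - a%:C%C *: v.
  by rewrite rcD rcN scalerBl.
apply: (@riemann_deriv _ _ _ (fun t => t%:C%C *: v) _ _ 0) => // s x t _.
by rewrite rcD rcN scalerBl subrr nrm0 mul0r.
Qed.

(** The partial sums converge uniformly on a smaller circle, and only the term of
index [m] survives integration against [cis (- m t)]. *)
Lemma cauchy_coef (V : normedModType C) (a : nat -> V) (g : C -> V) (r rho : R)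
    m : pser a g r -> 0 < rho < r / 2 ->
  is_Riemann_int (fun t => cis (- (m%:R * t)) *: g (rho%:C%C * cis t))
    0 (2 * pi) ((2 * pi * rho ^+ m)%:C%C *: a m).
Proof.
move=> ag /andP[p0 pr].
have [c c0 Hc] : exists2 c : R, 0 <= c & forall k, nrm (a k) <= c * (2 * rho)^-1 ^+ k.
  by apply: (pser_coef_bound ag); apply/andP; split; lra.
have zn t : nrm (rho%:C%C * cis t : C) = rho.
  by rewrite nrmM nrm_cis mulr1 nrm_real_gt0.
have pi0 : 0 < 2 * pi :> R by rewrite mulr_gt0 ?pi_gt0.
apply: riemann_unif; first exact: ltW.
move=> e e0; have h0 : 0 <= 1 / 2 :> R by lra.
have [||N HN] := @pow_small _ (2 * c) e (1 / 2) e0; rewrite ?mulr_ge0 ?h0 ?lexx //.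
pose n := (N + m.+1)%N.
exists (fun t => \sum_(k < n) (rho ^+ k)%:C%C *: (cis ((k%:R - m%:R) * t) *: a k)).
exists (\sum_(k < n) (if k == m :> nat then (2 * pi * rho ^+ m)%:C%C *: a m else 0)).
split.
- apply: (@riemann_sum _ _ (fun k t => (rho ^+ k)%:C%C *: (cis ((k%:R - m%:R) * t) *: a k))
    (fun k => if k == m :> nat then (2 * pi * rho ^+ m)%:C%C *: a m else 0)) => k _.
  case: eqP => [->|/eqP km].
    have -> : (fun t : R => (rho ^+ m)%:C%C *: (cis ((m%:R - m%:R) * t) *: a m))
       = (fun=> (rho ^+ m)%:C%C *: a m).
      by apply/funext => t; rewrite subrr mul0r /cis cos0 sin0 scale1r.
    have := riemann_cst 0 (2 * pi) ((rho ^+ m)%:C%C *: a m).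
    by rewrite scalerA -rcM subr0.
  have -> : 0 = (rho ^+ k)%:C%C *: (0 : V) by rewrite scaler0.
  apply: (@riemann_blin _ _ _ (fun v => (rho ^+ k)%:C%C *: v)).
    exact: blinZ (blin_id V).
  apply: riemann_cis; first by rewrite subr_eq0 eqr_nat.
  have h : cis ((k%:R - m%:R) * (2 * pi)) * cis (m%:R * (2 * pi)) = 1 :> C.
    by rewrite -cisD mulrBl subrK cis_period.
  by move: h; rewrite cis_period mulr1.
- move=> t.
  have -> : \sum_(k < n) (rho ^+ k)%:C%C *: (cis ((k%:R - m%:R) * t) *: a k)
     = cis (- (m%:R * t)) *: psum a (rho%:C%C * cis t) n.
    rewrite /psum scaler_sumr; apply: eq_bigr => k _; rewrite !scalerA.
    congr (_ *: _); rewrite exprMn cisX rcX mulrCA -cisD.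
    by congr (_ * cis _); ring.
  rewrite -scalerBr nrmZ nrm_cis mul1r nrmBC.
  have i0 : 0 <= (2 * rho)^-1 by rewrite invr_ge0; lra.
  have h := pser_tail ag c0 i0 Hc _ _ n (z := rho%:C%C * cis t).
  apply: le_trans (h _ _) _; rewrite zn.
  + by apply/andP; split; lra.
  + by rewrite invfM mulrCA divff ?gt_eqF // mulr1; lra.
  + rewrite invfM mulrCA divff ?gt_eqF // mulr1 -[2^-1]div1r ltW // HN //.
    exact: leq_addr.
- have mn : (m < n)%N by rewrite leq_addl.
  rewrite (bigD1 (Ordinal mn)) //= eqxx big1 ?addr0 ?subrr ?nrm0 ?ltW //.
  by move=> k; rewrite -val_eqE /= => /negbTE ->.
Qed.

(** Cauchy's estimate: bounds the coefficients from a bound of the sum on one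
circle. It is what makes the coefficients of a pointwise convergent expansion
bounded operators. *)
Lemma cauchy_bound (V : normedModType C) (a : nat -> V) (g : C -> V)
    (r rho M : R) m : pser a g r -> 0 < rho < r / 2 ->
  (forall t, 0 <= t <= 2 * pi -> nrm (g (rho%:C%C * cis t)) <= M) ->
  nrm (a m) <= M * rho^-1 ^+ m.
Proof.
move=> ag pr gM; have [p0 _] := andP pr.
have pi0 : 0 < 2 * pi :> R by rewrite mulr_gt0 ?pi_gt0.
have := riemann_bound pi0 (cauchy_coef m ag pr) (M := M).
rewrite nrmZ nrm_real ger0_norm; last by rewrite mulr_ge0 ?exprn_ge0 // ltW.
rewrite subr0 -mulrA ler_pM2l // exprVn ler_pdivlMr ?exprn_gt0 //.
rewrite [nrm _ * _]mulrC; apply => t t01; rewrite nrmZ nrm_cis mul1r.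
exact: gM.
Qed.

(** For a pole of order [p.+1] the contour integral picks the coefficient of index
[p] of [z ^+ p.+1 *: h (mu + z)], that is the residue. *)
Lemma residue_formula (V : normedModType C) (a : nat -> V) (h : C -> V)
    (mu : C) (r rho : R) p :
  pser a (fun z => z ^+ p.+1 *: h (mu + z)) r -> 0 < rho < r / 2 ->
  is_circle_int mu rho h ((2 * (pi : R)%:C%C * 'i%C) *: a p).
Proof.
move=> ag pr; have [p0 _] := andP pr.
have pC : rho%:C%C != 0 :> C by rewrite -nrm_eq0 nrm_real_gt0 // gt_eqF.
have H := cauchy_coef p ag pr.
have := riemann_blin (blinZ ('i%C * rho%:C%C ^- p) (blin_id V)) H.
rewrite /= scalerA rcM rcX.
rewrite [(2 * pi)%:C%C]rcM.
have -> : 'i%C * rho%:C%C ^- p * (2%:C%C * pi%:C%C * rho%:C%C ^+ p)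
   = 2 * (pi : R)%:C%C * 'i%C :> C.
  have -> : 2%:C%C = 2 :> C by rewrite rmorph_nat.
  by field; rewrite expf_neq0.
rewrite /is_circle_int.
congr (is_Riemann_int _ _ _ _); apply/funext => t.
rewrite !scalerA exprMn cisX.
congr (_ *: _).
have -> : cis ((p.+1)%:R * t) = cis (p%:R * t) * cis t :> C.
  by rewrite -cisD -natr1 mulrDl mul1r.
rewrite exprS.
have h1 : cis (- (p%:R * t)) * cis (p%:R * t) = 1 :> C.
  by rewrite -cisD addNr /cis cos0 sin0.
have -> : 'i%C * rho%:C%C ^- p * cis (- (p%:R * t)) *
  (rho%:C%C * rho%:C%C ^+ p * (cis (p%:R * t) * cis t)) =
  'i%C * rho%:C%C * cis t * (rho%:C%C ^- p * rho%:C%C ^+ p) *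
   (cis (- (p%:R * t)) * cis (p%:R * t)) :> C by ring.
by rewrite h1 mulVf ?expf_neq0 // !mulr1.
Qed.

End CauchyFormula.

(** * The resolvent of an unbounded operator *)

Section Resolvent.
Variable R : realType.
Local Notation C := R[i].
Variables (V : normedModType C) (T : operator V).
Hypothesis Tlin : is_linear T.

Lemma domD u v : dom T u -> dom T v -> dom T (u + v).
Proof. by move=> hu hv; have := Tlin.1.2 1 u v hu hv; rewrite scale1r. Qed.

Lemma domZ a u : dom T u -> dom T (a *: u).
Proof. by move=> hu; have := Tlin.1.2 a u 0 hu Tlin.1.1; rewrite addr0. Qed.

Lemma domB u v : dom T u -> dom T v -> dom T (u - v).
Proof. by move=> hu hv; rewrite -scaleN1r; apply: domD => //; apply: domZ. Qed.

Lemma opD u v : dom T u -> dom T v -> T (u + v) = T u + T v.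
Proof. by move=> hu hv; have := Tlin.2 1 u v hu hv; rewrite !scale1r. Qed.

Lemma op0 : T 0 = 0.
Proof.
have /eqP := opD Tlin.1.1 Tlin.1.1.
by rewrite addr0 -subr_eq0 opprD addNKr oppr_eq0 => /eqP.
Qed.

Lemma opZ a u : dom T u -> T (a *: u) = a *: T u.
Proof.
by move=> hu; have := Tlin.2 a u 0 hu Tlin.1.1; rewrite !addr0 op0 addr0.
Qed.

Lemma opB u v : dom T u -> dom T v -> T (u - v) = T u - T v.
Proof.
move=> hu hv; have hN := domZ (-1) hv.
by rewrite -scaleN1r opD // opZ // scaleN1r.
Qed.

Section Point.
Variable lam : C.
Hypothesis hl : resolvent_set T lam.
Local Notation Rl := (resolvent T lam).

Lemma resP x : dom T (Rl x) /\ T (Rl x) - lam *: Rl x = x.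
Proof.
have [[_ _ sj] _] := hl; have [u Du ux] := sj x I.
by rewrite /resolvent; case: xgetP => [v _ //|/(_ u)]; case.
Qed.

Lemma res_dom x : dom T (Rl x). Proof. by have [] := resP x. Qed.

Lemma res_eq x : T (Rl x) = x + lam *: Rl x.
Proof. by have [_ /eqP] := resP x; rewrite subr_eq => /eqP. Qed.

Lemma shift_inj u v : dom T u -> dom T v ->
  T u - lam *: u = T v - lam *: v -> u = v.
Proof.
by move=> Du Dv E; have [[_ inj _] _] := hl; apply: inj; rewrite ?inE.
Qed.

Lemma resK u : dom T u -> Rl (T u - lam *: u) = u.
Proof.
move=> Du; have [D E] := resP (T u - lam *: u); exact: shift_inj E.
Qed.

Lemma res_lin : linear Rl.
Proof.
move=> a x y; apply: shift_inj; first exact: res_dom.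
  by apply: domD (res_dom _); apply/domZ/res_dom.
rewrite (resP _).2 opD ?opZ; do ?[exact: res_dom|exact/domZ/res_dom].
rewrite scalerDr opprD addrACA (resP y).2 scalerA mulrC -scalerA -scalerBr.
by rewrite (resP x).2.
Qed.

Lemma res_blin : blin Rl.
Proof.
have [_ cR] := hl; have [F FE] := linear_bundle res_lin.
apply: (eq_blin FE); apply/blin_continuous.
by rewrite (_ : F = Rl :> (V -> V)) //; apply/funext.
Qed.
End Point.

(** The first resolvent identity. *)
Lemma res_identity lam kap x : resolvent_set T lam -> resolvent_set T kap ->
  resolvent T lam x =
  resolvent T kap x + (lam - kap) *: resolvent T kap (resolvent T lam x).
Proof.
move=> hl hk; rewrite -[LHS](resK hk (res_dom hl x)) (res_eq hl).
by rewrite -addrA -scalerBl addrC (res_lin hk) addrC.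
Qed.

Lemma res_comm lam kap x : resolvent_set T lam -> resolvent_set T kap ->
  resolvent T lam (resolvent T kap x) = resolvent T kap (resolvent T lam x).
Proof.
move=> hl hk; have [->//|ne] := eqVneq lam kap.
have l0 : lam - kap != 0 by rewrite subr_eq0.
have E1 := res_identity x hl hk; have E2 := res_identity x hk hl.
apply: (scalerI l0).
set u := resolvent T lam (resolvent T kap x) in E2 *.
set v := resolvent T kap (resolvent T lam x) in E1 *.
have -> : (lam - kap) *: v = resolvent T lam x - resolvent T kap x.
  by apply/eqP; rewrite eq_sym subr_eq addrC -E1.
by rewrite E2 opprD addrA subrr add0r -scaleNr opprB.
Qed.

(** The resolvent identity bounds the resolvent near [lam] by the resolvent at
[lam]. *)
Lemma res_locally_bounded lam : resolvent_set T lam -> exists2 d : R, 0 < d &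
  exists2 M : R, 0 < M & forall kap, resolvent_set T kap ->
    nrm (kap - lam) < d -> forall x, nrm (resolvent T kap x) <= M * nrm x.
Proof.
move=> hl; have [c c0 Hc] := blin_gt0 (res_blin hl).
exists (2 * c)^-1; first by rewrite invr_gt0; lra.
exists (2 * c); first by lra.
move=> kap hk dk x; rewrite (res_identity x hk hl).
set w := resolvent T kap x.
have wE : w = resolvent T lam x + (kap - lam) *: resolvent T lam w.
  exact: res_identity.
rewrite -wE.
have h1 : nrm w <= c * nrm x + nrm (kap - lam) * (c * nrm w).
  rewrite {1}wE (le_trans (nrmD _ _)) // nrmZ lerD ?Hc //.
  by rewrite ler_wpM2l ?nrm_ge0 ?Hc.
have h2 : nrm (kap - lam) * (c * nrm w) <= (2 * c)^-1 * (c * nrm w).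
  by rewrite ler_wpM2r ?mulr_ge0 ?nrm_ge0 // ltW.
have h3 : (2 * c)^-1 * (c * nrm w) = 1 / 2 * nrm w by field; lra.
by lra.
Qed.

(** A locally bounded function is bounded on a compact circle. *)
Lemma res_circle_bound mu (rho : R) :
  (forall t : R, 0 <= t <= 2 * pi ->
     resolvent_set T (mu + rho%:C%C * cis t)) ->
  exists2 M : R, 0 <= M & forall t : R, 0 <= t <= 2 * pi -> forall x,
    nrm (resolvent T (mu + rho%:C%C * cis t) x) <= M * nrm x.
Proof.
move=> hc; have := @segment_compact R 0 (2 * pi).
move=> /compact_near_coveringP/(_ nat \oo (fun n t => 0 <= t <= 2 * pi ->
  forall x, nrm (resolvent T (mu + rho%:C%C * cis t) x) <= n%:R * nrm x)).
case.
  move=> t; rewrite /= in_itv /= => t01.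
  have [d d0 [M M0 HM]] := res_locally_bounded (hc t t01).
  have c0 : 0 < 2 * `|rho| + 1 by rewrite ltr_wpDl // mulr_ge0.
  exists (ball t (d / (2 * `|rho| + 1)), [set n | (Num.bound M <= n)%N]).
    split; last by exists (Num.bound M).
    by apply: nbhsx_ballx; rewrite divr_gt0.
  move=> [s n] /= [ts Mn] s01 x.
  apply: le_trans (HM _ (hc s s01) _ x) _.
    rewrite opprD addrACA subrr add0r -mulrBr nrmM nrm_real.
    apply: le_lt_trans (ler_wpM2l (normr_ge0 _) (cisB_le _ _)) _.
    have h : `|s - t| * (2 * `|rho| + 1) < d.
      rewrite -ltr_pdivlMr // distrC; exact: ts.
    by have := normr_ge0 (s - t); lra.
  rewrite ler_wpM2r ?nrm_ge0 // ltW // (lt_le_trans (archi_boundP (ltW M0))) //.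
  by rewrite ler_nat.
move=> N _ HN; exists N%:R => // t t01 x.
by apply: (HN N) => //=; rewrite in_itv.
Qed.

End Resolvent.

(** * Division of power series by [1 - z K] *)

Section Division.
Variable R : realType.
Local Notation C := R[i].

(** From [(1 - z K) g = e] to [g]: the coefficients are given by the recursion of
the quotient. The radius does not depend on the series, so that the lemma can
be applied to all vectors at once. *)
Lemma div_left (V : normedModType C) (K : V -> V) (r : R) : blin K -> 0 < r ->
  exists2 r' : R, 0 < r' <= r & forall (e y : nat -> V) (g : C -> V),
    y 0%N = e 0%N -> (forall k, y k.+1 = e k.+1 + K (y k)) ->
    pser e (fun z => g z - z *: K (g z)) r -> pser y g r'.
Proof.
move=> hK r0; have [q q0 Kq] := blin_gt0 hK.
pose s := (r / 2)^-1 + 2 * q; have i0 : 0 < (r / 2)^-1 by rewrite invr_gt0; lra.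
have s0 : 0 < s by rewrite /s; lra.
have m0 : 0 < Num.min r (1 / (2 * s)).
  by rewrite lt_min r0 divr_gt0 //; lra.
exists (Num.min r (1 / (2 * s))).
  by rewrite m0 ge_min lexx.
move=> e y g y0 yS eg z; rewrite lt_min => /and3P[z0 zr zs].
have [|c c0 Hc] := pser_coef_bound eg (s := r / 2).
  by apply/andP; split; lra.
have yb k : nrm (y k) <= 2 * c * s ^+ k.
  have es j : nrm (e j) <= c * s ^+ j.
    apply: le_trans (Hc j) _; rewrite ler_wpM2l // lerXn2r ?nnegrE //; try exact: ltW.
    by rewrite /s; lra.
  elim: k => [|k IH].
    by rewrite y0; have := es 0%N; rewrite !expr0; lra.
  rewrite yS (le_trans (nrmD _ _)) // (le_trans (lerD (es _) (Kq _))) //.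
  have h : q * nrm (y k) <= q * (2 * c * s ^+ k) by rewrite ler_wpM2l // ltW.
  have h2 : 0 <= c * s ^+ k by rewrite mulr_ge0 // exprn_ge0 // ltW.
  have h3 : c * s ^+ k * (2 * q) <= c * s ^+ k * s.
    by rewrite ler_wpM2l // /s; lra.
  by rewrite exprSr; lra.
have zs2 : nrm z * s <= 1 / 2.
  move: zs; rewrite ltr_pdivlMr; first by lra.
  by lra.
have zq : nrm z * q <= 1 / 2.
  have : nrm z * q <= nrm z * s by rewrite ler_wpM2l ?nrm_ge0 // /s; lra.
  by lra.
have SE N : psum y z N.+1 - z *: K (psum y z N.+1)
    = psum e z N.+1 - z ^+ N.+1 *: K (y N).
  elim: N => [|N IH].
    by rewrite /psum !big_ord_recr !big_ord0 /= !add0r !expr0 !scale1r y0.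
  rewrite !(psumS _ _ N.+1) (linDf hK.1) scalerDr opprD addrACA {}IH.
  rewrite yS (linZf hK.1) scalerDr scalerA -exprS.
  by rewrite addrA [_ + z ^+ N.+1 *: K (y N)]addrC subrKA.
apply/cvg_nrmP => d d0; have d4 : 0 < d / 4 by lra.
have [N1 HN1] := (cvg_nrmP _ _).1 (eg z (introT andP (conj z0 zr))) _ d4.
have h0 : 0 <= 1 / 2 :> R by lra.
have [||N2 HN2] := @pow_small _ (2 * c) _ (1 / 2) d4; rewrite ?mulr_ge0 ?h0 ?lexx //.
exists (N1 + N2).+1 => -[//|N] NN.
have hN1 : nrm (psum e z N.+1 - (g z - z *: K (g z))) < d / 4.
  by apply: HN1; apply: leq_trans NN; rewrite leqW // leq_addr.
have hN2 : 2 * c * (1 / 2) ^+ N < d / 4.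
  by apply: HN2; apply: leq_trans (leq_addl N1 _) _.
set w := psum y z N.+1 - g z.
have wE : w = (psum e z N.+1 - (g z - z *: K (g z))) - z ^+ N.+1 *: K (y N)
   + z *: K w.
  have -> : psum e z N.+1 = psum y z N.+1 - z *: K (psum y z N.+1)
      + z ^+ N.+1 *: K (y N) by rewrite SE subrK.
  rewrite /w (linBf hK.1) scalerBr [X in _ = X + _]addrAC addrK.
  by rewrite opprB [RHS]addrAC !subrKA.
have h1 : nrm (z ^+ N.+1 *: K (y N)) <= 2 * c * (1 / 2) ^+ N.
  rewrite nrmZ nrmX exprSr -mulrA.
  have a1 : nrm z * nrm (K (y N)) <= 2 * c * s ^+ N.
    apply: le_trans (ler_wpM2l (nrm_ge0 z) (Kq _)) _; rewrite mulrA.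
    have a2 : nrm z * q * nrm (y N) <= 1 * nrm (y N).
      by rewrite ler_wpM2r ?nrm_ge0 //; lra.
    by have := yb N; lra.
  apply: le_trans (ler_wpM2l (exprn_ge0 _ (nrm_ge0 z)) a1) _.
  rewrite mulrCA -exprMn ler_wpM2l ?mulr_ge0 // lerXn2r ?nnegrE //.
  by rewrite mulr_ge0 ?nrm_ge0 // ltW.
have h2 : nrm (z *: K w) <= 1 / 2 * nrm w.
  rewrite nrmZ (le_trans (ler_wpM2l (nrm_ge0 z) (Kq _))) // mulrA.
  by rewrite ler_wpM2r ?nrm_ge0.
have h3 : nrm w <= nrm (psum e z N.+1 - (g z - z *: K (g z)))
   + nrm (z ^+ N.+1 *: K (y N)) + nrm (z *: K w).
  rewrite {1}wE (le_trans (nrmD _ _)) // lerD2r.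
  exact: nrmB.
by lra.
Qed.

Lemma neumann_scaled (V : completeNormedModType C) (K : V -> V) (q : R) :
  linear K -> 0 < q -> (forall x, nrm (K x) <= q * nrm x) ->
  forall z : C, nrm z * q <= 1 / 2 ->
  forall x, exists2 y, y - z *: K y = x & nrm y <= 2 * nrm x.
Proof.
move=> lK q0 Kq z zq x; apply: (@neumann _ _ (fun y => z *: K y)).
  by move=> a u v; rewrite lK scalerDr !scalerA mulrC.
move=> y; rewrite nrmZ (le_trans (ler_wpM2l (nrm_ge0 z) (Kq _))) // mulrA.
rewrite [leRHS]mulrC -[2^-1]div1r ler_wpM2r ?nrm_ge0 //.
Qed.
(** From [g (1 - z K) = E] to [g], for operator-valued series. Every vector is
[(1 - z K) y] for small [z], and on such vectors the partial sums of the quotient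
telescope to those of [E] up to a last term controlled by the bounds on [E]. *)
Lemma div_right (V : completeNormedModType C) (W : normedModType C) (K : V -> V) (r c0 s0 : R) :
  blin K -> 0 < r -> 0 <= c0 -> 0 <= s0 ->
  exists2 r' : R, 0 < r' <= r & forall (E A : nat -> V -> W) (g : C -> V -> W),
    (forall k, blin (E k)) -> 
    (forall k x, nrm (E k x) <= c0 * s0 ^+ k * nrm x) ->
    (forall x, A 0%N x = E 0%N x) ->
    (forall k x, A k.+1 x = E k.+1 x + A k (K x)) ->
    (forall y, pser (fun k => E k y) (fun z => g z (y - z *: K y)) r) ->
    [/\ forall k, blin (A k),
        exists c s : R, [/\ 0 <= c, 0 < s &
          forall k x, nrm (A k x) <= c * s ^+ k * nrm x] &
        forall x, pser (fun k => A k x) (fun z => g z x) r'].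
Proof.
move=> hK r0 c00 s00; have [q q0 Kq] := blin_gt0 hK.
pose s := s0 + 2 * q; have sp : 0 < s by rewrite /s; lra.
have sq : 2 * q <= s by rewrite /s; lra.
have m0 : 0 < Num.min r (1 / (2 * s)).
  by rewrite lt_min r0 divr_gt0 //; lra.
exists (Num.min r (1 / (2 * s))); first by rewrite m0 ge_min lexx.
move=> E A g Eb Ebd A0 AS Eg.
have Abl k : blin (A k).
  elim: k => [|k IH]; first by apply: eq_blin (Eb 0%N) => x; rewrite A0.
  apply: (@eq_blin _ _ _ (fun x => E k.+1 x + A k (K x))) => [x|].
    by rewrite AS.
  by apply: blinD => //; apply: (blin_comp IH hK).
have Abd k x : nrm (A k x) <= 2 * c0 * s ^+ k * nrm x.
  have es j y : nrm (E j y) <= c0 * s ^+ j * nrm y.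
    apply: le_trans (Ebd j y) _; rewrite ler_wpM2r ?nrm_ge0 // ler_wpM2l //.
    by rewrite lerXn2r ?nnegrE //; [exact: ltW|rewrite /s; lra].
  elim: k x => [|k IH] x.
    rewrite A0 (le_trans (es _ _)) // ler_wpM2r ?nrm_ge0 //.
    by rewrite !expr0; lra.
  rewrite AS (le_trans (nrmD _ _)) // (le_trans (lerD (es _ _) (IH _))) //.
  rewrite -/s; set w := c0 * s ^+ k; have w0 : 0 <= w by rewrite mulr_ge0 // exprn_ge0 // ltW.
  have h : 2 * w * nrm (K x) <= 2 * w * (q * nrm x).
    by rewrite ler_wpM2l ?Kq // mulr_ge0.
  have h2 : w * nrm x * (2 * q) <= w * nrm x * s.
    by apply: ler_wpM2l => //; rewrite mulr_ge0 ?nrm_ge0.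
  have -> : c0 * s ^+ k.+1 = w * s by rewrite exprSr mulrA.
  have -> : 2 * c0 * s ^+ k.+1 = 2 * w * s by rewrite exprSr /w; ring.
  have -> : 2 * c0 * s ^+ k = 2 * w by rewrite /w; ring.
  lra.
split=> //; first by exists (2 * c0), s; split=> //; rewrite mulr_ge0.
move=> x z; rewrite lt_min => /and3P[z0 zr zs].
have zs2 : nrm z * s <= 1 / 2.
  move: zs; rewrite ltr_pdivlMr; first by lra.
  by lra.
have zq : nrm z * q <= 1 / 2.
  have : nrm z * q <= nrm z * s by rewrite ler_wpM2l ?nrm_ge0 // /s; lra.
  by lra.
have [y <- _] := neumann_scaled hK.1 q0 Kq zq x.
have SE N : psum (fun k => A k (y - z *: K y)) z N.+1
    = psum (fun k => E k y) z N.+1 - z ^+ N.+1 *: A N (K y).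
  elim: N => [|N IH].
    rewrite /psum !big_ord_recr !big_ord0 /= !add0r !expr0 !scale1r.
    by rewrite (linBf (Abl _).1) (linZf (Abl _).1) A0.
  rewrite !(psumS _ _ N.+1) IH.
  rewrite (linBf (Abl _).1) (linZf (Abl _).1) AS scalerBr scalerDr scalerA.
  rewrite -exprSr addrA; congr (_ - _).
  by rewrite [_ + z ^+ N.+1 *: A N (K y)]addrC subrKA.
apply/cvg_nrmP => d d0; have d2 : 0 < d / 2 by lra.
have [N1 HN1] := (cvg_nrmP _ _).1 (Eg y z (introT andP (conj z0 zr))) _ d2.
have h0 : 0 <= 1 / 2 :> R by lra.
have [||N2 HN2] := @pow_small _ (2 * c0 * nrm y) _ (1 / 2) d2.
- by rewrite !mulr_ge0 ?nrm_ge0.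
- by rewrite h0 lexx.
exists (N1 + N2).+1 => -[//|N] NN.
have hN1 : nrm (psum (fun k => E k y) z N.+1 - g z (y - z *: K y)) < d / 2.
  by apply: HN1; apply: leq_trans NN; rewrite leqW // leq_addr.
have hN2 : 2 * c0 * nrm y * (1 / 2) ^+ N < d / 2.
  by apply: HN2; apply: leq_trans (leq_addl N1 _) _.
rewrite SE addrAC (le_lt_trans (nrmB _ _)) //.
have h1 : nrm (z ^+ N.+1 *: A N (K y)) <= 2 * c0 * nrm y * (1 / 2) ^+ N.
  rewrite nrmZ nrmX exprSr -mulrA.
  have b0 : 0 <= 2 * c0 * s ^+ N by rewrite !mulr_ge0 ?exprn_ge0 // ltW.
  have a1 : nrm z * nrm (A N (K y)) <= 2 * c0 * s ^+ N * nrm y.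
    apply: le_trans (ler_wpM2l (nrm_ge0 z) (Abd _ _)) _; rewrite mulrCA.
    rewrite ler_wpM2l //.
    apply: le_trans (ler_wpM2l (nrm_ge0 z) (Kq _)) _; rewrite mulrA.
    rewrite -[leRHS]mul1r ler_wpM2r ?nrm_ge0 //; lra.
  apply: le_trans (ler_wpM2l (exprn_ge0 _ (nrm_ge0 z)) a1) _.
  have -> : nrm z ^+ N * (2 * c0 * s ^+ N * nrm y) =
     2 * c0 * nrm y * (nrm z * s) ^+ N by rewrite exprMn; ring.
  rewrite ler_wpM2l ?mulr_ge0 ?nrm_ge0 // lerXn2r ?nnegrE //.
  by rewrite mulr_ge0 ?nrm_ge0 // ltW.
by lra.
Qed.

End Division.

(** * Operators of finite rank *)

Section FiniteRank.
Variable R : realType.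
Local Notation C := R[i].

Section Closure.
Variables (U V W : lmodType C).
Implicit Types (D : set U).

Lemma finite_rank0 D : finite_rank_on D (fun _ : U => 0 : V).
Proof.
by exists 0%N, (fun _ => 0) => u _; exists (fun=> 0); rewrite big_ord0.
Qed.

Lemma finite_rankD D (f g : U -> V) : finite_rank_on D f -> finite_rank_on D g ->
  finite_rank_on D (fun x => f x + g x).
Proof.
move=> [m [e He]] [n [h Hh]].
exists (m + n)%N, (fun k => match @fintype.split m n k with inl i => e i | inr j => h j end).
move=> u Du; have [c ->] := He u Du; have [d ->] := Hh u Du.
exists (fun k => match @fintype.split m n k with inl i => c i | inr j => d j end).
rewrite big_split_ord /=; congr (_ + _); apply: eq_bigr => i _.
  by rewrite (unsplitK (inl i)).
by rewrite (unsplitK (inr i)).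
Qed.

Lemma finite_rank_comp D (f : U -> V) (h : V -> W) : linear h ->
  finite_rank_on D f -> finite_rank_on D (fun x => h (f x)).
Proof.
move=> lh [m [e He]]; exists m, (fun i => h (e i)) => u Du.
have [c ->] := He u Du; exists c.
have h0 : h 0 = 0 by have := lh (-1) 0 0; rewrite scaler0 addr0 scaleN1r addNr.
have hD : {morph h : x y / x + y} by move=> x y; have := lh 1 x y; rewrite !scale1r.
rewrite (big_morph h hD h0); apply: eq_bigr => i _.
by have := lh (c i) (e i) 0; rewrite !addr0 h0 addr0.
Qed.

Lemma eq_finite_rank D (f g : U -> V) : (forall x, D x -> f x = g x) ->
  finite_rank_on D f -> finite_rank_on D g.
Proof.
move=> fg [m [e He]]; exists m, e => u Du; have [c E] := He u Du.
by exists c; rewrite -fg.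
Qed.
End Closure.

Lemma finite_rank_precomp (U U' V : lmodType C) (D : set U) (D' : set U') (f : U -> V)
    (g : U' -> U) : (forall x, D' x -> D (g x)) ->
  finite_rank_on D f -> finite_rank_on D' (fun x => f (g x)).
Proof. by move=> gD [m [e He]]; exists m, e => u Du; apply/He/gD. Qed.

(** The coefficient rows of the vectors in the range form a subspace of the finite
dimensional space of rows, so a matrix of maximal rank with rows in it spans
them all; this yields a finite spanning family inside the range itself. *)
Lemma finite_rank_span (V : lmodType C) (P : V -> V) : linear P ->
  finite_rank_on setT P -> exists (m : nat) (x : 'I_m.+1 -> V),
  forall u, exists c : 'I_m.+1 -> C, P u = \sum_(i < m.+1) c i *: P (x i).
Proof.
move=> lP [d [e He]].
pose ev (c : 'rV[C]_d) := \sum_(i < d) c 0 i *: e i.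
pose good n (M : 'M[C]_(n, d)) := forall j, exists u, P u = ev (row j M).
pose Q k := `[< exists n (M : 'M[C]_(n, d)), good n M /\ \rank M = k >].
have Q0 : Q 0%N by apply/asboolP; exists 0%N, 0; split; [case|rewrite mxrank0].
have Qd k : Q k -> (k <= d)%N.
  by move=> /asboolP[n [M [_ <-]]]; apply: rank_leq_col.
have [k /asboolP[n [M [gM rM]]] kmax] := ex_maxnP (ex_intro Q _ Q0) Qd.
have /choice [x Hx] := gM.
have HM u : exists c : 'I_n -> C, P u = \sum_(i < n) c i *: P (x i).
  have [c Ec] := He u I; pose r : 'rV[C]_d := \row_i c i.
  have Pr : P u = ev r by rewrite Ec; apply: eq_bigr => i _; rewrite mxE.
  (* Otherwise adding the row [r] would increase the maximal rank. *)
  have rM' : (r <= M)%MS.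
    have : (\rank (col_mx M r) <= k)%N.
      apply: kmax; apply/asboolP; exists (n + 1)%N, (col_mx M r); split=> // j.
      have [i ->|i ->] := fintype.split_ordP j.
        by exists (x i); rewrite rowKu Hx.
      by exists u; rewrite rowKd Pr; congr ev; apply/rowP => l; rewrite ord1 !mxE.
    rewrite -rM -addsmxE => h.
    apply: (submx_trans (addsmxSr M r)).
    by rewrite -(geq_leqif (mxrank_leqif_sup (addsmxSl M r))).
  have [a ra] := submxP rM'.
  exists (fun i => a 0 i); rewrite Pr ra /ev.
  under [RHS]eq_bigr do rewrite Hx /ev scaler_sumr.
  rewrite exchange_big /=; apply: eq_bigr => i _.
  rewrite mxE scaler_suml; apply: eq_bigr => j _.
  by rewrite scalerA mxE.
exists n, (fun i => if unlift ord0 i is Some j then x j else 0) => u.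
have [c Ec] := HM u.
exists (fun i => if unlift ord0 i is Some j then c j else 0).
rewrite big_ord_recl unlift_none scale0r add0r Ec.
by apply: eq_bigr => i _; rewrite liftK.
Qed.

Section PolyOp.
Variables (V : lmodType C) (D : V -> V).
Hypothesis lD : linear D.

Definition poly_op (p : {poly C}) (v : V) := \sum_(i < size p) p`_i *: iter i D v.

Lemma poly_op_wide n (p : {poly C}) v : (size p <= n)%N ->
  poly_op p v = \sum_(i < n) p`_i *: iter i D v.
Proof.
move=> pn; rewrite /poly_op (big_ord_widen n (fun i => p`_i *: iter i D v)) //.
rewrite big_mkcond; apply: eq_bigr => i _; case: ltnP => // h.
by rewrite nth_default // scale0r.
Qed.

Lemma poly_opD p q v : poly_op (p + q) v = poly_op p v + poly_op q v.
Proof.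
pose n := maxn (size p) (size q).
rewrite !(@poly_op_wide n) ?leq_maxl ?leq_maxr ?size_polyD // -big_split /=.
by apply: eq_bigr => i _; rewrite coefD scalerDl.
Qed.

Lemma poly_opC c v : poly_op c%:P v = c *: v.
Proof.
by rewrite (@poly_op_wide 1) ?size_polyC ?leq_b1 // big_ord_recr /= big_ord0 add0r coefC.
Qed.

Lemma poly_opZ c p v : poly_op (c *: p) v = c *: poly_op p v.
Proof.
rewrite (@poly_op_wide (size p)) ?size_scale_leq // /poly_op scaler_sumr.
by apply: eq_bigr => i _; rewrite coefZ scalerA.
Qed.

Lemma poly_opMX p v : poly_op (p * 'X) v = poly_op p (D v).
Proof.
rewrite (@poly_op_wide (size p).+1); last first.
  by rewrite (leq_trans (size_polyMleq _ _)) // size_polyX addn2.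
rewrite big_ord_recl /= coefMX scale0r add0r /poly_op.
by apply: eq_bigr => i _; rewrite coefMX /= -iterSr.
Qed.

Lemma poly_op_lin p : linear (poly_op p).
Proof.
have itL i : linear (fun v => iter i D v).
  by elim: i => [|i IH] a x y //=; rewrite IH lD.
move=> a x y; rewrite /poly_op scaler_sumr -big_split /=; apply: eq_bigr => i _.
by rewrite itL scalerDr !scalerA mulrC.
Qed.

Lemma poly_op0v p : poly_op p 0 = 0.
Proof.
by have := poly_op_lin p (-1) 0 0; rewrite scaler0 addr0 scaleN1r addNr.
Qed.

Lemma poly_opDv p x y : poly_op p (x + y) = poly_op p x + poly_op p y.
Proof. by have := poly_op_lin p 1 x y; rewrite !scale1r. Qed.

Lemma poly_opZv p a x : poly_op p (a *: x) = a *: poly_op p x.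
Proof. by have := poly_op_lin p a x 0; rewrite !addr0 poly_op0v addr0. Qed.

Lemma poly_op_comm (S : V -> V) p v : linear S -> (forall x, S (D x) = D (S x)) ->
  S (poly_op p v) = poly_op p (S v).
Proof.
move=> lS SD.
have S0 : S 0 = 0 by have := lS (-1) 0 0; rewrite scaler0 addr0 scaleN1r addNr.
have SDD : {morph S : x y / x + y} by move=> x y; have := lS 1 x y; rewrite !scale1r.
rewrite /poly_op (big_morph S SDD S0); apply: eq_bigr => i _.
have := lS p`_i (iter i D v) 0; rewrite !addr0 S0 addr0 => ->; congr (_ *: _).
by elim: (nat_of_ord i) => [|k IH] //=; rewrite SD IH.
Qed.

Lemma poly_opD_comm p v : D (poly_op p v) = poly_op p (D v).
Proof. exact: poly_op_comm. Qed.

Lemma poly_opM p q v : poly_op (p * q) v = poly_op p (poly_op q v).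
Proof.
elim/poly_ind: p v => [|p c IH] v.
  by rewrite mul0r (poly_opC 0 v) (poly_opC 0 (poly_op q v)) !scale0r.
rewrite mulrDl -mulrA -commr_polyX mulrA poly_opD poly_opMX IH mul_polyC poly_opZ.
by rewrite poly_opD poly_opMX poly_opC poly_opD_comm.
Qed.

Lemma poly_opXn n v : poly_op 'X^n v = iter n D v.
Proof.
elim: n v => [|n IH] v; first by rewrite expr0 (poly_opC 1 v) scale1r.
by rewrite exprSr poly_opMX IH -iterSr.
Qed.

(** Cayley-Hamilton for the matrix of [D] on the finite-dimensional, [D]-stable
range of [P]. *)
Lemma annihilating_poly (P : V -> V) : linear P -> finite_rank_on setT P ->
  (forall x, P (D x) = D (P x)) ->
  exists2 p : {poly C}, p != 0 & forall x, poly_op p (P x) = 0.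
Proof.
move=> lP frP PD; have [m [x Hx]] := finite_rank_span lP frP.
have /choice [N0 HN0] : forall j, exists c : 'I_m.+1 -> C,
    D (P (x j)) = \sum_(i < m.+1) c i *: P (x i).
  by move=> j; rewrite -PD; apply: Hx.
pose N : 'M[C]_m.+1 := \matrix_(j, i) N0 j i.
pose act (M : 'M[C]_m.+1) j := \sum_(i < m.+1) M j i *: P (x i).
have Npow k j : iter k D (P (x j)) = act (N ^+ k) j.
  elim: k j => [|k IH] j.
    rewrite expr0 /act (bigD1 j) //= mxE eqxx scale1r big1 ?addr0 // => i ij.
    by rewrite mxE eq_sym (negbTE ij) scale0r.
  rewrite iterSr HN0.
  have itL : linear (fun v => iter k D v).
    by elim: (k) => [|i IHi] a u v //=; rewrite IHi lD.
  have it0 : iter k D 0 = 0.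
    by have := itL (-1) 0 0; rewrite scaler0 addr0 scaleN1r addNr.
  have itD : {morph (fun v => iter k D v) : u v / u + v}.
    by move=> u v; have := itL 1 u v; rewrite !scale1r.
  rewrite (big_morph _ itD it0) exprS /act.
  under eq_bigr => i _.
    have -> : iter k D (N0 j i *: P (x i)) = N0 j i *: iter k D (P (x i)).
      by have := itL (N0 j i) (P (x i)) 0; rewrite !addr0 it0 addr0.
    rewrite IH /act scaler_sumr; over.
  rewrite exchange_big /=; apply: eq_bigr => i _.
  rewrite mxE scaler_suml; apply: eq_bigr => l _.
  by rewrite scalerA mxE.
exists (char_poly N); first by rewrite monic_neq0 // char_poly_monic.
move=> u; have [c ->] := Hx u.
have pl := poly_op_lin (char_poly N).
rewrite (big_morph _ (poly_opDv (char_poly N)) (poly_op0v _)).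
rewrite big1 // => j _; rewrite poly_opZv /poly_op.
under eq_bigr do rewrite Npow /act scaler_sumr.
rewrite exchange_big /= [X in _ *: X]big1 ?scaler0 // => i _.
have CH : \sum_(l < size (char_poly N)) (char_poly N)`_l *: N ^+ l = 0.
  rewrite -[RHS](Cayley_Hamilton N).
  rewrite -[X in _ = horner_mx _ X]coefK poly_def linear_sum /=.
  by apply: eq_bigr => l _; rewrite linearZ /= rmorphXn /= horner_mx_X.
have /matrixP/(_ j i) := CH; rewrite summxE mxE => E.
rewrite -[RHS](scale0r (P (x i))) -[X in _ = X *: _]E scaler_suml.
by apply: eq_bigr => l _; rewrite scalerA mxE.
Qed.
End PolyOp.
End FiniteRank.

(** * The Riesz projection as a limit of averages *)

Section Averages.
Variable R : realType.
Local Notation C := R[i].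

Lemma eq_cvgn (V : normedModType C) (u v : nat -> V) (l : V) :
  u =1 v -> u @ \oo --> l -> v @ \oo --> l.
Proof. by move=> /funext ->. Qed.

Lemma blin_lim (V W : normedModType C) (F : nat -> V -> W) (G : V -> W) (M : R) :
  (forall n, linear (F n)) -> (forall n x, nrm (F n x) <= M * nrm x) ->
  (forall x, (fun n => F n x) @ \oo --> G x) -> blin G.
Proof.
move=> lF bF FG; split.
  move=> a x y; apply: cvg_nrm_uniq (FG _) _.
  under eq_fun do rewrite lF.
  apply: cvgD; last exact: FG.
  exact: (blin_cvg (blinZ a (blin_id W)) (FG x)).
exists M => x; apply/ler_addgt0Pr => e e0.
have [N HN] := (cvg_nrmP _ _).1 (FG x) e e0.
have := HN N (leqnn _); have := bF N x; have := nrm_triB (F N x) (G x) 0.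
rewrite !subr0 (nrmBC (G x)); lra.
Qed.

Lemma big_ord_mul (V : nmodType) (F : nat -> V) N M :
  \sum_(j < N * M) F j = \sum_(a < N) \sum_(b < M) F (a * M + b)%N.
Proof.
elim: N => [|N IH]; first by rewrite mul0n !big_ord0.
by rewrite mulSnr big_split_ord /= IH big_ord_recr.
Qed.

Definition avg (V : lmodType C) (f : R -> V) (c : R) (N : nat) : V :=
  (N%:R^-1)%:C%C *: \sum_(k < N) f (c / N%:R * k%:R).

(** Refining a uniform partition moves each sample point by less than the mesh. *)
Lemma avg_mul (V : normedModType C) (f : R -> V) (c L : R) N M :
  0 <= c -> 0 <= L ->
  (forall s t, 0 <= s <= c -> 0 <= t <= c -> nrm (f s - f t) <= L * `|s - t|) ->
  nrm (avg f c N.+1 - avg f c (N.+1 * M.+1)) <= L * c / N.+1%:R.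
Proof.
move=> c0 L0 fL.
have n0 : 0 < N.+1%:R :> R by rewrite ltr0n.
have m0 : 0 < M.+1%:R :> R by rewrite ltr0n.
have nC : N.+1%:R != 0 :> R by rewrite gt_eqF.
have mC : M.+1%:R != 0 :> R by rewrite gt_eqF.
have -> : avg f c N.+1 = ((N.+1 * M.+1)%:R^-1)%:C%C *:
    \sum_(a < N.+1) \sum_(b < M.+1) f (c / N.+1%:R * a%:R).
  rewrite /avg; under [in RHS]eq_bigr do rewrite sumr_const card_ord -scaler_nat.
  rewrite -scaler_sumr scalerA; congr (_ *: _).
  rewrite natrM invfM rcM -mulrA -[LHS]mulr1; congr (_ * _).
  by rewrite -[M.+1%:R in X in _ = _ * X](rmorph_nat (real_complex R)) -rcM mulVf.
rewrite /avg (big_ord_mul (fun j => f (c / (N.+1 * M.+1)%:R * j%:R))).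
rewrite -scalerBr -sumrB nrmZ nrm_real ger0_norm ?invr_ge0 ?ler0n //.
rewrite mulrC ler_pdivrMr ?ltr0n ?muln_gt0 //.
apply: le_trans (nrm_sum _ _ _) _.
have -> : L * c / N.+1%:R * (N.+1 * M.+1)%:R =
   \sum_(a < N.+1) \sum_(b < M.+1) L * c / N.+1%:R.
  by rewrite !sumr_const !card_ord -mulrnA mulnC -[RHS]mulr_natr.
apply: ler_sum => a _; rewrite -sumrB; apply: le_trans (nrm_sum _ _ _) _.
apply: ler_sum => b _.
have ha : a%:R <= N.+1%:R :> R by rewrite ler_nat ltnW.
have hb : b%:R <= M.+1%:R :> R by rewrite ler_nat ltnW.
(* Both sample points stay in [0, c], where [f] is Lipschitz. *)
have hab : (a * M.+1 + b)%:R <= N.+1%:R * M.+1%:R :> R.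
  rewrite -natrM ler_nat (@leq_trans (a.+1 * M.+1)) //.
    by rewrite mulSnr leq_add2l ltnW.
  by rewrite leq_mul2r ltn_ord orbT.
apply: le_trans (fL _ _ _ _) _.
- rewrite mulr_ge0 ?divr_ge0 //=.
  by rewrite mulrAC ler_pdivrMr // ler_wpM2l.
- rewrite mulr_ge0 ?divr_ge0 //= natrM.
  by rewrite mulrAC ler_pdivrMr ?mulr_gt0 // ler_wpM2l.
rewrite -[leRHS]mulrA ler_wpM2l //.
have -> : c / N.+1%:R * a%:R - c / (N.+1 * M.+1)%:R * (a * M.+1 + b)%:R
   = - (c / N.+1%:R * (b%:R / M.+1%:R)).
  rewrite natrD !natrM; move: nC mC.
  move: (N.+1%:R : R) (M.+1%:R : R) => n' m' nC mC; field.
  by rewrite mC nC.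
rewrite normrN ger0_norm; last by rewrite mulr_ge0 ?divr_ge0.
by rewrite ler_piMr ?divr_ge0 // ler_pdivrMr // mul1r.
Qed.

Lemma avg_cvg (V : completeNormedModType C) (f : R -> V) (c L : R) :
  0 <= c -> 0 <= L ->
  (forall s t, 0 <= s <= c -> 0 <= t <= c -> nrm (f s - f t) <= L * `|s - t|) ->
  exists l : V, (fun n => avg f c n.+1) @ \oo --> l.
Proof.
move=> c0 L0 fL; apply: cauchy_cvg_nrm => e e0.
have lc0 : 0 <= L * c by rewrite mulr_ge0.
exists (Num.bound (2 * (L * c) / e)) => m n hm hn.
have h N : (Num.bound (2 * (L * c) / e) <= N)%N -> L * c / N.+1%:R < e / 2.
  move=> hN; have n0 : 0 < N.+1%:R :> R by rewrite ltr0n.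
  have : 2 * (L * c) / e < N.+1%:R.
    apply: lt_le_trans (archi_boundP _) _; first by rewrite divr_ge0 ?mulr_ge0 ?(ltW e0).
    by rewrite ler_nat (leq_trans hN).
  by rewrite !ltr_pdivrMr //; lra.
have h1 := avg_mul m n c0 L0 fL; have h2 := avg_mul n m c0 L0 fL.
rewrite (mulnC n.+1) in h2.
have := nrm_triB (avg f c (m.+1 * n.+1)) (avg f c m.+1) (avg f c n.+1).
rewrite (nrmBC (avg f c (_ * _))).
have h3 := le_lt_trans h1 (h m hm); have h4 := le_lt_trans h2 (h n hn).
by move: h3 h4; lra.
Qed.

End Averages.

Section Laurent.
Variable R : realType.
Local Notation C := R[i].

(** The Laurent expansion of the resolvent with a pole of order at most [p] at
[mu]; [A k] is the coefficient of index [k - p]. *)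
Definition res_laurent (V : normedModType C) (T : operator V) (mu : C)
    (p : nat) (A : nat -> V -> V) (r : R) :=
  [/\ 0 < r, punctured_disc mu r `<=` resolvent_set T, forall k, blin (A k),
      exists c s : R, [/\ 0 <= c, 0 < s &
        forall k x, nrm (A k x) <= c * s ^+ k * nrm x] &
      forall x, pser (fun k => A k x)
        (fun z => z ^+ p *: resolvent T (mu + z) x) r].

Lemma punctured_disc_add (mu z : C) (r : R) : 0 < nrm z < r ->
  punctured_disc mu r (mu + z).
Proof.
by rewrite /punctured_disc /= [mu + z]addrC addrK nrmE !ltcR.
Qed.

Lemma punctured_disc_sub (mu : C) (r s : R) : r <= s ->
  punctured_disc mu r `<=` punctured_disc mu s.
Proof.
move=> rs l; rewrite /punctured_disc /= => /andP[-> h] /=.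
by rewrite (lt_le_trans h) // lecR.
Qed.

Lemma punctured_discP (mu lam : C) (r : R) : punctured_disc mu r lam ->
  0 < nrm (lam - mu) < r.
Proof. by rewrite /punctured_disc /= nrmE !ltcR. Qed.

Section FromProjection.
Variables (V : completeNormedModType C) (T : operator V) (mu : C).
Hypothesis Tlin : is_linear T.

(** [P] is the limit of the averages of [- z R (mu + z)] and [Q] the limit of the
averages of [R (mu + z)], with [z] on a circle. As [(T - mu) R = 1 + z R], the
averages satisfy [(T - mu) Q = 1 - P], and this identity survives the limit after
an application of the resolvent at a fixed point. [P] commutes with
that resolvent because the averages do. *)
Lemma riesz_parametrix (P : V -> V) : is_Riesz_projection T mu P ->
  exists (Q : V -> V) (l0 : C), [/\ blin P, blin Q, resolvent_set T l0,
    (forall x, P (resolvent T l0 x) = resolvent T l0 (P x)) &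
    forall x, dom T (Q x) /\ T (Q x) - mu *: Q x = x - P x].
Proof.
move=> [rho [r0 Hrho HP]].
have rc (t : R) : resolvent_set T (mu + rho%:C%C * cis t).
  apply: Hrho; rewrite /= [mu + _]addrC addrK nrmE nrmM nrm_cis mulr1.
  by rewrite nrm_real_gt0 // !lecR !ltcR r0 lexx.
have [M M0 HM] := res_circle_bound Tlin (fun t _ => rc t).
pose l0 := mu + rho%:C%C * cis 0.
pose f t := resolvent T (mu + rho%:C%C * cis t).
pose g t x := - ((rho%:C%C * cis t) *: f t x).
have pi0 : 0 < 2 * pi :> R by rewrite mulr_gt0 ?pi_gt0.
pose PN n x := avg (fun t => g t x) (2 * pi) n.+1.
pose QN n x := avg (fun t => f t x) (2 * pi) n.+1.
have in01 n (k : 'I_n.+1) : 0 <= (2 * pi / n.+1%:R * k%:R : R) <= 2 * pi.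
  have n0 : 0 < n.+1%:R :> R by rewrite ltr0n.
  rewrite mulr_ge0 ?divr_ge0 ?(ltW pi0) //=.
  by rewrite mulrAC ler_pdivrMr // ler_wpM2l ?(ltW pi0) // ler_nat ltnW.
have fl t : linear (f t) by apply: res_lin.
have gl t : linear (g t).
  by move=> a x y; rewrite /g fl scalerDr opprD scalerN !scalerA [a * _]mulrC.
have avgl (h : R -> V -> V) n : (forall t, linear (h t)) ->
    linear (fun x => avg (fun t => h t x) (2 * pi) n.+1).
  move=> hl a x y; rewrite /avg; under eq_bigr do rewrite hl.
  by rewrite big_split /= -scaler_sumr scalerDr !scalerA [a * _]mulrC.
have avgb (h : R -> V -> V) (m : R) n x : 0 <= m ->
    (forall t, 0 <= t <= 2 * pi -> nrm (h t x) <= m * nrm x) ->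
    nrm (avg (fun t => h t x) (2 * pi) n.+1) <= m * nrm x.
  move=> m0 hb; have n0 : 0 < n.+1%:R :> R by rewrite ltr0n.
  rewrite /avg nrmZ nrm_real ger0_norm ?invr_ge0 ?(ltW n0) // mulrC.
  rewrite ler_pdivrMr //; apply: le_trans (nrm_sum _ _ _) _.
  have -> : m * nrm x * n.+1%:R = \sum_(k < n.+1) (m * nrm x).
    by rewrite sumr_const card_ord mulr_natr.
  by apply: ler_sum => k _; apply/hb/in01.
have Pcvg x : (fun n => PN n x) @ \oo --> P x.
  have [I0 HI ->] := HP x.
  apply: eq_cvgn (blin_cvg (blinZ (- (2 * (pi : R)%:C%C * 'i%C)^-1) (blin_id V))
     (riemann_equi pi0 HI)) => n.
  rewrite /PN /avg /= scalerA !scaler_sumr; apply: eq_bigr => k _.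
  rewrite !subr0 add0r /g -scaleNr !scalerA; congr (_ *: _).
  have pC : (pi : R)%:C%C != 0 :> C.
    by rewrite -nrm_eq0 nrm_real normr_eq0 gt_eqF // pi_gt0.
  have iC : 'i%C != 0 :> C.
    by rewrite -nrm_eq0 /nrm normc_def /= expr0n expr1n add0r sqrtr1 oner_eq0.
  rewrite !rcM; have -> : 2%:C%C = 2 :> C by rewrite rmorph_nat.
  move: (_^-1)%:C%C (cis _) => w c'; move: (pi : R)%:C%C pC => q pC; field.
  by rewrite iC pC.
have Qcvg x : exists q : V, (fun n => QN n x) @ \oo --> q.
  apply: (@avg_cvg _ _ _ _ (rho * 2 * (M * M) * nrm x)); first exact: ltW.
    by rewrite !mulr_ge0 ?nrm_ge0 // ltW.
  move=> s t hs ht; rewrite /f (res_identity Tlin x (rc s) (rc t)).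
  rewrite addrC addKr.
  rewrite nrmZ opprD addrACA subrr add0r -mulrBr nrmM nrm_real_gt0 //.
  have h1 := cisB_le s t.
  have h2 : nrm (f t (f s x)) <= M * (M * nrm x).
    by apply: le_trans (HM t ht _) _; rewrite ler_wpM2l // HM.
  apply: le_trans (ler_pM _ _ (ler_wpM2l (ltW r0) h1) h2) _.
  - by rewrite mulr_ge0 ?nrm_ge0 // ltW.
  - exact: nrm_ge0.
  by rewrite le_eqVlt; apply/orP; left; apply/eqP; ring.
have /choice [Q HQ] := Qcvg.
have hl0 : resolvent_set T l0 := rc 0.
have bP : blin P.
  apply: (@blin_lim _ _ _ PN P (rho * M)) => [n|n x|//]; first exact: avgl.
  apply: avgb; first by rewrite mulr_ge0 // ltW.
  move=> t ht; rewrite /g nrmN nrmZ nrmM nrm_cis mulr1 nrm_real_gt0 // -mulrA.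
  by rewrite ler_wpM2l ?(ltW r0) // HM.
have bQ : blin Q.
  apply: (@blin_lim _ _ _ QN Q M) => [n|n x|//]; first exact: avgl.
  by apply: avgb => // t ht; apply: HM.
exists Q, l0; split=> //.
  move=> x; apply: cvg_nrm_uniq (Pcvg _) _.
  apply: eq_cvgn (blin_cvg (res_blin Tlin hl0) (Pcvg x)) => n.
  have Sl := res_lin Tlin hl0.
  rewrite /PN /avg (linZf Sl) (lin_sum Sl); congr (_ *: _); apply: eq_bigr => k _.
  by rewrite /g (linNf Sl) (linZf Sl) /f (res_comm Tlin _ (rc _) hl0).
move=> x; set S := resolvent T l0.
have QE n : QN n x = S (x - PN n x + (mu - l0) *: QN n x).
  have step t : f t x = S (x - g t x + (mu - l0) *: f t x).
    rewrite /S -[LHS](resK hl0 (res_dom (rc t) x)); congr (S _).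
    rewrite (res_eq (rc t)) /g opprK -/(f t x) -!addrA -scalerBl -scalerDl.
    by congr (_ + _ *: _); ring.
  have Sl := res_lin Tlin hl0.
  rewrite {1}/QN /avg; under eq_bigr do rewrite step.
  rewrite -(lin_sum Sl) -(linZf Sl); congr S.
  rewrite big_split /= sumrB sumr_const card_ord scalerDr scalerBr.
  rewrite -scaler_sumr [in X in _ + X]scalerA [in X in _ + X]mulrC -scalerA.
  congr (_ - _ + _).
  rewrite -[x *+ _]scaler_nat scalerA rcV rmorph_nat.
  by rewrite mulVf ?scale1r // pnatr_eq0.
have QE' : Q x = S (x - P x + (mu - l0) *: Q x).
  apply: cvg_nrm_uniq (HQ x) _; under eq_fun do rewrite QE.
  apply: (blin_cvg (res_blin Tlin hl0)); apply: cvgD.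
    apply: cvgB; first exact: cvg_cst.
    exact: Pcvg.
  exact: (blin_cvg (blinZ _ (blin_id V)) (HQ x)).
split; first by rewrite QE'; apply: res_dom.
have E : T (Q x) = x - P x + (mu - l0) *: Q x + l0 *: Q x.
  by rewrite {1}QE' (res_eq hl0) -/S -QE'.
by rewrite E -[X in X - _]addrA -scalerDl subrK addrK.
Qed.
End FromProjection.
End Laurent.

(** * The Laurent expansion at an isolated eigenvalue *)

Section RieszLaurent.
Variable R : realType.
Local Notation C := R[i].

Lemma poly_split0 (q : {poly C}) : exists q' : {poly C}, q = q' * 'X + (q`_0)%:P.
Proof.
elim/poly_ind: q => [|p c _]; first by exists 0; rewrite mul0r coef0 addr0.
by exists p; rewrite coefD coefMX coefC add0r.
Qed.

(** An annihilating polynomial is [x ^ m * (1 - x * phi)] up to a constant; this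
separates the nilpotent part of [D] from the part that is invertible at 0. *)
Lemma annihilating_poly_split (V : lmodType C) (D P : V -> V) : linear D -> linear P ->
  finite_rank_on setT P -> (forall x, P (D x) = D (P x)) ->
  exists (m : nat) (phi : {poly C}),
    forall x, iter m D (P x - D (poly_op D phi (P x))) = 0.
Proof.
move=> lD lP fP PD; have [p p0 Hp] := annihilating_poly lD lP fP PD.
have [m [q]] := multiplicity_XsubC p 0; rewrite p0 /= => q0 pE.
have c0 : q`_0 != 0 by move: q0; rewrite rootE horner_coef0.
have [q' qE] := poly_split0 q.
exists m, (- (q`_0)^-1 *: q') => x.
have := Hp x; rewrite pE polyC0 subr0 mulrC poly_opM // poly_opXn // => E.
have -> : P x - D (poly_op D (- (q`_0)^-1 *: q') (P x)) = (q`_0)^-1 *: poly_op D q (P x).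
  have -> : poly_op D q (P x) = D (poly_op D q' (P x)) + q`_0 *: P x.
    by rewrite {1}qE poly_opD // poly_opMX // poly_opC // -poly_opD_comm.
  rewrite poly_opZ //.
  have D0 : D 0 = 0 by have := lD (-1) 0 0; rewrite scaler0 addr0 scaleN1r addNr.
  have := lD (- (q`_0)^-1) (poly_op D q' (P x)) 0; rewrite !addr0 D0 addr0 => ->.
  by rewrite scalerDr scalerA mulVf // scale1r scaleNr opprK addrC.
have itL : linear (fun v => iter m D v).
  by elim: (m) => [|i IH] a u v //=; rewrite IH lD.
have it0 : iter m D 0 = 0.
  by have := itL (-1) 0 0; rewrite scaler0 addr0 scaleN1r addNr.
by have := itL (q`_0)^-1 (poly_op D q (P x)) 0; rewrite !addr0 it0 addr0 E scaler0.
Qed.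

Lemma poly_op_blin (V : normedModType C) (D : V -> V) (p : {poly C}) : blin D ->
  blin (poly_op D p).
Proof.
move=> hD; apply: (@blin_sum _ _ _ (fun i x => p`_i *: iter i D x)) => k _.
exact/blinZ/blin_iter.
Qed.

Lemma blin_family_bound (V W : normedModType C) (F : nat -> V -> W) n :
  (forall k, (k < n)%N -> blin (F k)) ->
  exists2 c : R, 0 <= c & forall k x, (k < n)%N -> nrm (F k x) <= c * nrm x.
Proof.
elim: n => [|n IH] H; first by exists 0.
have [|c c0 Hc] := IH; first by move=> k kn; apply/H/ltnW.
have [d d0 Hd] := blin_gt0 (H n (ltnSn n)).
exists (c + d) => [|k x]; first by rewrite addr_ge0 // ltW.
rewrite ltnS leq_eqVlt mulrDl => /orP[/eqP ->|kn].
  by rewrite (le_trans (Hd x)) // lerDr mulr_ge0 ?nrm_ge0.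
by rewrite (le_trans (Hc k x kn)) // lerDl mulr_ge0 ?nrm_ge0 // ltW.
Qed.

(** The coefficients of [E(z) (1 - z K)^-1]. *)
Fixpoint quot_coef (V W : lmodType C) (K : V -> V) (E : nat -> V -> W) (k : nat)
    (x : V) : W :=
  if k is k'.+1 then E k x + quot_coef K E k' (K x) else E 0%N x.

Lemma quot_coef_finite_rank (V W : lmodType C) (K : V -> V) (E : nat -> V -> W) n :
  (forall k, (k < n)%N -> finite_rank_on setT (E k)) ->
  forall k, (k < n)%N -> finite_rank_on setT (quot_coef K E k).
Proof.
move=> HE; elim=> [|k IH] kn; first exact: HE.
apply: finite_rankD; first exact: HE.
by apply: (@finite_rank_precomp _ V _ _ setT) => //; apply: IH; apply: ltnW.
Qed.

Section AtIsolatedPoint.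
Variables (V : completeNormedModType C) (T : operator V) (mu : C).
Hypothesis Tlin : is_linear T.

(** [(T - mu) Q = 1 - P] with [P] of finite rank. On the range of [P] the operator
[T - mu] acts as a bounded operator [D]; correcting [Q] by a polynomial in [D]
replaces [P] by [P0] with [D ^ d P0 = 0], so that [R (mu + z) P0] is a polynomial in
[1 / z]. Then [z ^ d R (mu + z) (1 - z Q')] is a polynomial in [z], and dividing by
[1 - z Q'] gives the Laurent expansion with a principal part of finite rank. *)
Lemma riesz_laurent (P : V -> V) (r0 : R) : 0 < r0 ->
  punctured_disc mu r0 `<=` resolvent_set T ->
  is_Riesz_projection T mu P -> finite_rank_on setT P ->
  exists p A r, res_laurent T mu p A r /\
    forall k, (k < p)%N -> finite_rank_on setT (A k).
Proof.
move=> r00 hr0 HP frP.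
have [Q [l0 [bP bQ hl0 PS HQ]]] := riesz_parametrix Tlin HP.
have bS := res_blin Tlin hl0; set S := resolvent T l0 in PS bS.
(* The resolvent is injective, so the power of the variable in its annihilating
   polynomial can be dropped: on the range of [P], [S] is invertible. *)
have iS m x : iter m S x = 0 -> x = 0.
  elim: m => [//|m IH] E; apply: IH; move: E => /= E.
  have [_] := resP hl0 (iter m S x); rewrite -/S E op0 // scaler0 subrr.
  by move=> <-.
have [m [phi Hphi]] := annihilating_poly_split bS.1 bP.1 frP PS.
have PE x : P x = S (poly_op S phi (P x)).
  by apply/eqP; rewrite -subr_eq0; apply/eqP; apply: (iS m).
(* The action of [T - mu] on the range of [P]. *)
pose D x := poly_op S phi x + (l0 - mu) *: x.
have bD : blin D by apply: blinD; [apply: poly_op_blin|apply/blinZ/blin_id].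
have PD x : P (D x) = D (P x).
  rewrite /D (linDf bP.1) (linZf bP.1) (poly_op_comm _ _ bP.1) //.
have domP x : dom T (P x) by rewrite PE; apply: res_dom.
have TP x : T (P x) - mu *: P x = D (P x).
  rewrite {1}PE (res_eq hl0) -/S -PE /D.
  by rewrite -addrA -scalerBl.
have [d [psi Hpsi]] := annihilating_poly_split bD.1 bP.1 frP PD.
(* The nilpotent part of [P] for [D]. *)
pose P0 x := P x - D (poly_op D psi (P x)).
have P0E x : P0 x = P (x - D (poly_op D psi x)).
  by rewrite (linBf bP.1) PD (poly_op_comm _ _ bP.1).
have bP0 : blin P0.
  apply: blinB => //; apply: (blin_comp bD).
  exact: (blin_comp (poly_op_blin _ bD) bP).
have frP0 : finite_rank_on setT P0.
  apply: (@eq_finite_rank _ _ _ _ (fun x => P (x - D (poly_op D psi x)))) => //.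
  by apply: (@finite_rank_precomp _ V _ _ setT).
pose Q' x := Q x + poly_op D psi (P x).
have bQ' : blin Q' by apply: blinD => //; apply: (blin_comp (poly_op_blin _ bD) bP).
have pevP x : poly_op D psi (P x) = P (poly_op D psi x).
  by rewrite (poly_op_comm _ _ bP.1).
have HQ' x : dom T (Q' x) /\ T (Q' x) - mu *: Q' x = x - P0 x.
  have [D1 E1] := HQ x; rewrite /Q' pevP; split; first exact: domD.
  rewrite opD // scalerDr opprD addrACA E1 TP /P0 pevP opprB.
  by rewrite [RHS]addrA [RHS]addrAC.
(* The coefficients of [z ^ d R (mu + z) (1 - z Q')], a polynomial of degree [d]. *)
pose F (k : nat) x := if (k < d)%N then - iter (d.-1 - k)%N D (P0 x) else Q' x.
pose E (k : nat) x := if (k < d.+1)%N then F k x else 0.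
have bF k : blin (F k).
  rewrite /F; case: ltnP => _; last exact: bQ'.
  exact: (blinN (blin_comp (blin_iter _ bD) bP0)).
have bE k : blin (E k) by rewrite /E; case: ltnP => _; [apply: bF|apply: blin0].
have [c c0 Hc] := @blin_family_bound _ _ F d.+1 (fun k _ => bF k).
have Hb k x : nrm (E k x) <= c * 1 ^+ k * nrm x.
  rewrite expr1n mulr1 /E; case: ltnP => h; first exact: Hc.
  by rewrite nrm0 mulr_ge0 ?nrm_ge0.
have Rrec z n x : resolvent_set T (mu + z) ->
    z ^+ n *: resolvent T (mu + z) (P x)
    = - (\sum_(k < n) z ^+ k *: iter (n.-1 - k)%N D (P x))
      + resolvent T (mu + z) (iter n D (P x)).
  move=> hz; have Rl := res_lin Tlin hz.
  have step y : z *: resolvent T (mu + z) (P y)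
      = resolvent T (mu + z) (D (P y)) - P y.
    have := resK hz (domP y).
    have -> : T (P y) - (mu + z) *: P y = D (P y) - z *: P y.
      by rewrite scalerDl opprD addrA TP.
    by rewrite (linBf Rl) (linZf Rl) => /eqP; rewrite subr_eq [P y + _]addrC -subr_eq => /eqP ->.
  elim: n x => [|n IH] x; first by rewrite big_ord0 oppr0 add0r scale1r.
  rewrite exprSr -scalerA step scalerBr -PD IH PD -iterSr.
  rewrite big_ord_recr /= subnn opprD addrAC; congr (_ - _ + _).
  congr (- _); apply: eq_bigr => k _; congr (_ *: _).
  rewrite -iterSr; congr (iter _ D (P x)); have := ltn_ord k; lia.
have Hser y : pser (fun k => E k y)
   (fun z => z ^+ d *: resolvent T (mu + z) (y - z *: Q' y)) r0.
  apply: (@pser_ext _ _ (fun k => if (k < d.+1)%N then F k y else 0) _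
    (fun z => psum (fun k => F k y) z d.+1)) => [//|z zr|]; last exact: pser_poly.
  have hz : resolvent_set T (mu + z) by apply/hr0/punctured_disc_add.
  have Rl := res_lin Tlin hz.
  have [DQ EQ] := HQ' y.
  have := resK hz DQ.
  have -> : T (Q' y) - (mu + z) *: Q' y = (y - z *: Q' y) - P0 y.
    by rewrite scalerDl opprD addrA EQ addrAC.
  rewrite (linBf Rl) => /eqP; rewrite subr_eq => /eqP ->.
  rewrite scalerDr psumS /F ltnn addrC; congr (_ + _).
  rewrite P0E Rrec // -P0E Hpsi (lin0 Rl) addr0 /psum -sumrN.
  by apply: eq_bigr => k _; rewrite ltn_ord scalerN P0E.
have [r1 /andP[r10 r1r] Hr1] := div_right V bQ' r00 c0 ler01.
have [bA HA Aser] := Hr1 E (quot_coef Q' E)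
   (fun z x => z ^+ d *: resolvent T (mu + z) x) bE Hb
   (fun _ => erefl) (fun _ _ => erefl) Hser.
exists d, (quot_coef Q' E), r1; split.
  split=> //; exact: subset_trans (punctured_disc_sub r1r) hr0.
apply: quot_coef_finite_rank => k kd.
apply: (@eq_finite_rank _ _ _ _ (fun x => - iter (d.-1 - k)%N D (P0 x))).
  by move=> x _; rewrite /E /F kd ltnW.
have lI : linear (fun v => - iter (d.-1 - k)%N D v).
  exact: (blinN (blin_iter _ bD)).1.
exact: (finite_rank_comp lI frP0).
Qed.
End AtIsolatedPoint.
End RieszLaurent.

(** * Poles of the resolvent *)

Section Poles.
Variable R : realType.
Local Notation C := R[i].

Lemma Laurent_sumE (U : Type) (W : lmodType C) (mu z : C) p (M : int -> U -> W)
    f N : z != 0 ->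
  Laurent_sum mu p M (mu + z) f N
  = z ^- p *: psum (fun k => M (k%:Z - p%:Z) f) z N.
Proof.
move=> z0; rewrite /Laurent_sum /psum scaler_sumr; apply: eq_bigr => k _.
by rewrite scalerA [mu + z]addrC addrK expfzDr // exprnN mulrC -exprnP.
Qed.

(** If [z ^ p g] has a limit at 0 then [z ^ q g] tends to 0 for every [q > p]. *)
Lemma order_uniq (I : Type) (D : set I) (V : normedModType C)
    (g : C -> I -> V) (a b : I -> V) p q :
  (forall x, D x -> lim0 (fun z => z ^+ p *: g z x) (a x)) ->
  (forall x, D x -> lim0 (fun z => z ^+ q *: g z x) (b x)) ->
  (exists2 x, D x & a x != 0) -> (exists2 x, D x & b x != 0) -> p = q.
Proof.
have H a' b' p' q' : (p' < q')%N ->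
    (forall x, D x -> lim0 (fun z => z ^+ p' *: g z x) (a' x)) ->
    (forall x, D x -> lim0 (fun z => z ^+ q' *: g z x) (b' x)) ->
    forall x, D x -> b' x = 0.
  move=> pq ha hb x Dx; apply: lim0_uniq (hb x Dx) _.
  have d0 : (0 < q' - p')%N by rewrite subn_gt0.
  apply: (@lim0_ext _ _ _ _ _ 1 ltr01 _ (lim0_pow d0 (ha x Dx))) => z _ /=.
  by rewrite scalerA -exprD subnK // ltnW.
move=> ha hb [x Dx ax] [y Dy bx]; case: (ltngtP p q) => // h.
  by move: bx; rewrite (H _ _ _ _ h ha hb) // eqxx.
by move: ax; rewrite (H _ _ _ _ h hb ha) // eqxx.
Qed.

Section OneOperator.
Variables (V : normedModType C) (T : operator V) (mu : C).
Hypothesis Tlin : is_linear T.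

Lemma res_laurent_lim p A r x : res_laurent T mu p A r ->
  lim0 (fun z => z ^+ p *: resolvent T (mu + z) x) (A 0%N x).
Proof. by move=> [r0 _ _ _ ser]; apply: pser_lim0 r0 (ser x). Qed.

(** On an eigenvector [u] the resolvent is [- u / z], which is unbounded. *)
Lemma eigenvalue_principal_part p A r : res_laurent T mu p A r -> is_eigenvalue T mu ->
  exists2 k, (k < p)%N & exists x, A k x != 0.
Proof.
move=> [r0 hr bA bd ser] [u [Du u0 Tu]]; apply: contrapT => H.
have A0 k : (k < p)%N -> A k u = 0.
  move=> kp; apply/eqP; apply: contrapT => /negP Au; apply: H.
  by exists k => //; exists u.
have := pser_lim0 r0 (pser_drop A0 (ser u)) => /lim0_small.
have Ez z : 0 < nrm z < r ->
    z *: (z ^- p *: (z ^+ p *: resolvent T (mu + z) u)) = - u.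
  move=> zr; have hz : resolvent_set T (mu + z) by apply/hr/punctured_disc_add.
  have z0 : z != 0 by rewrite -nrm_gt0; case/andP: zr.
  rewrite [z ^- p *: _]scalerA mulVf ?expf_neq0 // scale1r.
  have := resK hz Du.
  rewrite Tu scalerDl opprD addrA subrr add0r -scaleNr (linZf (res_lin Tlin hz)).
  by rewrite scaleNr => /(congr1 -%R); rewrite opprK.
move=> /(lim0_ext r0 Ez) /(lim0_uniq (lim0_cst _)) /eqP.
by rewrite oppr_eq0 (negbTE u0).
Qed.

Lemma res_laurent_drop p A r j : res_laurent T mu p A r -> (j <= p)%N ->
  (forall k, (k < j)%N -> forall x, A k x = 0) ->
  res_laurent T mu (p - j) (fun k => A (j + k)%N) r.
Proof.
move=> [r0 hr bA [c [s [c0 s0 bd]]] ser] jp A0; split=> //.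
  exists (c * s ^+ j), s; split=> //.
    by rewrite mulr_ge0 ?exprn_ge0 // ltW.
  by move=> k x; rewrite -(mulrA c) -exprD.
move=> x; apply: pser_ext (pser_drop (fun k kj => A0 k kj x) (ser x)) => // z zr.
have z0 : z != 0 by rewrite -nrm_gt0; case/andP: zr.
rewrite scalerA -[in LHS](subnK jp) exprD mulrCA mulVf ?mulr1 //.
by rewrite expf_neq0.
Qed.

Lemma res_laurent_normalize p A r : res_laurent T mu p A r ->
  is_eigenvalue T mu ->
  (forall k, (k < p)%N -> finite_rank_on setT (A k)) ->
  exists q A', [/\ (0 < q)%N, res_laurent T mu q A' r, exists x, A' 0%N x != 0 &
    forall k, (k < q)%N -> finite_rank_on setT (A' k)].
Proof.
move=> hA he fA; have [k0 k0p hk0] := eigenvalue_principal_part hA he.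
pose Q k := `[< exists x, A k x != 0 >].
have exQ : exists k, Q k by exists k0; apply/asboolP.
have [j /asboolP hj jmin] := ex_minnP exQ.
have jp : (j < p)%N by apply: leq_ltn_trans (jmin k0 _) k0p; apply/asboolP.
exists (p - j)%N, (fun k => A (j + k)%N); split.
- by rewrite subn_gt0.
- apply: res_laurent_drop => //; first exact: ltnW.
  move=> k kj x; apply/eqP; apply: contrapT => /negP Akx.
  have := jmin k; rewrite leqNgt kj => h; have : false by apply: h; apply/asboolP; exists x.
  by [].
- by rewrite addn0.
- by move=> k kq; apply: fA; rewrite -ltn_subRL.
Qed.

(** The leading coefficient maps into the eigenspace: multiply the resolvent
identity by [z ^ q] and let [z] tend to 0. *)
Lemma laurent_eigenvalue q A r : (0 < q)%N -> res_laurent T mu q A r ->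
  (exists x, A 0%N x != 0) -> is_eigenvalue T mu.
Proof.
move=> q0 hA [x Ax]; have [r0 hr _ _ _] := hA.
pose z1 : C := (r / 2)%:C%C.
have z1r : 0 < nrm z1 < r by rewrite nrm_real_gt0; [apply/andP; split; lra|lra].
have hl0 : resolvent_set T (mu + z1) by apply/hr/punctured_disc_add.
set l0 := mu + z1 in hl0; set S := resolvent T l0.
have bS : blin S := res_blin Tlin hl0.
set v := A 0%N x in Ax.
have L1 : lim0 (fun z => z ^+ q *: resolvent T (mu + z) x) v.
  exact: res_laurent_lim hA.
have L2 : lim0 (fun z => z ^+ q *: resolvent T (mu + z) x)
    ((0 + (mu - l0) *: S v) + 0).
  pose g z := (z ^+ q *: S x + (mu - l0) *: S (z ^+ q *: resolvent T (mu + z) x))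
    + z *: S (z ^+ q *: resolvent T (mu + z) x).
  apply: (@lim0_ext _ _ g _ _ r r0).
    move=> z zr; have hz : resolvent_set T (mu + z) by apply/hr/punctured_disc_add.
    rewrite [in RHS](res_identity Tlin x hz hl0) -/S /g (linZf bS.1) scalerDr.
    rewrite -addrA; congr (_ + _); rewrite -scalerDl !scalerA; congr (_ *: _).
    by ring.
  apply: lim0D; first apply: lim0D.
  - exact: (lim0_pow q0 (lim0_cst (S x))).
  - exact: (lim0_blin (blin_comp (blinZ (mu - l0) (blin_id V)) bS) L1).
  - exact: (lim0_small (lim0_blin bS L1)).
have vE : v = (mu - l0) *: S v.
  by have := lim0_uniq L1 L2; rewrite add0r addr0.
exists v; split=> //; first by rewrite vE; apply/domZ/res_dom.
rewrite {1}vE opZ //; last exact: res_dom.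
rewrite (res_eq hl0) -/S scalerDr scalerA mulrC -scalerA -vE -scalerDl.
by rewrite subrK.
Qed.

(** The Riesz projection is minus the residue [A q.-1]. *)
Lemma laurent_isolated q A r : (0 < q)%N -> res_laurent T mu q A r ->
  (exists x, A 0%N x != 0) ->
  (forall k, (k < q)%N -> finite_rank_on setT (A k)) ->
  isolated_eigenvalue_of_finite_multiplicity T mu.
Proof.
move=> q0 hA Ax frA; have ev := laurent_eigenvalue q0 hA Ax.
have [r0 hr bA _ ser] := hA; split=> //.
  split; last by exists r.
  move=> hmu; have [u [Du u0 Tu]] := ev.
  have := shift_inj hmu Du Tlin.1.1.
  rewrite Tu (op0 Tlin) scaler0 !subrr => /(_ erefl) uE.
  by move: u0; rewrite uE eqxx.
case: q q0 hA frA ser => // q _ hA frA ser.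
exists (fun x => - A q x); last first.
  have lN : linear (fun v : V => - v) := (blinN (blin_id V)).1.
  exact: (finite_rank_comp lN (frA q (ltnSn q))).
exists (r / 4); split; first by rewrite divr_gt0.
  move=> l /= /andP[l0 lr]; apply: hr; rewrite /punctured_disc /= l0 /=.
  by apply: le_lt_trans lr _; rewrite ltcR; lra.
move=> x; exists ((2 * (pi : R)%:C%C * 'i%C) *: A q x).
  by apply: residue_formula (ser x) _; apply/andP; split; lra.
rewrite scaleNr scalerA mulVf ?scale1r //.
have iC : 'i%C != 0 :> C.
  by rewrite -nrm_eq0 /nrm normc_def /= expr0n expr1n add0r sqrtr1 oner_eq0.
rewrite !mulf_neq0 ?pnatr_eq0 //.
by rewrite -nrm_eq0 nrm_real normr_eq0 gt_eqF // pi_gt0.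
Qed.

Lemma laurent_pole q A r : (0 < q)%N -> res_laurent T mu q A r ->
  (exists x, A 0%N x != 0) -> resolvent_pole T mu q.
Proof.
move=> q0 [r0 hr bA [c [s [c0 s0 bd]]] ser] [x0 Ax0]; split=> //.
have m0 : 0 < Num.min r (1 / (2 * s)).
  by rewrite lt_min r0 divr_gt0 //; lra.
exists (Num.min r (1 / (2 * s))) => //; split.
  by apply: subset_trans hr; apply: punctured_disc_sub; rewrite ge_min lexx.
have /choice [F HF] : forall k, exists f : {linear V -> V}, f =1 A k.
  by move=> k; apply: linear_bundle; apply: (bA k).1.
exists (fun n : int => F (absz (n + q%:Z))); split.
- by move=> n _; apply/blin_continuous; apply: eq_blin (bA (absz (n + q%:Z))) => x; rewrite HF.
- by exists x0; rewrite addNr HF.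
move=> lam /punctured_discP; set z := lam - mu => zr e e0.
have lE : lam = mu + z by rewrite /z addrC subrK.
have [z0 zr1 zs] : [/\ 0 < nrm z, nrm z < r & nrm z * s <= 1 / 2].
  move: zr; rewrite lt_min => /and3P[h1 h2 h3]; split=> //.
  by move: h3; rewrite ltr_pdivlMr; lra.
have zn0 : z != 0 by rewrite -nrm_gt0.
pose w := nrm (z ^- q); have w0 : 0 <= w := nrm_ge0 _.
have sm := @pow_small _ (w * (2 * c)) e (nrm z * s) e0.
have [||N HN] := sm.
- by rewrite mulr_ge0 // mulr_ge0.
- by rewrite zs mulr_ge0 ?ltW.
exists N => // n /= Nn x; rewrite lE Laurent_sumE //.
have -> : psum (fun k => F (absz (k%:Z - q%:Z + q%:Z)) x) z n = psum (fun k => A k x) z n.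
  by apply: eq_bigr => k _; rewrite subrK HF.
have -> : z ^- q *: psum (fun k => A k x) z n - resolvent T (mu + z) x
   = z ^- q *: (psum (fun k => A k x) z n - z ^+ q *: resolvent T (mu + z) x).
  by rewrite scalerBr [z ^- q *: (z ^+ q *: _)]scalerA mulVf ?expf_neq0 // scale1r.
rewrite !nrmE nrmZ -rcM lecR -/w.
have b1 k : nrm (A k x) <= c * nrm x * s ^+ k by rewrite mulrAC.
have zr' : 0 < nrm z < r by rewrite z0.
have := pser_tail (ser x) (mulr_ge0 c0 (nrm_ge0 x)) (ltW s0) b1 zr' zs n.
move=> /(ler_wpM2l w0) h; apply: le_trans h _.
have -> : w * (2 * (c * nrm x) * (nrm z * s) ^+ n)
   = w * (2 * c) * (nrm z * s) ^+ n * nrm x by ring.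
by rewrite ler_wpM2r ?nrm_ge0 // ltW // HN.
Qed.

Lemma pole_lim p : resolvent_pole T mu p -> exists a : V -> V,
  (forall x, lim0 (fun z => z ^+ p *: resolvent T (mu + z) x) (a x)) /\
  exists x, a x != 0.
Proof.
move=> [p0 [r r0 [hr [M [cM [x0 Mx0] HM]]]]]; exists (M (- p%:Z)); split; last by exists x0.
move=> x.
suff ser : pser (fun k => M (k%:Z - p%:Z) x)
    (fun z => z ^+ p *: resolvent T (mu + z) x) r.
  by have := pser_lim0 r0 ser; rewrite sub0r.
move=> z zr; have z0 : z != 0 by rewrite -nrm_gt0; case/andP: zr.
have zn : 0 < nrm (z ^+ p) by rewrite nrm_gt0 expf_neq0.
apply/cvg_nrmP => e e0.
have x1 : 0 < nrm x + 1 by rewrite ltr_wpDl ?nrm_ge0.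
have d0 : 0 < e / (nrm (z ^+ p) * (nrm x + 1)) by rewrite divr_gt0 // mulr_gt0.
have [N _ HN] := HM _ (punctured_disc_add mu zr) _ d0.
exists N => n Nn; have := HN n Nn x; rewrite Laurent_sumE // !nrmE -rcM lecR => h.
have -> : psum (fun k => M (k%:Z - p%:Z) x) z n - z ^+ p *: resolvent T (mu + z) x
   = z ^+ p *: (z ^- p *: psum (fun k => M (k%:Z - p%:Z) x) z n
               - resolvent T (mu + z) x).
  by rewrite scalerBr [z ^+ p *: (z ^- p *: _)]scalerA mulfV ?expf_neq0 // scale1r.
rewrite nrmZ; apply: le_lt_trans (ler_wpM2l (ltW zn) h) _.
have -> : nrm (z ^+ p) * (e / (nrm (z ^+ p) * (nrm x + 1)) * nrm x)
  = e * (nrm x / (nrm x + 1)).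
  by field; rewrite !gt_eqF.
by rewrite -[ltRHS]mulr1 ltr_pM2l // ltr_pdivrMr // mul1r ltrDl.
Qed.
End OneOperator.
End Poles.

(** * Riesz representation and adjoints in Hilbert spaces *)

Section Hilbert.
Variable R : realType.
Local Notation C := R[i].

Section Inner.
Variable H : hilbert R.
Implicit Types x y z : H.

Lemma innerDl x y z : inner (x + y) z = inner x z + inner y z.
Proof. exact: linearDl. Qed.

Lemma innerDr x y z : inner x (y + z) = inner x y + inner x z.
Proof. exact: linearDr. Qed.

Lemma innerBl x y z : inner (x - y) z = inner x z - inner y z.
Proof. exact: linearBl. Qed.

Lemma innerBr x y z : inner x (y - z) = inner x y - inner x z.
Proof. exact: linearBr. Qed.

Lemma innerNl x y : inner (- x) y = - inner x y.
Proof. exact: linearNl. Qed.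

Lemma inner0r x : inner x 0 = 0.
Proof. exact: linear0r. Qed.

Lemma innerZl a x y : inner (a *: x) y = a * inner x y.
Proof. by rewrite linearZl_LR. Qed.

Lemma innerZr a x y : inner x (a *: y) = Num.conj a * inner x y.
Proof. by rewrite linearZr_LR. Qed.

Lemma innerC x y : inner x y = Num.conj (inner y x).
Proof. by rewrite hermC expr0 mul1r. Qed.

Lemma inner_nrm x : inner x x = ((nrm x) ^+ 2)%:C%C.
Proof. by rewrite inner_normE nrmE rcX. Qed.

Lemma nrm_inner x : nrm (inner x x) = nrm x ^+ 2.
Proof. by rewrite inner_nrm nrm_real ger0_norm // sqr_ge0. Qed.

Lemma conj_mul_nrm (a : C) : a * Num.conj a = (nrm a ^+ 2)%:C%C.
Proof. by rewrite -normCK nrmE rcX. Qed.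

(** Pythagoras for the component of [x] along [k]. *)
Lemma nrm_proj x k : k != 0 ->
  nrm (x - (inner x k / inner k k) *: k) ^+ 2
  = nrm x ^+ 2 - nrm (inner x k) ^+ 2 / nrm k ^+ 2.
Proof.
move=> k0; have K0 : inner k k != 0.
  by rewrite -nrm_eq0 nrm_inner sqrf_eq0 nrm_eq0.
apply: (@complexI R); rewrite -inner_nrm.
set c := inner x k / inner k k.
rewrite innerBl !innerBr !innerZl !innerZr.
have cc : Num.conj (inner k k) = inner k k by rewrite -innerC.
have <- : inner k x = Num.conj c * inner k k.
  by rewrite /c rmorphM /= fmorphV /= cc -innerC divfK.
rewrite subrr subr0 rcD rcN rcM rcV -!inner_nrm -conj_mul_nrm; congr (_ - _).
by rewrite /c rmorphM /= fmorphV /= cc; ring.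
Qed.

Lemma cauchy_schwarz x y : nrm (inner x y) <= nrm x * nrm y.
Proof.
have [->|y0] := eqVneq y 0; first by rewrite inner0r !nrm0 mulr0.
have yp : 0 < nrm y by rewrite nrm_gt0.
have := nrm_proj x y0.
have : 0 <= nrm (x - (inner x y / inner y y) *: y) ^+ 2 by rewrite sqr_ge0.
move=> h E; rewrite E subr_ge0 in h.
rewrite -[leLHS]ger0_norm ?nrm_ge0 // -[leRHS]ger0_norm ?mulr_ge0 ?nrm_ge0 //.
rewrite -ler_sqr ?nnegrE // !real_normK ?num_real // exprMn.
by rewrite -ler_pdivrMr // exprn_gt0.
Qed.

Lemma parallelogram x y :
  nrm (x + y) ^+ 2 + nrm (x - y) ^+ 2 = 2 * nrm x ^+ 2 + 2 * nrm y ^+ 2.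
Proof.
apply: (@complexI R); rewrite !rcD !(rcM 2) -!inner_nrm.
have -> : 2%:C%C = 2 :> C by rewrite rmorph_nat.
rewrite !innerDl !innerDr !linearNl !linearNr; ring.
Qed.

Lemma inner_sep x y : (forall z, inner x z = inner y z) -> x = y.
Proof.
move=> E; apply/eqP; rewrite -subr_eq0 -nrm_eq0 -sqrf_eq0 -nrm_inner.
by rewrite innerBl E subrr nrm0.
Qed.

(** The vector of least norm on the hyperplane [phi = 1] exists by the parallelogram
identity and is orthogonal to the kernel of [phi]. *)
Lemma riesz_representation (phi : H -> C) (c : R) :
  (forall a x y, phi (a *: x + y) = a * phi x + phi y) ->
  (forall x, nrm (phi x) <= c * nrm x) ->
  exists y, forall x, phi x = inner x y.
Proof.
move=> lphi bphi.
have phi0 : phi 0 = 0.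
  by have := lphi (-1) 0 0; rewrite scaler0 addr0 mulN1r addNr.
have phiZ a x : phi (a *: x) = a * phi x.
  by have := lphi a x 0; rewrite !addr0 phi0 addr0.
have phiD x y : phi (x + y) = phi x + phi y.
  by have := lphi 1 x y; rewrite scale1r mul1r.
have phiB x y : phi (x - y) = phi x - phi y.
  by rewrite phiD -scaleN1r phiZ mulN1r.
have [[x1 phix1]|H0] := pselect (exists x, phi x != 0); last first.
  exists 0 => x; rewrite inner0r; apply/eqP; apply: contrapT => /negP h.
  by apply: H0; exists x.
pose S := [set nrm x | x in [set x | phi x = 1]].
have S0 : S !=set0.
  exists (nrm ((phi x1)^-1 *: x1)), ((phi x1)^-1 *: x1) => //=.
  by rewrite phiZ mulVf.
have Slb : has_inf S by split=> //; exists 0 => _ [x _ <-]; apply: nrm_ge0.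
pose d := inf S.
have d0 : 0 <= d by apply: lb_le_inf => // _ [x _ <-]; apply: nrm_ge0.
have dle x : phi x = 1 -> d <= nrm x.
  by move=> hx; apply: ge_inf; [case: Slb|exists x].
have /choice [u Hu] : forall n : nat, exists x, phi x = 1 /\ nrm x < d + n.+1%:R^-1.
  move=> n; have n0 : 0 < n.+1%:R^-1 :> R by rewrite invr_gt0 ltr0n.
  by have [_ [x hx <-] hd] := inf_adherent n0 Slb; exists x.
have dsum x y : phi x = 1 -> phi y = 1 -> (2 * d) ^+ 2 <= nrm (x + y) ^+ 2.
  move=> hx hy; rewrite ler_sqr ?nnegrE ?nrm_ge0 ?mulr_ge0 //.
  have h : d <= nrm (2^-1 *: (x + y)).
    by apply: dle; rewrite phiZ phiD hx hy -[1 + 1]/(2%:R) mulVf ?pnatr_eq0.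
  move: h; rewrite nrmZ nrmV.
  have -> : nrm (2 : C) = 2 by rewrite -[2 : C](rmorph_nat (real_complex R)) nrm_real ger0_norm.
  by lra.
(* The midpoint lies on the hyperplane, so its norm is at least [d]. *)
have udiff m n : nrm (u m - u n) ^+ 2 <=
   2 * (d + m.+1%:R^-1) ^+ 2 + 2 * (d + n.+1%:R^-1) ^+ 2 - (2 * d) ^+ 2.
  have [hm1 hm2] := Hu m; have [hn1 hn2] := Hu n.
  have := parallelogram (u m) (u n); have := dsum _ _ hm1 hn1.
  have i0 k : 0 <= d + k.+1%:R^-1 by rewrite addr_ge0 // invr_ge0.
  have : nrm (u m) ^+ 2 <= (d + m.+1%:R^-1) ^+ 2.
    by rewrite ler_sqr ?nnegrE ?nrm_ge0 // ltW.
  have : nrm (u n) ^+ 2 <= (d + n.+1%:R^-1) ^+ 2.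
    by rewrite ler_sqr ?nnegrE ?nrm_ge0 // ltW.
  move: ((d + n.+1%:R^-1) ^+ 2) ((d + m.+1%:R^-1) ^+ 2) ((2 * d) ^+ 2).
  move: (nrm (u m) ^+ 2) (nrm (u n) ^+ 2) (nrm (u m - u n) ^+ 2) (nrm (u m + u n) ^+ 2).
  by move=> *; lra.
have [x0 Hx0] : exists x0 : H, u @ \oo --> x0.
  apply: cauchy_cvg_nrm => e e0.
  pose q := e ^+ 2 / (8 * (d + 1)).
  have d1 : 0 < 8 * (d + 1) by lra.
  have q0 : 0 < q by rewrite divr_gt0 // exprn_gt0.
  exists (Num.bound q^-1) => m n hm hn.
  have inv k : (Num.bound q^-1 <= k)%N -> k.+1%:R^-1 < q.
    move=> hk; rewrite invf_plt ?posrE ?ltr0n //.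
    apply: lt_le_trans (archi_boundP _) _; first by rewrite invr_ge0 ltW.
    by rewrite ler_nat (leq_trans hk).
  have im := inv m hm; have in' := inv n hn.
  have h := udiff m n.
  rewrite -(ltr_pXn2r (n := 2)) ?nnegrE ?nrm_ge0 ?(ltW e0) //.
  have sm k : k.+1%:R^-1 < q -> (d + k.+1%:R^-1) ^+ 2 < d ^+ 2 + e ^+ 2 / 4.
    have k0 : 0 <= k.+1%:R^-1 :> R by rewrite invr_ge0.
    have k1 : k.+1%:R^-1 <= 1 :> R by rewrite invf_le1 ?ltr0n // ler1n.
    move: (k.+1%:R^-1 : R) k0 k1 => t k0 k1; rewrite /q ltr_pdivlMr // => tq.
    have tt : t * t <= t by rewrite -[leRHS]mulr1 ler_wpM2l.
    have td : 0 <= t * d by rewrite mulr_ge0.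
    by rewrite !expr2 in tq *; lra.
  have dd : (2 * d) ^+ 2 = 4 * d ^+ 2 by ring.
  have := sm m im; have := sm n in'; move: h; rewrite dd.
  move: ((d + n.+1%:R^-1) ^+ 2) ((d + m.+1%:R^-1) ^+ 2) (d ^+ 2) (e ^+ 2).
  move: (nrm (u m - u n) ^+ 2) => *; lra.
have phi1 : phi x0 = 1.
  apply/eqP; rewrite -subr_eq0 -nrm_eq0; apply/eqP/le_anti; rewrite nrm_ge0 andbT.
  apply/ler_addgt0Pr => e e0; rewrite add0r.
  have c1 : 0 < `|c| + 1 by rewrite ltr_wpDl.
  have [N HN] := (cvg_nrmP _ _).1 Hx0 _ (divr_gt0 e0 c1).
  have := HN N (leqnn _); rewrite ltr_pdivlMr // => h.
  rewrite -(Hu N).1 -phiB nrmBC in h *.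
  apply: le_trans (bphi _) _.
  have := ler_wpM2r (nrm_ge0 (x0 - u N)) (ler_norm c).
  by have := nrm_ge0 (x0 - u N); lra.
have nx0 : nrm x0 <= d.
  apply/ler_addgt0Pr => e e0; have e2 : 0 < e / 2 by lra.
  have [N HN] := (cvg_nrmP _ _).1 Hx0 _ e2.
  pose n := maxn N (Num.bound (e / 2)^-1).
  have h1 := HN n (leq_maxl _ _); have h2 := (Hu n).2.
  have h3 : n.+1%:R^-1 < e / 2.
    rewrite invf_plt ?posrE ?ltr0n //.
    apply: lt_le_trans (archi_boundP _) _; first by rewrite invr_ge0 ltW.
    by rewrite ler_nat (leq_trans (leq_maxr N _)).
  have := nrm_triB (u n) x0 0; rewrite !subr0 (nrmBC x0 (u n)).
  by move: h3 h2 h1; move: (n.+1%:R^-1) => *; lra.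
have x0n : x0 != 0 by apply/eqP => E; move: phi1; rewrite E phi0 => /eqP; rewrite eq_sym oner_eq0.
have orth k : phi k = 0 -> inner x0 k = 0.
  move=> hk; have [->|k0] := eqVneq k 0; first exact: inner0r.
  have kp : 0 < nrm k ^+ 2 by rewrite exprn_gt0 // nrm_gt0.
  have := nrm_proj x0 k0; set w := x0 - _ *: k => E.
  have hw : d <= nrm w by apply: dle; rewrite phiB phiZ hk mulr0 subr0.
  have hw2 : nrm x0 ^+ 2 <= nrm w ^+ 2.
    by rewrite ler_sqr ?nnegrE ?nrm_ge0 // (le_trans nx0).
  rewrite E lerBrDr gerDl in hw2.
  apply/eqP; rewrite -nrm_eq0 -sqrf_eq0; apply/eqP/le_anti.
  by rewrite sqr_ge0 andbT -(pmulr_lle0 _ (x := (nrm k ^+ 2)^-1)) ?invr_gt0 // mulrC.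
have I0 : inner x0 x0 != 0 by rewrite -nrm_eq0 nrm_inner sqrf_eq0 nrm_eq0.
exists ((inner x0 x0)^-1 *: x0) => x.
have /orth : phi (x - phi x *: x0) = 0 by rewrite phiB phiZ phi1 mulr1 subrr.
rewrite innerBr innerZr => /eqP; rewrite subr_eq0 => /eqP E.
rewrite innerZr (innerC x x0) E rmorphM /= conjCK fmorphV /=.
have cc : Num.conj (inner x0 x0) = inner x0 x0 by rewrite -innerC.
by rewrite cc mulrCA mulVf ?mulr1.
Qed.
End Inner.

Lemma hilbert_adjoint (H G : hilbert R) (F : H -> G) : blin F ->
  exists2 Fs : G -> H, blin Fs & forall g y, inner (Fs g) y = inner g (F y).
Proof.
move=> bF; have [c c0 Fc] := blin_gt0 bF.
have /choice [Fs HFs] : forall g, exists h, forall y, inner (F y) g = inner y h.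
  move=> g; apply: (@riesz_representation _ _ (c * nrm g)).
    by move=> a x y; rewrite bF.1 innerDl innerZl.
  move=> x; rewrite (le_trans (cauchy_schwarz _ _)) // mulrAC.
  by rewrite ler_wpM2r ?nrm_ge0.
have E g y : inner (Fs g) y = inner g (F y) by rewrite innerC -HFs -innerC.
exists Fs => //; split.
  move=> a x y; apply: inner_sep => z.
  by rewrite E !innerDl !innerZl !E.
exists c => g; have [->|g0] := eqVneq (Fs g) 0.
  by rewrite nrm0 mulr_ge0 ?nrm_ge0 // ltW.
have gp : 0 < nrm (Fs g) by rewrite nrm_gt0.
rewrite -(ler_pM2r gp) -expr2 -nrm_inner E.
rewrite (le_trans (cauchy_schwarz _ _)) // [c * _]mulrC -mulrA.
by rewrite ler_wpM2l ?nrm_ge0 // Fc.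
Qed.

End Hilbert.

(** * Maps that are linear on a subspace *)

Section LinearOn.
Variable R : realType.
Local Notation C := R[i].
Variables (U V W : lmodType C) (D : set U).
Implicit Types f g : U -> V.

Lemma linear_on0 : linear_on D (fun _ : U => 0 : V).
Proof. by move=> a x y _ _; rewrite scaler0 addr0. Qed.

Lemma linear_onD f g : linear_on D f -> linear_on D g ->
  linear_on D (fun x => f x + g x).
Proof. by move=> lf lg a x y Dx Dy; rewrite lf // lg // scalerDr addrACA. Qed.

Lemma linear_onZ c f : linear_on D f -> linear_on D (fun x => c *: f x).
Proof.
by move=> lf a x y Dx Dy; rewrite lf // scalerDr !scalerA [c * a]mulrC.
Qed.

Lemma linear_on_comp (h : V -> W) f : linear h -> linear_on D f ->
  linear_on D (fun x => h (f x)).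
Proof. by move=> lh lf a x y Dx Dy; rewrite lf // lh. Qed.
End LinearOn.

(** * Adjoints of densely defined operators *)

Section Adjoint.
Variable R : realType.
Local Notation C := R[i].
Variable H : hilbert R.

Lemma adjP (S : operator H) v : dom (adjoint S) v -> forall u, dom S u ->
  inner (S u) v = inner u (adjoint S v).
Proof.
move=> [w hw] u Du; rewrite /adjoint /=.
by case: xgetP => [w' _ hw'|/(_ w)]; [apply: hw'|case].
Qed.

Lemma dense_sep (D : set H) w : dense D -> (forall u, D u -> inner u w = 0) ->
  w = 0.
Proof.
move=> dD hw; apply/eqP; apply: contrapT => /negP w0.
have wp : 0 < nrm w by rewrite nrm_gt0.
have e0 : 0 < (nrm w)%:C%C :> C by rewrite ltcR.
have [|u [/= uw Du]] := dD (ball w (nrm w)%:C%C) _ (ball_open w (nrm w)%:C%C).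
  by exists w; apply: ballxx.
move: uw; rewrite -ball_normE /= nrmE ltcR => uw.
have E : inner (w - u) w = inner w w by rewrite innerBl (hw u Du) subr0.
have := cauchy_schwarz (w - u) w; rewrite E nrm_inner expr2 ler_pM2r //.
by rewrite leNgt uw.
Qed.

Lemma adj_intro (S : operator H) v w : dense (dom S) ->
  (forall u, dom S u -> inner (S u) v = inner u w) ->
  dom (adjoint S) v /\ adjoint S v = w.
Proof.
move=> dS hw; have Dv : dom (adjoint S) v by exists w.
split=> //; apply/eqP; rewrite -subr_eq0; apply/eqP; apply: dense_sep dS _ => u Du.
by rewrite innerBr -(adjP Dv Du) hw // subrr.
Qed.

Lemma adj_linear (S : operator H) : dense (dom S) -> is_linear (adjoint S).
Proof.
move=> dS.
have comb a u v : dom (adjoint S) u -> dom (adjoint S) v ->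
    dom (adjoint S) (a *: u + v) /\
    adjoint S (a *: u + v) = a *: adjoint S u + adjoint S v.
  move=> Du Dv; apply: adj_intro => // x Dx.
  by rewrite !innerDr !innerZr (adjP Du Dx) (adjP Dv Dx).
split; last by move=> a u v Du Dv; have [] := comb a u v Du Dv.
split; last by move=> a u v Du Dv; have [] := comb a u v Du Dv.
by exists 0 => u _; rewrite !inner0r.
Qed.

Lemma graph_bounded_real (W : normedModType C) (S : operator H) (f : H -> W) :
  graph_bounded S f ->
  exists2 c : R, 0 <= c & forall u, dom S u -> nrm (f u) <= c * (nrm u + nrm (S u)).
Proof.
move=> [c hc]; exists (nrm c); first exact: nrm_ge0.
move=> u Du.
have h : nrm (f u) <= nrm c * nrm (graph_norm S u).
  have := hc u Du => h; rewrite -nrmM.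
  have r0 : 0 <= c * graph_norm S u by apply: le_trans h; apply: normr_ge0.
  by rewrite -lecR -!nrmE (ger0_norm r0).
apply: (le_trans h); rewrite ler_wpM2l ?nrm_ge0 //.
rewrite -ler_sqr ?nnegrE ?nrm_ge0 ?addr_ge0 ?nrm_ge0 // -nrmX /graph_norm sqrtCK.
rewrite !nrmE -!rcX -rcD nrm_real ger0_norm ?addr_ge0 ?sqr_ge0 // sqrrD.
by rewrite lerD2r lerDl mulrn_wge0 // mulr_ge0 ?nrm_ge0.
Qed.
End Adjoint.

(** * Boundary triplets *)

Section Triplet.
Variable R : realType.
Local Notation C := R[i].
Variables (H G K : hilbert R) (A At : operator H).
Hypotheses (A_dense : dense (dom A)) (At_dense : dense (dom At)).
Hypothesis A_At : adjoint_pair A At.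
Variables (G1 : H -> G) (G2 : H -> K) (Gt1 : H -> K) (Gt2 : H -> G).
Hypothesis triplet : boundary_triplet A At G1 G2 Gt1 Gt2.

Local Notation T := (adjoint At).
Local Notation AB B := (restr At G1 G2 B).

Let Tlin : is_linear T := adj_linear At_dense.

Lemma G1_lin : linear_on (dom T) G1. Proof. by have [[]] := triplet. Qed.
Lemma G2_lin : linear_on (dom T) G2. Proof. by have [[]] := triplet. Qed.

Section LinOn.
Variables (W : lmodType C) (f : H -> W).
Hypothesis lf : linear_on (dom T) f.
Let T0 : dom T 0 := Tlin.1.1.

Lemma lo0 : f 0 = 0.
Proof. by have := lf (-1) T0 T0; rewrite scaler0 addr0 scaleN1r addNr. Qed.

Lemma loD u v : dom T u -> dom T v -> f (u + v) = f u + f v.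
Proof. by move=> Du Dv; have := lf 1 Du Dv; rewrite !scale1r. Qed.

Lemma loZ a u : dom T u -> f (a *: u) = a *: f u.
Proof. by move=> Du; have := lf a Du T0; rewrite !addr0 lo0 addr0. Qed.

Lemma loB u v : dom T u -> dom T v -> f (u - v) = f u - f v.
Proof.
move=> Du Dv; have := lf (-1) Dv Du.
by rewrite !scaleN1r addrC => ->; rewrite addrC.
Qed.
End LinOn.

Lemma restr_linear (B : {linear K -> G}) : is_linear (AB B).
Proof.
have [[D0 Dl] Al] := Tlin; split; last first.
  by move=> a u v [Du _] [Dv _]; apply: Al.
split; first by split=> //; rewrite (lo0 G1_lin) (lo0 G2_lin) linear0 subrr.
move=> a u v [Du u0] [Dv v0]; split; first exact: Dl.
rewrite G1_lin // G2_lin // linearP opprD addrACA -scalerBr u0 v0 scaler0.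
by rewrite addr0.
Qed.

Lemma G2_res_blin (B : {linear K -> G}) lam : resolvent_set (AB B) lam ->
  blin (fun x => G2 (resolvent (AB B) lam x)).
Proof.
move=> hl; have lB := restr_linear B; have bR := res_blin lB hl.
have dR x : dom T (resolvent (AB B) lam x) by have [] := res_dom hl x.
split; first by move=> a x y; rewrite bR.1 G2_lin.
have [_ /graph_bounded_real [c c0 hc] _ _] := bt_bounded triplet.
have [d d0 hd] := blin_gt0 bR.
exists (c * (d + 1 + nrm lam * d)) => x.
apply: le_trans (hc _ (dR x)) _; rewrite -mulrA ler_wpM2l //.
have -> : T (resolvent (AB B) lam x) = x + lam *: resolvent (AB B) lam x.
  exact: (res_eq hl).
have h1 := hd x; have h2 := nrmD x (lam *: resolvent (AB B) lam x).
rewrite nrmZ in h2; have h3 := ler_wpM2l (nrm_ge0 lam) h1; lra.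
Qed.

(** Let [S] be the resolvent of [A_D] at [mu]. The adjoint of [S] maps into the domain
of the adjoint of [A], where the second pair of boundary maps is defined and
bounded for the graph norm. Testing [u - S (T u - mu u)] against [y] and applying
Green's identity to [u] and the image of [y] leaves only boundary terms; their
adjoints are [P] and [Q]. Thus the component of [u] along the kernel of [T - mu] is
a bounded function of the boundary values of [u], although the solution operators
of the boundary problem need not be bounded. *)
Lemma boundary_values (D : {linear K -> G}) mu : resolvent_set (AB D) mu ->
  exists (P : G -> H) (Q : K -> H), [/\ blin P, blin Q & forall u, dom T u ->
    u - resolvent (AB D) mu (T u - mu *: u) = P (G1 u) + Q (G2 u)].
Proof.
move=> hmu; have lD := restr_linear D; set S := resolvent (AB D) mu.
have bS : blin S := res_blin lD hmu.
have [Ss bSs HSs] := hilbert_adjoint bS.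
have SsE y : dom (adjoint A) (Ss y) /\
    adjoint A (Ss y) = y + Num.conj mu *: Ss y.
  apply: adj_intro => // u Du.
  have [Tu AuE] : dom T u /\ T u = A u by have [_ [h1 h2]] := A_At; split; [apply: h1|apply: h2].
  have Du' : dom (AB D) u.
    move: Du; rewrite (bt_dom triplet) => -[_ g1 g2].
    by split=> //; rewrite g1 g2 linear0 subrr.
  have := resK hmu Du'; rewrite -/S.
  have -> : (AB D) u = A u by exact: AuE.
  move=> Su; rewrite innerDr innerZr conjCK.
  have -> : inner u y = inner (A u - mu *: u) (Ss y).
    by rewrite -{1}Su innerC -HSs -innerC.
  by rewrite innerBl innerZl subrK.
have [_ _ /graph_bounded_real[c1 c10 hc1] /graph_bounded_real[c2 c20 hc2]] := bt_bounded triplet.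
have [_ _ lGt1 lGt2] := bt_linear triplet.
have [s s0 hs] := blin_gt0 bSs.
have gb (W : normedModType C) (f : H -> W) (c : R) : 0 <= c ->
    linear_on (dom (adjoint A)) f ->
    (forall u, dom (adjoint A) u -> nrm (f u) <= c * (nrm u + nrm (adjoint A u))) ->
    blin (fun y => f (Ss y)).
  move=> c0 lf hf; split.
    by move=> a x y; rewrite bSs.1 lf //; [have [] := SsE x|have [] := SsE y].
  exists (c * (s + 1 + nrm mu * s)) => y; have [Dy Ey] := SsE y.
  apply: le_trans (hf _ Dy) _; rewrite -mulrA ler_wpM2l // Ey.
  have h1 := hs y; have h2 := nrmD y (Num.conj mu *: Ss y).
  rewrite nrmZ nrm_conj in h2; have h3 := ler_wpM2l (nrm_ge0 mu) h1; lra.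
have [P0 bP0 HP0] := hilbert_adjoint (gb _ _ _ c20 lGt2 hc2).
have [Q bQ HQ] := hilbert_adjoint (gb _ _ _ c10 lGt1 hc1).
exists (fun g => - P0 g), Q; split=> //; first exact: blinN.
move=> u Du; apply: inner_sep => y; have [Dy Ey] := SsE y.
rewrite innerBl [RHS]innerDl innerNl HP0 HQ.
have -> : inner (S (T u - mu *: u)) y = inner (T u - mu *: u) (Ss y).
  by rewrite innerC -HSs -innerC.
have yE : y = adjoint A (Ss y) - Num.conj mu *: Ss y by rewrite Ey addrK.
rewrite {1}yE innerBr innerZr conjCK innerBl innerZl opprB addrA subrK.
have := bt_Green triplet Du Dy => Gr.
by rewrite -[LHS]opprB Gr opprB addrC.
Qed.

(** * The M-function and the resolvent *)

Section Mfunction.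
Variables (B : {linear K -> G}).
Hypothesis B_bounded : continuous B.
Local Notation RB := (resolvent (AB B)).
Local Notation rho := (resolvent_set (AB B)).
Local Notation M := (Mfun At G1 G2 B).

(** Subtracting a resolvent turns any vector into a solution with the same
boundary data. *)
Lemma kernel_part lam w : rho lam -> dom T w ->
  let u := w - RB lam (T w - lam *: w) in
  [/\ dom T u, T u = lam *: u, G1 u - B (G2 u) = G1 w - B (G2 w) &
      M lam (G1 w - B (G2 w)) = G2 u].
Proof.
move=> hl Dw; set y := T w - lam *: w => u.
have [DR BR] := res_dom hl y; have Ru : T (RB lam y) = y + lam *: RB lam y := res_eq hl y.
have Du : dom T u by apply: domB.
have Tu : T u = lam *: u.
  by rewrite /u opB // Ru scalerBr opprD addrA /y opprB addrCA subrr addr0.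
have Gu : G1 u - B (G2 u) = G1 w - B (G2 w).
  rewrite /u (loB G1_lin) // (loB G2_lin) // linearB opprD addrACA -opprD.
  by rewrite BR oppr0 addr0.
split=> //; rewrite -Gu; apply: MfunE => //; [exact: G1_lin|exact: G2_lin].
Qed.

(** The solution operator of the boundary problem at [l0]. *)
Definition solution (l0 : C) (f : G) : H :=
  xget 0 [set w | [/\ dom T w, T w = l0 *: w & G1 w - B (G2 w) = f]].

Lemma solutionP l0 f : rho l0 -> bran At G1 G2 B f ->
  [/\ dom T (solution l0 f), T (solution l0 f) = l0 *: solution l0 f &
      G1 (solution l0 f) - B (G2 (solution l0 f)) = f].
Proof.
move=> hl [w Dw <-]; have [Du Tu Gu _] := kernel_part hl Dw.
rewrite /solution; case: xgetP => [v _ //|/(_ (w - RB l0 (T w - l0 *: w)))].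
by case.
Qed.

Lemma kernel_inj l0 u v : rho l0 -> dom T u -> dom T v ->
  T u = l0 *: u -> T v = l0 *: v -> G1 u - B (G2 u) = G1 v - B (G2 v) -> u = v.
Proof.
move=> hl Du Dv Tu Tv Guv; apply/eqP; rewrite -subr_eq0; apply/eqP.
have Dw : dom T (u - v) by apply: domB.
have lB := restr_linear B.
apply: (shift_inj hl); last first.
- change (T (u - v) - l0 *: (u - v) = T 0 - l0 *: 0).
  by rewrite opB // Tu Tv op0 // scaler0 subrr -scalerBr subrr.
- exact: lB.1.1.
split=> //; rewrite (loB G1_lin) // (loB G2_lin) // linearB opprD addrACA.
by rewrite -opprD Guv subrr.
Qed.

Lemma bran_lin a f g : bran At G1 G2 B f -> bran At G1 G2 B g ->
  bran At G1 G2 B (a *: f + g).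
Proof.
move=> [u Du <-] [v Dv <-]; exists (a *: u + v); first exact: Tlin.1.2.
by rewrite G1_lin // G2_lin // linearP scalerBr opprD addrACA.
Qed.

Lemma solution_lin l0 : rho l0 -> linear_on (bran At G1 G2 B) (solution l0).
Proof.
move=> hl a f g bf bg; have [D1 T1 E1] := solutionP hl (bran_lin a bf bg).
have [D2 T2 E2] := solutionP hl bf; have [D3 T3 E3] := solutionP hl bg.
apply: (kernel_inj hl) => //; first exact: Tlin.1.2.
- by rewrite Tlin.2 // T2 T3 scalerDr !scalerA mulrC.
- by rewrite E1 G1_lin // G2_lin // linearP opprD addrACA -scalerBr E2 E3.
Qed.

(** The resolvent enters between the bounded map [G2 (RB l0 _)] and the solution
operator at a fixed point [l0]; hence an expansion of the resolvent gives one of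
the M-function, and the graph norm is only met in that bounded map. *)
Lemma M_resolvent l0 lam f : rho l0 -> rho lam -> bran At G1 G2 B f ->
  let w := solution l0 f in let s := lam - l0 in
  M lam f = (G2 w + s *: G2 (RB l0 w)) + (s * s) *: G2 (RB l0 (RB lam w)).
Proof.
move=> h0 hl bf w s; have [Dw Tw Ew] := solutionP h0 bf; rewrite -/w in Dw Tw Ew.
have [_ _ _] := kernel_part hl Dw; rewrite Ew => ->.
have lB := restr_linear B.
have dR l x : rho l -> dom T (RB l x) by move=> h; have [] := res_dom h x.
have -> : T w - lam *: w = (- s) *: w.
  by rewrite Tw -scalerBl opprB.
rewrite (linZf (res_lin lB hl)) scaleNr opprK.
rewrite {1}(res_identity lB w hl h0) -/s.
have D1 := dR l0 w h0; have D2 := dR l0 (RB lam w) h0.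
have D2' : dom T (s *: RB l0 (RB lam w)) by apply: domZ.
rewrite (loD G2_lin) //; last by apply/domZ/domD.
rewrite (loZ G2_lin) //; last exact: domD.
by rewrite (loD G2_lin) // (loZ G2_lin) // scalerDr scalerA addrA.
Qed.

Section AtPoint.
Variables (mu : C).

Lemma M_limit l0 p (a : H -> H) r f : rho l0 -> (0 < p)%N -> 0 < r ->
  punctured_disc mu r `<=` rho ->
  (forall x, lim0 (fun z => z ^+ p *: RB (mu + z) x) (a x)) ->
  bran At G1 G2 B f ->
  lim0 (fun z => z ^+ p *: M (mu + z) f)
    (((mu - l0) * (mu - l0)) *: G2 (RB l0 (a (solution l0 f)))).
Proof.
move=> h0 p0 r0 hr ha bf; set w := solution l0 f; set n := mu - l0.
have bJ := G2_res_blin h0; set J := (fun x => G2 (RB l0 x)) in bJ.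
have LR : lim0 (fun z => J (z ^+ p *: RB (mu + z) w)) (J (a w)).
  exact: (lim0_blin bJ (ha w)).
set g := (fun z => J (z ^+ p *: RB (mu + z) w)) in LR.
pose h z := (z ^+ p *: (G2 w + n *: J w) + z *: (z ^+ p *: J w))
  + ((n * n) *: g z + (z *: ((2 * n) *: g z) + z ^+ 2 *: g z)).
apply: (@lim0_ext _ _ h _ _ r r0).
  move=> z zr; have hz : rho (mu + z) by apply/hr/punctured_disc_add.
  rewrite (M_resolvent h0 hz bf) -/w.
  have -> : mu + z - l0 = n + z by rewrite /n addrAC.
  rewrite /h /g (linZf bJ.1) /J !scalerDr -!addrA; congr (_ + _).
  rewrite !scalerA -2!scalerDl !addrA -scalerDl.
  by congr (_ *: _ + _ *: _); rewrite /n; ring.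
have -> : (n * n) *: G2 (RB l0 (a w)) = (0 + 0) + ((n * n) *: J (a w) + (0 + 0)).
  by rewrite !addr0 add0r.
apply: lim0D; first apply: lim0D.
- exact: (lim0_pow p0 (lim0_cst _)).
- exact: (lim0_small (lim0_pow p0 (lim0_cst _))).
- apply: lim0D; first exact: (lim0_blin (blinZ _ (blin_id K)) LR).
  apply: lim0D; first exact: (lim0_small (lim0_blin (blinZ _ (blin_id K)) LR)).
  exact: (lim0_pow (ltn0Sn 1) LR).
Qed.

(** The factor [s * s] of the previous formula is [(mu - l0 + z) ^+ 2], so each
coefficient combines three consecutive coefficients of the resolvent; the
constant terms only enter at the indices [q] and [q.+1], outside the principal
part. *)
Lemma M_series l0 q E r : rho l0 -> res_laurent (AB B) mu q E r ->
  exists c : nat -> G -> K,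
  [/\ forall k, linear_on (bran At G1 G2 B) (c k),
      (forall k, (k < q)%N -> finite_rank_on setT (E k)) ->
      forall k, (k < q)%N -> finite_rank_on (bran At G1 G2 B) (c k) &
      forall f, bran At G1 G2 B f ->
        pser (fun k => c k f) (fun z => z ^+ q *: M (mu + z) f) r].
Proof.
move=> h0 [r0 hr bA _ ser]; set n := mu - l0; set S := solution l0.
have bJ := G2_res_blin h0; set J := (fun x => G2 (RB l0 x)) in bJ.
have Sl := solution_lin h0; rewrite -/S in Sl.
pose a1 (k : nat) x := if k is k'.+1 then J (E k' x) else 0.
pose a2 (k : nat) x := if k is k'.+1 then a1 k' x else 0.
pose b (k : nat) x := (n * n) *: J (E k x) + ((2 * n) *: a1 k x + a2 k x).
have lJA k : linear (fun x => J (E k x)).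
  by move=> a x y; rewrite (bA k).1 bJ.1.
have la1 k : linear (a1 k).
  by case: k => [|k] a x y /=; rewrite ?scaler0 ?addr0 // (bA k).1 bJ.1.
have la2 k : linear (a2 k).
  by case: k => [|k] a x y /=; rewrite ?scaler0 ?addr0 // la1.
pose c k f := b k (S f) + ((if k == q then G2 (S f) + n *: J (S f) else 0)
   + (if k == q.+1 then J (S f) else 0)).
exists c; split.
- move=> k; rewrite /c /b.
  have lS (f : H -> K) : linear f -> linear_on (bran At G1 G2 B) (fun x => f (S x)).
    by move=> lf; apply: linear_on_comp.
  have lG2S : linear_on (bran At G1 G2 B) (fun f => G2 (S f)).
    move=> a f g bf bg; have [D2 _ _] := solutionP h0 bf.
    by have [D3 _ _] := solutionP h0 bg; rewrite Sl // G2_lin.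
  apply: linear_onD.
    apply: linear_onD; first by apply/linear_onZ/(lS (fun x => J (E k x))).
    by apply: linear_onD; [apply/linear_onZ/lS|apply: lS].
  apply: linear_onD; case: eqP => _; try exact: linear_on0.
    by apply: linear_onD => //; apply/linear_onZ/lS/bJ.1.
  exact/lS/bJ.1.
- move=> frA k kq.
  have frb : finite_rank_on setT (b k).
    have frJ j : (j < q)%N -> finite_rank_on setT (fun x => J (E j x)).
      by move=> jq; apply: (finite_rank_comp bJ.1 (frA j jq)).
    have fr1 j : (j < q)%N -> finite_rank_on setT (a1 j).
      by case: j => [|j] jq; [apply: finite_rank0|apply: frJ; apply: ltnW].
    have fr2 j : (j < q)%N -> finite_rank_on setT (a2 j).
      by case: j => [|j] jq; [apply: finite_rank0|apply: fr1; apply: ltnW].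
    have lZ (d : C) : linear (fun v : K => d *: v) := (blinZ d (blin_id K)).1.
    apply: finite_rankD; first exact: (finite_rank_comp (lZ _) (frJ k kq)).
    apply: finite_rankD; first exact: (finite_rank_comp (lZ _) (fr1 k kq)).
    exact: fr2.
  apply: (@eq_finite_rank _ _ _ _ (fun f => b k (S f))).
    move=> f _; rewrite /c (ltn_eqF kq) (ltn_eqF (ltn_trans kq (ltnSn q))).
    by rewrite !addr0.
  by apply: (@finite_rank_precomp _ H _ _ setT).
move=> f bf; set w := S f.
have s0 : pser (fun k => J (E k w)) (fun z => J (z ^+ q *: RB (mu + z) w)) r.
  exact: (pser_blin bJ (ser w)).
set g := (fun z => J (z ^+ q *: RB (mu + z) w)) in s0.
have s1 := pser_shift s0; have s2 := pser_shift s1.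
apply: (pser_ext _ _ (pserD (pserD (pser_blin (blinZ (n * n) (blin_id K)) s0)
   (pserD (pser_blin (blinZ (2 * n) (blin_id K)) s1) s2))
   (pserD (@pser_mono _ _ (G2 w + n *: J w) q r) (@pser_mono _ _ (J w) q.+1 r)))).
  by move=> k; rewrite /c /b -/w /=; case: k => [|[|k]].
move=> z zr; have hz : rho (mu + z) by apply/hr/punctured_disc_add.
rewrite (M_resolvent h0 hz bf) -/S -/w.
have -> : mu + z - l0 = n + z by rewrite /n addrAC.
rewrite /g (linZf bJ.1) /J !scalerDr !scalerA [RHS]addrC.
congr (_ + _).
  by rewrite -2!scalerDl; congr (_ *: _); rewrite /n; ring.
rewrite -!addrA; congr (_ + _); rewrite -scalerDl; congr (_ *: _).
by rewrite exprSr /n; ring.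
Qed.

Section Reference.
Variable D : {linear K -> G}.
Hypothesis hmu : resolvent_set (AB D) mu.
Local Notation S := (resolvent (AB D) mu).

(** The boundary data for [B] of [S x]: linear in [x], in the range of [G1 - B G2],
and independent of the spectral parameter. *)
Definition boundary_data x := G1 (S x) - B (G2 (S x)).

Lemma dom_S x : dom T (S x). Proof. by have [] := res_dom hmu x. Qed.

Lemma boundary_data_bran x : bran At G1 G2 B (boundary_data x).
Proof. by exists (S x) => //; apply: dom_S. Qed.

Lemma boundary_data_lin : linear boundary_data.
Proof.
have bS := res_blin (restr_linear D) hmu.
move=> a x y; rewrite /boundary_data bS.1 G1_lin ?G2_lin //; try exact: dom_S.
by rewrite linearP scalerBr opprD addrACA.
Qed.

Variables (P : G -> H) (Q : K -> H).
Hypotheses (bP : blin P) (bQ : blin Q).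
Hypothesis PQ : forall u, dom T u ->
  u - S (T u - mu *: u) = P (G1 u) + Q (G2 u).

(** Krein's formula with constant outer factors. The vector [S x - g] solves the
boundary problem with data [boundary_data x], so it is controlled by its boundary
values, and these are expressed by the M-function. Written at the fixed point
[mu], the formula applies the M-function to data that do not depend on [z], the
only data for which its Laurent expansion can be used. *)
Lemma resolvent_sandwich z x : rho (mu + z) ->
  let g := RB (mu + z) (x - z *: S x) in
  let m := M (mu + z) (boundary_data x) in
  g - z *: S g = (S x - z *: S (S x)) - P (boundary_data x) - (P (B m) + Q m).
Proof.
move=> hz g m; have Dw := dom_S x.
have bS := res_blin (restr_linear D) hmu.
have [Du Tu Eu Mu] := kernel_part hz Dw.
have wE : T (S x) - (mu + z) *: S x = x - z *: S x.
  have -> : T (S x) = x + mu *: S x := res_eq hmu x.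
  by rewrite scalerDl opprD addrA addrK.
rewrite wE -/g in Du Tu Eu Mu; set u := S x - g in Du Tu Eu Mu.
have mE : m = G2 u by exact: Mu.
have := PQ Du.
have -> : T u - mu *: u = z *: u by rewrite Tu scalerDl addrC addKr.
have -> : G1 u = boundary_data x + B m by rewrite /boundary_data -Eu mE subrK.
rewrite -mE (linDf bP.1) (linZf bS.1) /u (linBf bS.1) scalerBr => E.
have -> : g - z *: S g = (S x - z *: S (S x)) - (S x - g - (z *: S (S x) - z *: S g)).
  have -> : S x - g - (z *: S (S x) - z *: S g) = (S x - z *: S (S x)) - (g - z *: S g).
    by rewrite opprD addrACA -opprD.
  by rewrite opprB addrCA subrr addr0.
by rewrite E -[P _ + _ + _]addrA [in LHS]opprD addrA.
Qed.

Let L k := P (B k) + Q k.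

Let bL : blin L.
Proof. by apply: blinD => //; apply: blin_comp => //; apply/blin_continuous. Qed.

Let bS : blin S := res_blin (restr_linear D) hmu.

(** Leading coefficients across the previous formula: those of the resolvent vanish
as soon as those of the M-function do. *)
Lemma resolvent_limit p (a : H -> H) (b : G -> K) r x : (0 < p)%N -> 0 < r ->
  punctured_disc mu r `<=` rho ->
  (forall x, lim0 (fun z => z ^+ p *: RB (mu + z) x) (a x)) ->
  lim0 (fun z => z ^+ p *: M (mu + z) (boundary_data x)) (b (boundary_data x)) ->
  a x = - L (b (boundary_data x)).
Proof.
move=> p0 r0 hr ha hb; have lB := restr_linear B.
have L1 : lim0 (fun z => z ^+ p *: RB (mu + z) (x - z *: S x)) (a x).
  apply: (@lim0_ext _ _ (fun z => z ^+ p *: RB (mu + z) x +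
     (-1) *: (z *: (z ^+ p *: RB (mu + z) (S x)))) _ _ r r0).
    move=> z zr; have hz : rho (mu + z) by apply/hr/punctured_disc_add.
    have Rl := res_lin lB hz.
    by rewrite (linBf Rl) (linZf Rl) scalerBr scaleN1r !scalerA mulrC.
  rewrite -[X in lim0 _ X]addr0; apply: lim0D => //.
  rewrite -[X in lim0 _ X](scaler0 _ (-1)).
  exact: (lim0_blin (blinZ _ (blin_id H)) (lim0_small (ha (S x)))).
have L2 : lim0 (fun z => z ^+ p *: RB (mu + z) (x - z *: S x) +
    (-1) *: (z *: S (z ^+ p *: RB (mu + z) (x - z *: S x)))) (a x).
  rewrite -[X in lim0 _ X]addr0; apply: lim0D => //.
  rewrite -[X in lim0 _ X](scaler0 _ (-1)).
  exact: (lim0_blin (blinZ _ (blin_id H)) (lim0_small (lim0_blin bS L1))).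
apply: lim0_uniq L2 _.
pose h z := (z ^+ p *: (S x - P (boundary_data x)) + (-1) *: (z *: (z ^+ p *: S (S x))))
   + (-1) *: L (z ^+ p *: M (mu + z) (boundary_data x)).
apply: (@lim0_ext _ _ h _ _ r r0).
  move=> z zr; have hz : rho (mu + z) by apply/hr/punctured_disc_add.
  rewrite (linZf bS.1) !scaleN1r [z *: (z ^+ p *: S _)]scalerA mulrC -scalerA.
  rewrite -scalerBr (resolvent_sandwich x hz) /h (linZf bL.1) !scaleN1r.
  rewrite [z *: (z ^+ p *: S (S x))]scalerA [z * _]mulrC -scalerA -!scalerBr.
  by rewrite [S x - _ - _]addrAC.
have -> : - L (b (boundary_data x)) = (0 + (-1) *: 0) + (-1) *: L (b (boundary_data x)).
  by rewrite scaler0 !add0r scaleN1r.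
apply: lim0D; last exact: (lim0_blin (blin_comp (blinZ (-1) (blin_id H)) bL) hb).
apply: lim0D; first exact: (lim0_pow p0 (lim0_cst _)).
apply: (lim0_blin (blinZ (-1) (blin_id H))).
exact: (lim0_small (lim0_pow p0 (lim0_cst _))).
Qed.

(** The sandwich formula expands [(1 - z S) R (mu + z) (1 - z S)] pointwise. Division
by the left factor is possible vector by vector. Cauchy's estimate then gives
operator bounds for the coefficients, which the division on the right needs. *)
Lemma laurent_from_M p (c : nat -> G -> K) r : 0 < r ->
  punctured_disc mu r `<=` rho ->
  (forall k, linear_on (bran At G1 G2 B) (c k)) ->
  (forall k, (k < p)%N -> finite_rank_on (bran At G1 G2 B) (c k)) ->
  (forall f, bran At G1 G2 B f ->
     pser (fun k => c k f) (fun z => z ^+ p *: M (mu + z) f) r) ->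
  exists E s, res_laurent (AB B) mu p E s /\
    forall k, (k < p)%N -> finite_rank_on setT (E k).
Proof.
move=> r0 hr lc frc serc; have lB := restr_linear B.
pose e (k : nat) x := - L (c k (boundary_data x))
   + ((if k == p then S x - P (boundary_data x) else 0) - (if k == p.+1 then S (S x) else 0)).
have le k : linear (e k).
  have lo (f : H -> H) : linear_on setT f -> linear f by move=> lf a x y; apply: lf.
  have bdata (W : lmodType C) (f : G -> W) : linear_on (bran At G1 G2 B) f ->
      linear_on setT (fun x => f (boundary_data x)).
    by move=> lf a x y _ _; rewrite boundary_data_lin lf //; apply: boundary_data_bran.
  have lN (f : H -> H) : linear_on setT f -> linear_on setT (fun x => - f x).
    by move=> lf a x y _ _; rewrite lf // opprD scalerN.
  apply: lo; apply: linear_onD.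
    by apply/lN/(linear_on_comp bL.1)/bdata.
  apply: linear_onD; last first.
    by apply: lN; case: eqP => _; [move=> a x y _ _; rewrite !bS.1|apply: linear_on0].
  case: eqP => _; last exact: linear_on0.
  apply: linear_onD; first by move=> a x y _ _; rewrite bS.1.
  by apply/lN/(linear_on_comp bP.1) => a x y _ _; rewrite boundary_data_lin.
have sere x : pser (fun k => e k x)
    (fun z => (z ^+ p *: RB (mu + z) (x - z *: S x)) -
        z *: S (z ^+ p *: RB (mu + z) (x - z *: S x))) r.
  have sc := pser_blin (blinN bL) (serc _ (boundary_data_bran x)).
  apply: (pser_ext _ _ (pserD sc (pserD (@pser_mono _ _ (S x - P (boundary_data x)) p r)
     (pser_blin (blinN (blin_id H)) (@pser_mono _ _ (S (S x)) p.+1 r))))) => //.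
  move=> z zr; have hz : rho (mu + z) by apply/hr/punctured_disc_add.
  rewrite (linZf bS.1) [z *: (z ^+ p *: S _)]scalerA [z * _]mulrC -scalerA.
  rewrite -[in RHS]scalerBr (resolvent_sandwich x hz) (linZf bL.1) addrC exprSr -scalerA.
  by rewrite -!scalerBr [S x - _ - _]addrAC.
have [r1 /andP[r10 r1r] Hr1] := div_left bS r0.
pose y := fix y (k : nat) (x : H) := if k is k'.+1 then e k x + S (y k' x) else e 0%N x.
have yS k x : y k.+1 x = e k.+1 x + S (y k x) by [].
have ly k : linear (y k).
  elim: k => [|k IH]; first exact: le.
  move=> a u v; rewrite !yS le IH bS.1.
  by move: (e k.+1 u) (e k.+1 v) => e1 e2; rewrite scalerDr addrACA.
have sery x : pser (fun k => y k x) (fun z => z ^+ p *: RB (mu + z) (x - z *: S x)) r1.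
  by apply: (Hr1 (fun k => e k x)) (sere x).
have [q q0 qE] : exists2 q : R, 0 < q & q = r1 / 4.
  by exists (r1 / 4); rewrite ?divr_gt0.
have hq (t : R) : rho (mu + q%:C%C * cis t).
  apply/hr/punctured_disc_add; rewrite nrmM nrm_cis mulr1 nrm_real_gt0 // q0 /=.
  by rewrite qE; lra.
have [m m0 Hm] := res_circle_bound lB (fun t _ => hq t).
have [d d0 Hd] := blin_gt0 bS.
pose c0 := q ^+ p * (m * (1 + q * d)).
have c00 : 0 <= c0 by rewrite !mulr_ge0 ?exprn_ge0 ?addr_ge0 ?mulr_ge0 // ltW.
have yb k x : nrm (y k x) <= c0 * q^-1 ^+ k * nrm x.
  rewrite mulrAC; apply: (cauchy_bound k (sery x)).
    by apply/andP; split; rewrite qE; lra.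
  move=> t ht; rewrite nrmZ nrmX nrmM nrm_cis mulr1 nrm_real_gt0 // /c0 -!mulrA.
  rewrite ler_wpM2l ?exprn_ge0 ?(ltW q0) //; apply: le_trans (Hm t ht _) _.
  rewrite ler_wpM2l //; apply: le_trans (nrmB _ _) _.
  rewrite nrmZ nrmM nrm_cis mulr1 nrm_real_gt0 // mulrDl mul1r lerD2l.
  by have := ler_wpM2l (ltW q0) (Hd x); rewrite mulrA.
have by_ k : blin (y k) by split; [exact: ly|exists (c0 * q^-1 ^+ k)].
have i0 : 0 <= q^-1 by rewrite invr_ge0 ltW.
have [r2 /andP[r20 r2r] Hr2] := div_right H bS r10 c00 i0.
have [bE HE Eser] := Hr2 y (quot_coef S y) (fun z x => z ^+ p *: RB (mu + z) x)
   by_ yb (fun _ => erefl) (fun _ _ => erefl) sery.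
exists (quot_coef S y), r2; split.
  split=> //; apply: subset_trans (punctured_disc_sub _) hr.
  exact: le_trans r2r r1r.
apply: quot_coef_finite_rank => k kp.
have fre j : (j < p)%N -> finite_rank_on setT (e j).
  move=> jp; apply: (@eq_finite_rank _ _ _ _ (fun x => - L (c j (boundary_data x)))).
    by move=> x _; rewrite /e (ltn_eqF jp) (ltn_eqF (ltn_trans jp (ltnSn p))) subr0 addr0.
  apply: (finite_rank_comp (blinN bL).1).
  by apply: (finite_rank_precomp _ (frc j jp)) => x _; apply: boundary_data_bran.
elim: k kp => [|k IH] kp; first exact: fre.
apply: finite_rankD; first exact: fre.
by apply: (finite_rank_comp bS.1); apply: IH; apply: ltnW.
Qed.

End Reference.
End AtPoint.
End Mfunction.

Lemma M_Laurent_pser (B : {linear K -> G}) mu p Mn : M_Laurent At G1 G2 B mu p Mn ->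
  exists2 r : R, 0 < r & punctured_disc mu r `<=` resolvent_set (AB B) /\
    forall f, bran At G1 G2 B f -> pser (fun k => Mn (k%:Z - p%:Z) f)
      (fun z => z ^+ p *: Mfun At G1 G2 B (mu + z) f) r.
Proof.
move=> [p0 _ _ [r r0 [hr HM]]]; exists r => //; split=> // f bf z zr.
have z0 : z != 0 by rewrite -nrm_gt0; case/andP: zr.
have := HM _ _ (punctured_disc_add mu zr) bf => h.
apply: eq_cvgn (blin_cvg (blinZ (z ^+ p) (blin_id K)) h) => N.
by rewrite /= Laurent_sumE // scalerA mulfV ?scale1r // expf_neq0.
Qed.

Lemma pser_M_Laurent (B : {linear K -> G}) mu p (c : nat -> G -> K) (r : R) :
  (0 < p)%N -> 0 < r -> punctured_disc mu r `<=` resolvent_set (AB B) ->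
  (forall k, linear_on (bran At G1 G2 B) (c k)) ->
  (exists2 f, bran At G1 G2 B f & c 0%N f != 0) ->
  (forall f, bran At G1 G2 B f -> pser (fun k => c k f)
      (fun z => z ^+ p *: Mfun At G1 G2 B (mu + z) f) r) ->
  M_Laurent At G1 G2 B mu p (fun n => c (absz (n + p%:Z))).
Proof.
move=> p0 r0 hr lc [f0 bf0 cf0] ser.
split; [exact: p0|by move=> n _; apply: lc|by exists f0; rewrite ?addNr|].
exists r => //; split=> // lam f /punctured_discP; set z := lam - mu => zr bf.
have lE : lam = mu + z by rewrite /z addrC subrK.
have z0 : z != 0 by rewrite -nrm_gt0; case/andP: zr.
have h := blin_cvg (blinZ (z ^- p) (blin_id K)) (ser f bf z zr).
rewrite /= scalerA mulVf ?expf_neq0 // scale1r -lE in h.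
apply: eq_cvgn h => N; rewrite lE Laurent_sumE //; congr (_ *: _).
by apply: eq_bigr => k _; rewrite subrK.
Qed.

(** * Comparison of the two pole orders *)

Section Conclusion.
Variables (mu : C) (B D : {linear K -> G}).
Hypotheses (B_bounded : continuous B) (hmu : resolvent_set (AB D) mu).

Lemma punctured_point (r : R) : 0 < r ->
  punctured_disc mu r `<=` resolvent_set (AB B) ->
  resolvent_set (AB B) (mu + (r / 2)%:C%C).
Proof.
move=> r0; apply; apply: punctured_disc_add; rewrite nrm_real_gt0 //; last lra.
by apply/andP; split; lra.
Qed.

(** If the coefficient of index [- q] of the M-function vanished, so would that of
the resolvent, by [resolvent_limit]. *)
Lemma isolated_common_order : isolated_eigenvalue_of_finite_multiplicity (AB B) mu ->
  exists q E r Mn, [/\ (0 < q)%N,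
    res_laurent (AB B) mu q E r /\ (exists x, E 0%N x != 0),
    M_Laurent At G1 G2 B mu q Mn &
    forall n, - q%:Z <= n < 0 -> finite_rank_on (bran At G1 G2 B) (Mn n)].
Proof.
have lB := restr_linear B.
move=> [ev [_ [r0 r00 hr0]] [Pr HPr frP]].
have [p0 [E0 [r [hE0 frE0]]]] := riesz_laurent lB r00 hr0 HPr frP.
have [q [E [q0 hE [x0 Ex0] frE]]] := res_laurent_normalize lB hE0 ev frE0.
have [rp hr _ _ _] := hE.
have [c [lc frc serc]] := M_series (punctured_point rp hr) hE.
exists q, E, r, (fun n => c (absz (n + q%:Z))); split=> //.
- by split=> //; exists x0.
- apply: (pser_M_Laurent q0 rp hr lc _ serc).
  apply: contrapT => H0.
  have c0 f : bran At G1 G2 B f -> c 0%N f = 0.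
    by move=> bf; apply/eqP; apply: contrapT => /negP h; apply: H0; exists f.
  have [P [Q [bP bQ PQ]]] := boundary_values hmu.
  have := resolvent_limit B_bounded hmu bP bQ PQ q0 rp hr
     (fun x => res_laurent_lim x hE) (pser_lim0 rp (serc _ (boundary_data_bran B hmu x0))).
  rewrite c0 ?linear0; last exact: boundary_data_bran.
  by rewrite (lin0 bP.1) (lin0 bQ.1) addr0 oppr0 => E00; rewrite E00 eqxx in Ex0.
- move=> n /andP[n1 n2]; apply: frc => //; lia.
Qed.

(** If the coefficient of index [- p] of the resolvent vanished, so would that of the
M-function, by [M_limit]. *)
Lemma M_pole_isolated : M_pole_of_finite_multiplicity At G1 G2 B mu ->
  isolated_eigenvalue_of_finite_multiplicity (AB B) mu.
Proof.
have lB := restr_linear B.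
move=> [p [Mn [hM frM]]]; have [p0 lM [f bf Mf] _] := hM.
have [r r0 [hr serM]] := M_Laurent_pser hM.
have [P [Q [bP bQ PQ]]] := boundary_values hmu.
have [||E [s [hE frE]]] := laurent_from_M B_bounded hmu bP bQ PQ r0 hr _ _ serM.
- by move=> k; apply: lM; lia.
- by move=> k kp; apply: frM; lia.
apply: (laurent_isolated lB p0 hE _ frE).
apply: contrapT => H0.
have E0 x : E 0%N x = 0.
  by apply/eqP; apply: contrapT => /negP h; apply: H0; exists x.
have h0 := punctured_point r0 hr.
have [s0 hs _ _ _] := hE.
have := M_limit h0 p0 s0 hs (fun x => res_laurent_lim x hE) bf.
rewrite E0 (lin0 (G2_res_blin h0).1) scaler0 => L1.
have := lim0_uniq L1 (pser_lim0 r0 (serM f bf)).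
by rewrite sub0r => /esym M0; rewrite M0 eqxx in Mf.
Qed.

Lemma pole_orders : isolated_eigenvalue_of_finite_multiplicity (AB B) mu ->
  forall p, resolvent_pole (AB B) mu p <-> M_pole At G1 G2 B mu p.
Proof.
have lB := restr_linear B.
move=> /isolated_common_order [q [E [r [Mn [q0 [hE [x Ex]] hM _]]]]] p; split.
  move=> /pole_lim [a [La [y ay]]].
  have -> : p = q; last by exists Mn.
  apply: (@order_uniq R H setT H (fun z x => resolvent (AB B) (mu + z) x) a (E 0%N)).
  - by move=> u _; apply: La.
  - by move=> u _; apply: res_laurent_lim hE.
  - by exists y.
  - by exists x.
move=> [Mp hMp]; have [r1 r10 [_ s1]] := M_Laurent_pser hM.
have [r2 r20 [_ s2]] := M_Laurent_pser hMp.
have -> : p = q; last by apply: (laurent_pole q0 hE); exists x.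
have [_ _ [f bf Mf] _] := hM; have [_ _ [g bg Mg] _] := hMp.
apply: (@order_uniq R G (bran At G1 G2 B) K (fun z f => Mfun At G1 G2 B (mu + z) f)
  (Mp (- p%:Z)) (Mn (- q%:Z))).
- by move=> u bu; have := pser_lim0 r20 (s2 u bu); rewrite sub0r.
- by move=> u bu; have := pser_lim0 r10 (s1 u bu); rewrite sub0r.
- by exists g.
- by exists f.
Qed.
End Conclusion.
End Triplet.

Theorem theorem4p10 (R : realType) (H G K : hilbert R)
  (A At : operator H)
  (A_linear : is_linear A) (At_linear : is_linear At)
  (A_closed : closed_operator A) (At_closed : closed_operator At)
  (A_dense : dense (dom A)) (At_dense : dense (dom At))
  (A_At : adjoint_pair A At)
  (G1 : H -> G) (G2 : H -> K) (Gt1 : H -> K) (Gt2 : H -> G)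
  (triplet : boundary_triplet A At G1 G2 Gt1 Gt2)
  (mu : R[i]) (B C : {linear K -> G})
  (B_bounded : continuous B) (C_bounded : continuous C)
  (rho_B : resolvent_set (restr At G1 G2 B) !=set0)
  (rho_C :
     (resolvent_set (restr At G1 G2 C) mu /\
      resolvent_set (restr At G1 G2 (fun k => B k + C k)) mu) \/
     (resolvent_set (restr At G1 G2 C) mu /\
      resolvent_set (restr At G1 G2 (fun k => B k - C k)) mu)) :
  (isolated_eigenvalue_of_finite_multiplicity (restr At G1 G2 B) mu <->
   M_pole_of_finite_multiplicity At G1 G2 B mu) /\
  (isolated_eigenvalue_of_finite_multiplicity (restr At G1 G2 B) mu ->
   forall p : nat, resolvent_pole (restr At G1 G2 B) mu p <->
                   M_pole At G1 G2 B mu p).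

Proof.
have hC : resolvent_set (restr At G1 G2 C) mu by case: rho_C => -[].
split; first split.
- move=> /(isolated_common_order A_dense At_dense A_At triplet B_bounded hC).
  by move=> [q [E [r [M [_ _ hM frM]]]]]; exists q, M.
- exact: (M_pole_isolated A_dense At_dense A_At triplet B_bounded hC).
- exact: (pole_orders A_dense At_dense A_At triplet B_bounded hC).
Qed.
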